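(* Let $X$ be a fully supported three-dimensional standard Gaussian vector with covariance matrix $A=(a_{ij})$ satisfying $\mathrm{Cov}(X_i,X_j)=a_{ij}\in[0,1)$ for $1\le i<j\le 3$. If $a_{ij}>0$ for all $i<j$, then $X^h$ has a color representation for all sufficiently large $h$ if and only if one of the following (nonoverlapping) conditions holds: (i) $\mathbf{1}^TA^{-1}>\mathbf{0}$; (ii) $\min_i \mathbf{1}^TA^{-1}(i)=0$; (iii) $\min_i \mathbf{1}^TA^{-1}(i)<0$ and $\mathbf{1}^TA^{-1}\mathbf{1}<2$. Furthermore, if exactly one of the covariances $a_{12},a_{13},a_{23}$ is equal to zero, then $X^h$ does not have a color representation for large $h$ (i.e. there is $h_0$ such that $X^h$ has no color representation for any $h>h_0$).
   Context: A $\{0,1\}$-valued process $(Y_i)_{i\in S}$ has a color representation (equivalently, is a color process) if there are $p\in[0,1]$ and a random partition $\pi$ of $S$ such that $(Y_i)$ has the same law as the process obtained by sampling $\pi$ and then, independently of $\pi$ and independently for different partition elements, assigning all elements of a partition element the value $1$ with probability $p$ and the value $0$ with probability $1-p$. For a random vector $X=(X_i)$ and $h\in\mathbb{R}$, $X^h=(X^h_i)$ with $X^h_i=I(X_i>h)$. A Gaussian vector is standard if each marginal has mean zero and variance one; it is fully supported if the support of its law is the whole space (equivalently $A$ is positive definite). $\mathbf{1}=(1,1,1)$, $\mathbf{1}^TA^{-1}(i)$ denotes the $i$-th entry of the row vector $\mathbf{1}^TA^{-1}$, and vector inequalities are entrywise. *)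

(* Defs.v *)
From HB Require Import structures.
From mathcomp Require Import all_boot all_order all_algebra.
From mathcomp Require Import all_classical all_reals all_analysis.
Set Implicit Arguments.
Unset Strict Implicit.
Unset Printing Implicit Defensive.
Import Order.TTheory GRing.Theory Num.Theory.
Import numFieldNormedType.Exports.

Local Open Scope classical_set_scope.
Local Open Scope ring_scope.

(** * Gaussian vectors

    Vectors are row vectors; 'rV[R]_n carries the product topology, and its
    Borel sets are <<s open >>. *)

Definition rvec (R : realType) (d : measure_display) (T : measurableType d)
    (P : probability T R) (n : nat) (X : 'I_n -> {RV P >-> R}) (t : T) :
    'rV[R]_n :=
  \row_i X i t.

(** Z_0, ..., Z_(n-1) are independent N(0,1) variables.  Since B ranges over all
    families, including those with some B i = setT, the product rule over the
    full index set gives the one over every subfamily. *)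
Definition iid_std_normal (R : realType) (d : measure_display)
    (T : measurableType d) (P : probability T R) (n : nat)
    (Z : 'I_n -> {RV P >-> R}) : Prop :=
  (forall i (B : set R), measurable B ->
     distribution P (Z i) B = normal_prob 0 1 B) /\
  (forall B : 'I_n -> set R, (forall i, measurable (B i)) ->
     P [set t | forall i, B i (Z i t)] = (\prod_i distribution P (Z i) (B i))%E).

(** X has the law of Z M + mu, with Z made of independent N(0,1) variables;
    singular M are allowed. *)
Definition gaussian_vector (R : realType) (d : measure_display)
    (T : measurableType d) (P : probability T R) (n : nat)
    (X : 'I_n -> {RV P >-> R}) : Prop :=
  exists (d' : measure_display) (T' : measurableType d')
         (P' : probability T' R) (Z : 'I_n -> {RV P' >-> R})
         (M : 'M[R]_n) (mu : 'rV[R]_n),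
    iid_std_normal Z /\
    (forall B : set 'rV[R]_n, <<s open >> B ->
       P [set t | B (rvec X t)] = P' [set t | B (rvec Z t *m M + mu)]).

Definition standard (R : realType) (d : measure_display)
    (T : measurableType d) (P : probability T R) (n : nat)
    (X : 'I_n -> {RV P >-> R}) : Prop :=
  forall i, ('E_P[X i] = 0 /\ 'V_P[X i] = 1)%E.

Definition law_support (R : realType) (d : measure_display)
    (T : measurableType d) (P : probability T R) (n : nat)
    (X : 'I_n -> {RV P >-> R}) : set 'rV[R]_n :=
  [set x | forall U : set 'rV[R]_n, open U -> U x ->
     (0 < P [set t | U (rvec X t)])%E].

Definition fully_supported (R : realType) (d : measure_display)
    (T : measurableType d) (P : probability T R) (n : nat)
    (X : 'I_n -> {RV P >-> R}) : Prop :=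
  law_support X = setT.

Definition threshold (R : realType) (d : measure_display)
    (T : measurableType d) (P : probability T R) (n : nat)
    (X : 'I_n -> {RV P >-> R}) (h : R) : 'I_n -> T -> bool :=
  fun i t => h < X i t.

(** * Color representations of processes with a finite index set *)

(** q is the law of a random partition of S. *)
Definition partition_law (R : realType) (S : finType)
    (q : {set {set S}} -> R) : Prop :=
  [/\ forall pi, 0 <= q pi,
      forall pi, ~~ finset.partition pi [set: S]%SET -> q pi = 0
    & \sum_pi q pi = 1].

(** Conditional probability, given the partition pi, that the coloring is y:
    each block is independently all 1 with probability p, all 0 with
    probability 1 - p. *)
Definition coloring_prob (R : realType) (S : finType) (p : R)
    (pi : {set {set S}}) (y : {ffun S -> bool}) : R :=
  \prod_(B in pi) (p * [forall i in B, y i]%:R +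
                   (1 - p) * [forall i in B, ~~ y i]%:R).

Definition has_color_representation (R : realType) (d : measure_display)
    (T : measurableType d) (P : probability T R) (S : finType)
    (Y : S -> T -> bool) : Prop :=
  exists (p : R) (q : {set {set S}} -> R),
    [/\ 0 <= p <= 1, partition_law q
      & forall y : {ffun S -> bool},
          P [set t | forall i, Y i t = y i] =
          (\sum_pi q pi * coloring_prob p pi y)%:E].

(** * The vector 1^T A^{-1} *)

Definition one_invmx (R : realType) (n : nat) (A : 'M[R]_n) : 'rV[R]_n :=
  const_mx 1 *m invmx A.

Definition min_entry (R : realType) (n : nat) (u : 'rV[R]_n.+1) : R :=
  \big[Num.min/u 0 0]_i u 0 i.

Definition cond_pos (R : realType) (A : 'M[R]_3) : Prop :=
  forall i, 0 < one_invmx A 0 i.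

Definition cond_zero (R : realType) (A : 'M[R]_3) : Prop :=
  min_entry (one_invmx A) = 0.

Definition cond_neg (R : realType) (A : 'M[R]_3) : Prop :=
  min_entry (one_invmx A) < 0 /\
  (one_invmx A *m const_mx 1 : 'M[R]_1) 0 0 < 2.

(* Main.v *)
(** On three sites the weights of a color representation are affine functions of the pair and triple
    probabilities of [X^h], and for large [h] only two constraints matter.  Put [p = P (X_i > h)].
    The one-block partition needs [kappa = E (prod_i (X^h_i - p)) >= 0]; the partition {i, j}, {k}
    needs [P (X_i, X_j > h >= X_k)] to be at least [p^2] up to lower order terms.

    Let {i, j} be the pair of smallest covariance.  Only the [k]-th entry of [1^T A^{-1}] can be
    nonpositive, and in Gram-Schmidt coordinates [X_k] is a nonnegative combination of [X_i] and [X_j]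
    plus an independent normal variable.  So [P (X > h 1)] is at least a product of three
    one-dimensional tails, whose exponent beats that of [p P (X_x, X_y > h)] for every pair: [kappa > 0]
    for large [h] as soon as two covariances are positive.  If the third one vanishes, the partitions
    joining its two sites have total weight 0, which forces [kappa = 0], a contradiction.

    If the [k]-th entry of [1^T A^{-1}] is nonnegative, [P (X_i, X_j > h >= X_k)] has the exponent
    [h^2 / (1 + a_ij)] of [P (X_i, X_j > h)], which beats the exponent [h^2] of [p^2].  If it is
    negative, the exponent is [h^2 (1^T A^{-1} 1) / 2]; when this equals [h^2] the probability is still
    [o (p^2)], because of the polynomial factors. *)

Require Import Defs.
From HB Require Import structures.
From mathcomp Require Import all_boot all_order all_algebra.
From mathcomp Require Import all_classical all_reals all_analysis.
From mathcomp Require Import measurable_realfun ring lra.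
Set Implicit Arguments.
Unset Strict Implicit.
Unset Printing Implicit Defensive.
Import Order.TTheory GRing.Theory Num.Theory.
Import numFieldNormedType.Exports.
Local Open Scope classical_set_scope.
Local Open Scope ring_scope.

(** * Rotation invariance of independent standard normal variables *)

(** The definition of a Gaussian vector only gives an affine image of independent normal variables,
    while each estimate wants coordinates adapted to one pair of sites: Gram-Schmidt for lower
    bounds, sum and difference of the pair for upper bounds. The passage between them is an
    orthogonal map, assembled from plane rotations, transpositions and sign changes, each of which
    preserves [iid3]. Events are then compared with boxes, whose probabilities are products of
    one-dimensional tails [Qtail], so no three-dimensional density appears. When the third
    coordinate is constrained, the squared levels of the optimal box (in units of [h]) add up to
    [1^T A^{-1} 1] in both kinds of coordinates; this is the only way in which the inverse matrix
    enters. At the critical value 2, the product of the tails of the sum and of the residual has the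
    same order as [p^2], polynomial factors included. The missing decay comes from the difference of
    the pair, which is confined to a thin band unless the sum is even larger. *)

Section density.
Context (R : realType).
Local Notation leb := (@lebesgue_measure R).
Local Notation g := (@normal_prob R 0 1).
Local Notation phi := (@normal_pdf R 0 1).
Local Open Scope ereal_scope.
Import HBNNSimple.

(** [normal_prob] is an integral of its density on sets; the identity passes from indicators to
    simple functions by linearity, and to [f] by monotone convergence. *)
Lemma ge0_integral_normal (f : R -> \bar R) :
  measurable_fun [set: R] f -> (forall x, 0 <= f x) ->
  \int[g]_x f x = \int[leb]_x (f x * (phi x)%:E).
Proof.
move=> mf f0.
have mphi : measurable_fun setT (fun x => (phi x)%:E).
  by apply/measurable_EFinP; exact: measurable_normal_pdf.
have phi0 x : 0 <= (phi x)%:E by rewrite lee_fin normal_pdf_ge0.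
have mr (r : R) (B : set R) : measurable B ->
    measurable_fun [set: R] (fun x => (r * \1_B x)%:E).
  by move=> mB; apply/measurable_EFinP; apply: measurable_funM => //; exact: measurable_indic.
pose h := nnsfun_approx measurableT mf.
have mh n : measurable_fun [set: R] (fun x => (h n x)%:E).
  by apply/measurable_EFinP; exact: measurable_funP.
have mp n (r : R) : measurable (h n @^-1` [set r] : set R) by exact: measurable_sfunP.
have ndh a b x : (a <= b)%N -> ((h a x)%:E <= (h b x)%:E)%E.
  by move=> ab; rewrite lee_fin; exact/lefP/nd_nnsfun_approx.
have -> : \int[g]_x f x = limn (fun n => \int[g]_x (EFin \o h n) x).
  rewrite -monotone_convergence//.
  - by apply: eq_integral => x _; apply/esym/cvg_lim => //; exact: cvg_nnsfun_approx.
  - by move=> n x _; rewrite lee_fin.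
  - by move=> x _ a b; exact: ndh.
have -> : \int[leb]_x (f x * (phi x)%:E) =
    limn (fun n => \int[leb]_x ((h n x)%:E * (phi x)%:E)).
  rewrite -monotone_convergence//.
  - apply: eq_integral => x _; apply/esym/cvg_lim => //.
    by apply: cvgeZr => //; exact: cvg_nnsfun_approx.
  - by move=> n; apply: emeasurable_funM => //; exact: mh.
  - by move=> n x _; rewrite mule_ge0// lee_fin.
  - by move=> x _ a b ab; rewrite lee_wpmul2r//; exact: ndh.
suff H n : \int[g]_x (h n x)%:E = \int[leb]_x ((h n x)%:E * (phi x)%:E).
  by congr (limn _); apply/funext => n; rewrite -H.
transitivity (\int[g]_x (\sum_(y \in range (h n)) (y * \1_(h n @^-1` [set y]) x)%:E)).
  by apply: eq_integral => t _; rewrite /= fimfunE -fsumEFin.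
have nn y x : 0 <= (y * \1_(h n @^-1` [set y]) x)%:E.
  exact: nnfun_muleindic_ge0.
rewrite ge0_integral_fsum//; last first.
  by move=> y; exact: (mr y _ (mp n y)).
transitivity (\int[leb]_x (\sum_(y \in range (h n))
    ((y * \1_(h n @^-1` [set y]) x)%:E * (phi x)%:E))); last first.
  apply: eq_integral => x _; rewrite -ge0_mule_fsuml; last by move=> y.
  by congr *%E; rewrite [in RHS]fimfunE -fsumEFin.
rewrite ge0_integral_fsum//; last 2 first.
- by move=> y; apply: emeasurable_funM => //; exact: (mr y _ (mp n y)).
- by move=> y x _; rewrite mule_ge0.
apply: eq_fsbigr => r /[!inE] -[z _ hz].
have r0 : (0 <= r)%R by rewrite -hz.
under eq_integral do rewrite EFinM.
under [RHS]eq_integral do rewrite EFinM -muleA.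
have mi : measurable_fun [set: R] (fun x => (\1_(h n @^-1` [set r]) x)%:E : \bar R).
  by apply/measurable_EFinP; apply: measurable_indic; exact: (mp n r).
rewrite ge0_integralZl//.
rewrite ge0_integralZl//; last 2 first.
- exact: emeasurable_funM.
- by move=> x _; rewrite mule_ge0// lee_fin.
congr *%E; rewrite integral_indic//; last exact: (mp n r).
rewrite setIT.
transitivity (\int[leb]_x ((fun x => (phi x)%:E) \_ (h n @^-1` [set r])) x).
  exact: integral_mkcond.
apply: eq_integral => x _.
by rewrite patchE indicE; case: ifPn => _; rewrite ?mul1e ?mul0e.
Qed.

(** The image of Lebesgue measure under a translation has the same values on half-open intervals,
    hence is Lebesgue measure by uniqueness. *)
Lemma ge0_integral_shift (c : R) (f : R -> \bar R) :
  measurable_fun [set: R] f -> (forall x, 0 <= f x) ->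
  \int[leb]_x f (x + c)%R = \int[leb]_x f x.
Proof.
move=> mf f0.
pose s : measurableTypeR R -> measurableTypeR R := fun x => (x + c)%R.
have ms : measurable_fun setT s by exact: measurable_funD.
rewrite -[LHS](@ge0_integral_pushforward _ _ _ _ _ s ms leb setT f)//=.
apply: eq_measure_integral => A mA _; apply/esym.
apply: (@lebesgue_measure_unique R (pushforward leb s)) => // _ [[a b]] _ <-.
have E : s @^-1` `]a, b]%classic = `](a - c)%R, (b - c)%R]%classic.
  by apply/seteqP; split => x /=; rewrite /s !in_itv/= ltrBlDr lerBrDr.
transitivity (leb `](a - c)%R, (b - c)%R]%classic); last by rewrite -E.
rewrite !lebesgue_measure_itv/= !lte_fin ltrD2r; case: ifP => // _.
by rewrite -!EFinB; congr EFin; ring.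
Qed.

End density.

Section rotation.
Context (R : realType).
Local Notation leb := (@lebesgue_measure R).
Local Notation g := (@normal_prob R 0 1).
Local Notation phi := (@normal_pdf R 0 1).
Local Open Scope ereal_scope.

Lemma integral_shear2 (t : R) (F : R * R -> \bar R) :
  measurable_fun [set: R * R] F -> (forall z, 0 <= F z) ->
  \int[leb]_x \int[leb]_y F (x, y + t * x)%R = \int[leb]_x \int[leb]_y F (x, y).
Proof.
move=> mF F0; apply: eq_integral => x _.
apply: (ge0_integral_shift (t * x)%R (f := fun y => F (x, y))) => //.
exact: measurableT_comp.
Qed.

(** For fixed [y] this is a translation in [x], which Tonelli makes the inner variable. *)
Lemma integral_shear1 (t : R) (F : R * R -> \bar R) :
  measurable_fun [set: R * R] F -> (forall z, 0 <= F z) ->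
  \int[leb]_x \int[leb]_y F (x + t * y, y)%R = \int[leb]_x \int[leb]_y F (x, y).
Proof.
move=> mF F0.
have m1 : measurable_fun [set: R * R] (fun z : R * R => (z.1 + t * z.2, z.2)%R).
  apply/measurable_fun_pairP; split => /=; last exact: measurable_snd.
  apply: measurable_funD; first exact: measurable_fst.
  by apply: measurable_funM => //; exact: measurable_snd.
pose F1 (z : R * R) := F (z.1 + t * z.2, z.2)%R.
have mF1 : measurable_fun [set: R * R] F1 by exact: (measurableT_comp mF m1).
have F10 z : 0 <= F1 z by exact: F0.
apply: (etrans (@fubini_tonelli _ _ _ _ _ leb leb F1 mF1 F10)).
apply: (etrans _ (esym (@fubini_tonelli _ _ _ _ _ leb leb F mF F0))).
apply: eq_integral => y _.
apply: (ge0_integral_shift (t * y)%R (f := fun x => F (x, y))) => //.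
exact: measurableT_comp.
Qed.

(* A rotation of angle [th] is a product of three shears, with parameters [t], [- sin th] and [t]
   for [t = tan (th / 2)]; each of them preserves the Lebesgue measure. *)
Lemma integral_rot (c s : R) (F : R * R -> \bar R) :
  (0 <= c)%R -> (c ^+ 2 + s ^+ 2 = 1)%R ->
  measurable_fun [set: R * R] F -> (forall z, 0 <= F z) ->
  \int[leb]_x \int[leb]_y F (c * x + s * y, - s * x + c * y)%R =
  \int[leb]_x \int[leb]_y F (x, y).
Proof.
move=> c0 cs mF F0.
pose t := (s / (1 + c))%R.
have ts : (t * s = 1 - c)%R.
  have c1 : (1 + c != 0)%R by lra.
  apply: (mulIf c1); rewrite /t mulrAC divfK//; lra.
have tc : (t * (1 + c) = s)%R.
  by rewrite /t divfK//; lra.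
have cE : c = (1 - t * s)%R by lra.
have sE : s = (t * (2 - t * s))%R by rewrite -[LHS]tc; congr (_ * _)%R; lra.
pose F1 z := F (z.1 + t * z.2, z.2)%R.
pose F2 z := F1 (z.1, z.2 + (- s) * z.1)%R.
have m1 : measurable_fun [set: R * R] F1.
  apply: measurableT_comp => //.
  apply/measurable_fun_pairP; split => /=; last exact: measurable_snd.
  apply: measurable_funD; first exact: measurable_fst.
  by apply: measurable_funM => //; exact: measurable_snd.
have m2 : measurable_fun [set: R * R] F2.
  apply: measurableT_comp => //.
  apply/measurable_fun_pairP; split => /=; first exact: measurable_fst.
  apply: measurable_funD; first exact: measurable_snd.
  by apply: measurable_funM => //; exact: measurable_fst.
have F10 z : 0 <= F1 z by exact: F0.
have F20 z : 0 <= F2 z by exact: F0.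
apply: (etrans _ (integral_shear1 t mF F0)).
apply: (etrans _ (integral_shear2 (- s) m1 F10)).
apply: (etrans _ (integral_shear1 t m2 F20)).
apply: eq_integral => x _; apply: eq_integral => y _.
rewrite /F2 /F1 /=; congr (F (_, _)); last first.
  by rewrite cE; ring.
transitivity ((1 - t * s) * x + (t * (2 - t * s)) * y)%R; last by ring.
by rewrite -cE -sE.
Qed.

Lemma normal_prod_normalE (E : set (R * R)) : measurable E ->
  (g \x g) E = \int[leb]_x \int[leb]_y (\1_E (x, y) * (phi x * phi y))%:E.
Proof.
move=> mE.
have mphi : measurable_fun [set: R] (fun x => (phi x)%:E).
  by apply/measurable_EFinP; exact: measurable_normal_pdf.
rewrite /product_measure1 ge0_integral_normal//=; last first.
  exact: (measurable_fun_xsection g).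
apply: eq_integral => x _.
have mx : measurable (xsection E x) by exact: measurable_xsection.
transitivity (\int[g]_y (\1_(xsection E x) y)%:E * (phi x)%:E).
  by rewrite integral_indic// setIT.
rewrite ge0_integral_normal//=; last first.
  by apply/measurable_EFinP; apply: measurable_indic; exact: measurable_xsection.
rewrite -ge0_integralZr//=.
- apply: eq_integral => y _; rewrite -!EFinM; congr EFin.
  have -> : \1_(xsection E x) y = \1_E (x, y) :> R.
    by rewrite !indicE mem_xsection.
  by ring.
- apply: emeasurable_funM => //.
  by apply/measurable_EFinP; apply: measurable_indic; exact: measurable_xsection.
- by move=> y _; rewrite mule_ge0// lee_fin normal_pdf_ge0.
- by rewrite lee_fin normal_pdf_ge0.
Qed.

(** The density [phi x * phi y] depends only on [x^2 + y^2], and the rotation preserves the Lebesgue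
    integral. *)
Lemma normal_prod_rot (c s : R) (E : set (R * R)) :
  (0 <= c)%R -> (c ^+ 2 + s ^+ 2 = 1)%R -> measurable E ->
  (g \x g) ((fun z => (c * z.1 + s * z.2, - s * z.1 + c * z.2)%R) @^-1` E) =
  (g \x g) E.
Proof.
move=> c0 cs mE.
pose r (z : R * R) := (c * z.1 + s * z.2, - s * z.1 + c * z.2)%R.
have mr : measurable_fun [set: R * R] r.
  apply/measurable_fun_pairP; split => /=; apply: measurable_funD; apply: measurable_funM => //;
    solve [exact: measurable_fst | exact: measurable_snd].
have mphi (f : R * R -> R) : measurable_fun [set: R * R] f ->
    measurable_fun [set: R * R] (fun x => (phi (f x))).
  move=> mf; exact: (measurableT_comp (measurable_normal_pdf 0 1) mf).
pose G z := (\1_E z * (phi z.1 * phi z.2))%:E.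
have mG : measurable_fun [set: R * R] G.
  apply/measurable_EFinP; apply: measurable_funM; first exact: measurable_indic.
  by apply: measurable_funM; apply: mphi; [exact: measurable_fst|exact: measurable_snd].
have G0 z : 0 <= G z by rewrite lee_fin !mulr_ge0// normal_pdf_ge0.
have mrE : measurable (r @^-1` E) by rewrite -[X in measurable X]setTI; exact: mr.
apply: (etrans (normal_prod_normalE mrE)).
apply: (etrans _ (esym (normal_prod_normalE mE))).
apply: (etrans _ (integral_rot c0 cs mG G0)).
apply: eq_integral => x _; apply: eq_integral => y _.
rewrite /G /=; congr EFin; congr (_ * _)%R.
rewrite !normal_pdfE// /normal_fun.
set k := normal_peak _.
rewrite mulrACA [RHS]mulrACA -!expRD; congr (_ * expR _)%R.
rewrite !subr0 -!mulrDl; congr (_ / _)%R.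
transitivity (- ((c ^+ 2 + s ^+ 2) * (x ^+ 2 + y ^+ 2)))%R; last by ring.
by rewrite cs; ring.
Qed.
End rotation.

Section iid3.
Context (R : realType).
Local Notation g := (@normal_prob R 0 1).

Lemma normal_prodX (A B : set R) : measurable A -> measurable B ->
  (g \x g)%E (A `*` B) = (g A * g B)%E.
Proof. by move=> mA mB; exact: (product_measure1E g g mA mB). Qed.

Lemma normal_prob_setT : g setT = 1%E.
Proof. exact: probability_setT. Qed.

(** The symmetry of the normal law is read off from a quarter turn: it pulls [setT] times [A] back
    to the set of pairs whose first coordinate has its opposite in [A]. *)
Lemma normal_prob_scale_sign (e : R) (A : set R) :
  e ^+ 2 = 1 -> measurable A -> g [set x | A (e * x)] = g A.
Proof.
move=> e2 mA.
have [->|->] : e = 1 \/ e = -1.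
  have /eqP : (e - 1) * (e + 1) = 0 by ring: e2.
  by rewrite mulf_eq0 => /orP[]/eqP ?; [left|right]; lra.
  by congr (g _); apply/seteqP; split => x /=; rewrite mul1r.
have mN : measurable [set x : R | A (-1 * x)].
  rewrite -[X in measurable X]setTI; have : measurable_fun [set: R] (fun x : R => -1 * x) by exact: measurable_funM.
  exact.
have c0 : (0 : R) ^+ 2 + 1 ^+ 2 = 1 by rewrite expr0n /= expr1n add0r.
have mAN := measurableX (@measurableT _ R) mA.
have E : (fun z : R * R => (0 * z.1 + 1 * z.2, - 1 * z.1 + 0 * z.2)) @^-1` ([set: R] `*` A)
    = [set x : R | A (-1 * x)] `*` [set: R].
  by apply/seteqP; split => -[x y] /=; rewrite mul0r addr0; case.
have := normal_prod_rot (lexx 0) c0 mAN; rewrite E.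
by rewrite !normal_prodX// normal_prob_setT mule1 mul1e.
Qed.

Context d (T : measurableType d) (P : probability T R).

(** The nesting [(R * R) * R] makes the first two coordinates a point of the plane, on which the
    rotations act. *)
Definition iid3 (N : T -> R * R * R) : Prop :=
  measurable_fun setT N /\
  forall A B C : set R, measurable A -> measurable B -> measurable C ->
    P [set t | [/\ A (N t).1.1, B (N t).1.2 & C (N t).2]] = (g A * g B * g C)%E.

Definition perm01 (x : R * R * R) := (x.1.2, x.1.1, x.2).
Definition perm12 (x : R * R * R) := (x.1.1, x.2, x.1.2).
Definition sgn3 (e0 e1 e2 : R) (x : R * R * R) := (e0 * x.1.1, e1 * x.1.2, e2 * x.2).
Definition rot01 (c s : R) (x : R * R * R) :=
  (c * x.1.1 + s * x.1.2, - s * x.1.1 + c * x.1.2, x.2).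

Lemma measurable_fun_triple (f : R * R * R -> R * R * R) :
  measurable_fun setT (fun x => (f x).1.1) -> measurable_fun setT (fun x => (f x).1.2) ->
  measurable_fun setT (fun x => (f x).2) -> measurable_fun setT f.
Proof.
move=> m1 m2 m3; apply/measurable_fun_pairP; split => //.
by apply/measurable_fun_pairP; split.
Qed.

Let m1 : measurable_fun setT (fun x : R * R * R => x.1.1).
Proof. exact: (measurableT_comp (@measurable_fst _ _ _ _) (@measurable_fst _ _ _ _)). Qed.
Let m2 : measurable_fun setT (fun x : R * R * R => x.1.2).
Proof. exact: (measurableT_comp (@measurable_snd _ _ _ _) (@measurable_fst _ _ _ _)). Qed.
Let m3 : measurable_fun setT (fun x : R * R * R => x.2).
Proof. exact: measurable_snd. Qed.

Lemma iid3_perm01 N : iid3 N -> iid3 (perm01 \o N).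
Proof.
move=> [mN h]; split=> [|A B C mA mB mC].
  by apply: measurableT_comp => //; apply: measurable_fun_triple.
rewrite [(g A * g B)%E]muleC -h//; congr (P _).
by apply/seteqP; split => t /= [].
Qed.

Lemma iid3_perm12 N : iid3 N -> iid3 (perm12 \o N).
Proof.
move=> [mN h]; split=> [|A B C mA mB mC].
  by apply: measurableT_comp => //; apply: measurable_fun_triple.
rewrite muleAC -h//; congr (P _).
by apply/seteqP; split => t /= [].
Qed.

Lemma iid3_sgn e0 e1 e2 N : e0 ^+ 2 = 1 -> e1 ^+ 2 = 1 -> e2 ^+ 2 = 1 ->
  iid3 N -> iid3 (sgn3 e0 e1 e2 \o N).
Proof.
move=> h0 h1 h2 [mN h]; split=> [|A B C mA mB mC].
  by apply: measurableT_comp => //; apply: measurable_fun_triple; apply: measurable_funM.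
have me (e : R) (D : set R) : measurable D -> measurable [set x : R | D (e * x)].
  move=> mD; rewrite -[X in measurable X]setTI.
  have : measurable_fun [set: R] (fun x : R => e * x) by exact: measurable_funM.
  exact.
rewrite -(normal_prob_scale_sign h0 mA) -(normal_prob_scale_sign h1 mB).
by rewrite -(normal_prob_scale_sign h2 mC) -h//; exact: me.
Qed.

(** On the event that the third coordinate lies in [C], the first two have the law [g \x g] scaled
    by [g C], by uniqueness of the product measure; the planar rotation invariance then applies. *)
Lemma iid3_rot01 c s N : 0 <= c -> c ^+ 2 + s ^+ 2 = 1 ->
  iid3 N -> iid3 (rot01 c s \o N).
Proof.
move=> c0 cs [mN h]; split=> [|A B C mA mB mC].
  apply: measurableT_comp => //; apply: measurable_fun_triple => //=;
    by apply: measurable_funD; apply: measurable_funM.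
have mN12 : measurable_fun setT (fun t => (N t).1).
  by apply: measurableT_comp => //; exact: measurable_fst.
have mN3 : measurable_fun setT (fun t => (N t).2).
  by apply: measurableT_comp => //; exact: measurable_snd.
pose D := [set t | C (N t).2].
have mD : measurable D by rewrite -[X in measurable X]setTI; exact: mN3.
have gfin : g C \is a fin_num by exact: fin_num_measure.
pose k : {nonneg R} := NngNum (fine_ge0 (measure_ge0 g C)).
have kE : (k%:num%:E = g C)%E by rewrite /= fineK.
pose r (z : R * R) := (c * z.1 + s * z.2, - s * z.1 + c * z.2)%R.
have mr : measurable_fun [set: R * R] r.
  apply/measurable_fun_pairP; split => /=; apply: measurable_funD; apply: measurable_funM => //;
    solve [exact: measurable_fst | exact: measurable_snd].
have key (E : set (R * R)) : measurable E ->
    P ([set t | E (N t).1] `&` D) = ((g \x g) E * g C)%E.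
  move=> mE.
  (* The scale [g C] is loaded on the second marginal, so that the uniqueness theorem sees a product
     of two measures. *)
  have gk : (g \x mscale k g)%E E = ((g \x g) E * g C)%E.
    rewrite /product_measure1 -ge0_integralZr//=.
    - by apply: eq_integral => x _; rewrite /= /mscale kE muleC.
    - exact: (measurable_fun_xsection g).
  rewrite -gk.
    (* [normal_prob] is a measure on [g_sigma_algebraType _], not on the canonical measurable structure
     of [R]; retyping the map makes its pushforward comparable with it. *)
  pose N1 : T -> (g_sigma_algebraType (R.-ocitv.-measurable) *
      g_sigma_algebraType (R.-ocitv.-measurable))%type := fun t => (N t).1.
  have mN1 : measurable_fun setT N1 by exact: mN12.
  pose f := mfun_Sub (mem_set mN1).
  have uniq := @product_measure_unique _ _ _ _ _ g (mscale k g)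
    (pushforward (mrestr P mD) f).
  rewrite uniq//.
  move=> A' B' mA' mB'; rewrite /= /mscale kE muleA -muleA [(g C * _)%E]muleC muleA.
  rewrite -h// /pushforward /mrestr; congr (P _).
  by apply/seteqP; split => t /= [] // => [[]].
rewrite [X in P X](_ : _ = [set t | (r @^-1` (A `*` B)) (N t).1] `&` D); last first.
  by apply/seteqP; split => t /= [] // => [[]].
have mAB := measurableX mA mB.
have mrAB : measurable (r @^-1` (A `*` B)) by rewrite -[X in measurable X]setTI; exact: mr.
by rewrite (key _ mrAB) (normal_prod_rot c0 cs mAB) normal_prodX.
Qed.
End iid3.

(** * Orthogonal changes of coordinates *)

Section frame.
Context (R : realType).
Implicit Types (x y : R * R * R) (f : R * R * R -> R * R * R).

Definition dot3 x y := x.1.1 * y.1.1 + x.1.2 * y.1.2 + x.2 * y.2.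

(** The two halves work together: [dot3 u N = dot3 (f u) (f N)] with [f \o N] again independent
    normal, so a linear functional can be studied in coordinates where [f u] is simple. Quantifying
    over the probability space lets [f] be built from vectors alone. *)
Definition gaussian_isometry f : Prop :=
  (forall x y, dot3 (f x) (f y) = dot3 x y) /\
  forall d (T : measurableType d) (P : probability T R) N, iid3 P N -> iid3 P (f \o N).

Lemma gaussian_isometry_comp f f' :
  gaussian_isometry f -> gaussian_isometry f' -> gaussian_isometry (f' \o f).
Proof.
move=> [h1 h2] [h1' h2']; split=> [x y|d T P N iN] /=; first by rewrite h1' h1.
by have /h2' := h2 _ _ _ _ iN.
Qed.

Lemma gaussian_isometry_perm01 : gaussian_isometry (@perm01 R).
Proof.
split=> [x y|d T P N]; first by rewrite /dot3 /=; ring.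
exact: iid3_perm01.
Qed.

Lemma gaussian_isometry_perm12 : gaussian_isometry (@perm12 R).
Proof.
split=> [x y|d T P N]; first by rewrite /dot3 /=; ring.
exact: iid3_perm12.
Qed.

Lemma gaussian_isometry_sgn3 e0 e1 e2 :
  e0 ^+ 2 = 1 -> e1 ^+ 2 = 1 -> e2 ^+ 2 = 1 -> gaussian_isometry (@sgn3 R e0 e1 e2).
Proof.
move=> h0 h1 h2; split=> [x y|d T P N]; last exact: iid3_sgn.
transitivity (e0 ^+ 2 * (x.1.1 * y.1.1) + e1 ^+ 2 * (x.1.2 * y.1.2) + e2 ^+ 2 * (x.2 * y.2)).
  by rewrite /dot3 /=; ring.
by rewrite h0 h1 h2 !mul1r.
Qed.

Lemma gaussian_isometry_rot01 c s :
  0 <= c -> c ^+ 2 + s ^+ 2 = 1 -> gaussian_isometry (@rot01 R c s).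
Proof.
move=> c0 cs; split=> [x y|d T P N]; last exact: iid3_rot01.
transitivity ((c ^+ 2 + s ^+ 2) * (x.1.1 * y.1.1 + x.1.2 * y.1.2) + x.2 * y.2).
  by rewrite /dot3 /=; ring.
by rewrite cs mul1r.
Qed.

(** The sign of [a] is moved into [c] and [s] so that [0 <= c], which the shear decomposition of the
    rotation requires. *)
Lemma givens (a b : R) : exists c s : R, [/\ 0 <= c, c ^+ 2 + s ^+ 2 = 1 & - s * a + c * b = 0].
Proof.
have [a0|a0] := eqVneq a 0.
  by exists 0, 1; split => //; [rewrite expr0n expr1n add0r|rewrite a0 mulr0 mul0r addr0].
pose r := Num.sqrt (a ^+ 2 + b ^+ 2).
have ab0 : 0 < a ^+ 2 + b ^+ 2.
  by rewrite ltr_pwDl ?sqr_ge0// exprn_even_gt0.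
have r0 : 0 < r by rewrite sqrtr_gt0.
have r2 : r ^+ 2 = a ^+ 2 + b ^+ 2 by rewrite sqr_sqrtr// ltW.
have e2 : (Num.sg a) ^+ 2 = 1 by rewrite sqr_sg a0.
have ea : `|a| = Num.sg a * a by rewrite normrEsg.
have rn : r != 0 by rewrite gt_eqF.
exists (`|a| / r), (Num.sg a * b / r); split.
- by rewrite divr_ge0// ltW.
- rewrite !exprMn e2 real_normK ?num_real// mul1r -mulrDl exprVn -r2 divff//.
  by rewrite expf_neq0.
- by rewrite ea; ring.
Qed.

Lemma sign_choice (a : R) : exists2 e : R, e ^+ 2 = 1 & 0 <= e * a.
Proof.
have [a0|a0] := leP 0 a; first by exists 1; rewrite ?expr1n ?mul1r.
by exists (-1); [ring|rewrite mulN1r oppr_ge0 ltW].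
Qed.

(** A QR factorization by three Givens rotations: two bring [m] to the first axis, the third acts on
    the last two coordinates, where [m] already vanishes, and brings [n] to the first coordinate
    plane. As [rot01] turns only the first two coordinates, the others are reached by conjugation
    with transpositions. *)
Lemma gaussian_isometry_triangular (m n l : R * R * R) :
  exists f, [/\ gaussian_isometry f,
    [/\ (f m).1.2 = 0, (f m).2 = 0 & (f n).2 = 0]
    & [/\ 0 <= (f m).1.1, 0 <= (f n).1.2 & 0 <= (f l).2]].
Proof.
have [c1 [s1 [c10 cs1 h1]]] := givens m.1.1 m.1.2.
pose f1 := rot01 c1 s1.
have i1 : gaussian_isometry f1 by exact: gaussian_isometry_rot01.
have [c2 [s2 [c20 cs2 h2]]] := givens (f1 m).1.1 (f1 m).2.
pose f2 := @perm12 R \o (rot01 c2 s2 \o (@perm12 R \o f1)).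
have i2 : gaussian_isometry f2.
  apply: gaussian_isometry_comp; last exact: gaussian_isometry_perm12.
  apply: gaussian_isometry_comp; last exact: gaussian_isometry_rot01.
  by apply: gaussian_isometry_comp; last exact: gaussian_isometry_perm12.
(* By conversion this is [h1], since the second rotation leaves the middle coordinate alone; the
   next claim is [h2]. *)
have f2m1 : (f2 m).1.2 = 0 by [].
have f2m2 : (f2 m).2 = 0 by [].
have [c3 [s3 [c30 cs3 h3]]] := givens (f2 n).1.2 (f2 n).2.
pose f3 := @perm01 R \o (@perm12 R \o (rot01 c3 s3 \o (@perm12 R \o (@perm01 R \o f2)))).
have i3 : gaussian_isometry f3.
  apply: gaussian_isometry_comp; last exact: gaussian_isometry_perm01.
  apply: gaussian_isometry_comp; last exact: gaussian_isometry_perm12.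
  apply: gaussian_isometry_comp; last exact: gaussian_isometry_rot01.
  apply: gaussian_isometry_comp; last exact: gaussian_isometry_perm12.
  by apply: gaussian_isometry_comp; last exact: gaussian_isometry_perm01.
have f3m1 : (f3 m).1.2 = 0.
  by transitivity (c3 * (f2 m).1.2 + s3 * (f2 m).2) => //; rewrite f2m1 f2m2 !mulr0 addr0.
have f3m2 : (f3 m).2 = 0.
  by transitivity (- s3 * (f2 m).1.2 + c3 * (f2 m).2) => //; rewrite f2m1 f2m2 !mulr0 addr0.
have f3n2 : (f3 n).2 = 0 by [].
have [e0 e02 ge0] := sign_choice (f3 m).1.1.
have [e1 e12 ge1] := sign_choice (f3 n).1.2.
have [e2 e22 ge2] := sign_choice (f3 l).2.
exists (sgn3 e0 e1 e2 \o f3); split.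
- by apply: gaussian_isometry_comp => //; exact: gaussian_isometry_sgn3.
- split; [transitivity (e1 * (f3 m).1.2)|transitivity (e2 * (f3 m).2)|transitivity (e2 * (f3 n).2)] => //;
    by rewrite ?f3m1 ?f3m2 ?f3n2 mulr0.
- by [].
Qed.
End frame.

(** * One-dimensional tails and moments *)

Section tails.
Context (R : realType).
Local Notation leb := (@lebesgue_measure R).
Local Notation g := (@normal_prob R 0 1).
Local Notation phi := (@normal_pdf R 0 1).
Implicit Types x e : R.

Lemma normal_pdf01E x : phi x = normal_peak 1 * expR (- (x ^+ 2) / 2).
Proof. by rewrite normal_pdfE// /normal_fun subr0 expr1n. Qed.

Lemma normal_pdf01_gt0 x : 0 < phi x.
Proof. by rewrite normal_pdf01E mulr_gt0 ?expR_gt0// normal_peak_gt0. Qed.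

Lemma normal_peak1_le1 : normal_peak 1 <= 1 :> R.
Proof.
have p2 : 1 <= (1 : R) ^+ 2 * pi *+ 2 by rewrite expr1n mul1r mulr2n; have := @pi_ge2 R; lra.
rewrite /normal_peak invf_le1 ?sqrtr_gt0 ?(lt_le_trans ltr01)//.
by rewrite -[leLHS]sqrtr1 ler_sqrt// (le_trans ler01).
Qed.

Lemma normal_pdf01_le x y : 0 <= x -> x <= y -> phi y <= phi x.
Proof.
move=> x0 xy; rewrite !normal_pdf01E ler_pM2l ?normal_peak_gt0// ler_expR.
rewrite ler_pM2r ?invr_gt0// lerN2; nra.
Qed.

Lemma normal_prob_itv_ge x e : 0 <= x -> 0 <= e ->
  ((e * phi (x + e))%:E <= g `]x, (x + e)%R[)%E.
Proof.
move=> x0 e0; rewrite /normal_prob.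
apply: (@le_trans _ _ (\int[leb]_(y in `]x, (x + e)%R[) (phi (x + e))%:E)%E).
  rewrite integral_cst//= lebesgue_measure_itv/= lte_fin.
  case: ifPn => [_|]; first by rewrite -EFinD -EFinM lee_fin; have := normal_pdf01_gt0 (x + e); nra.
  rewrite -leNgt gerDl => e0'; have -> : e = 0 by apply/eqP; rewrite eq_le e0 e0'.
  by rewrite mul0r mule0.
apply: ge0_le_integral => //=.
- by move=> y _; rewrite lee_fin normal_pdf_ge0.
- apply/measurable_EFinP; apply: measurable_funTS; exact: measurable_normal_pdf.
- move=> y; rewrite in_itv/= => /andP[xy ye]; rewrite lee_fin normal_pdf01_le//; lra.
Qed.

Lemma normal_prob_band_le e : 0 <= e -> (g `](- e)%R, e[ <= (2 * e)%:E)%E.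
Proof.
move=> e0; rewrite /normal_prob.
apply: (@le_trans _ _ (\int[leb]_(y in `](- e)%R, e[) 1%:E)%E).
  apply: ge0_le_integral => //=.
  - by move=> y _; rewrite lee_fin normal_pdf_ge0.
  - by apply/measurable_EFinP; apply: measurable_funTS; exact: measurable_normal_pdf.
  - move=> y _; rewrite lee_fin (le_trans (normal_pdf_ub _ _ _))//.
    exact: normal_peak1_le1.
rewrite integral_cst//= lebesgue_measure_itv/= lte_fin mul1e.
case: ifPn => _; last by rewrite lee_fin; lra.
by rewrite -EFinD lee_fin; lra.
Qed.

Lemma cvg_normal_pdf01 : phi x @[x --> +oo] --> (0 : R).
Proof.
have -> : phi = (fun x => normal_peak 1 * expR (- (x ^+ 2 / 2))).
  by apply/funext => x; rewrite normal_pdf01E mulNr.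
rewrite -[X in _ --> X](mulr0 (normal_peak (1 : R))).
apply: cvgM; first exact: cvg_cst.
apply: (@cvg_comp _ _ _ (fun x : R => x ^+ 2 / 2) (fun z => expR (- z)) _ (pinfty_nbhs R)).
  apply/cvgryPge => A; near=> x.
  have x1 : 2 * `|A| + 1 <= x by near: x; apply: nbhs_pinfty_ge; rewrite num_real.
  have := ler_norm A; have := normr_ge0 A; nra.
exact: cvgr_expR.
Unshelve. all: by end_near. Qed.

Lemma is_derive_normal_pdf01 x : is_derive x 1 (fun t => - phi t) (x * phi x).
Proof.
have -> : (fun t : R => - phi t) =
    (fun t => - normal_peak 1 * expR t) \o (fun t => - (t ^+ 2) / 2).
  by apply/funext => t; rewrite /= normal_pdf01E !mulNr.
have h1 : is_derive x 1 (fun t : R => - (t ^+ 2) / 2) (- x).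
  have -> : (fun t : R => - (t ^+ 2) / 2) = (- 2^-1) *: ((@idfun R : R -> R) ^+ 2).
    by apply/funext => t; rewrite exprfctE scalrfctE /GRing.scale /=; lra.
  by apply: is_derive_eq; rewrite expr1 /GRing.scale /=; lra.
have h2 : is_derive (- (x ^+ 2) / 2) 1 (fun t : R => - normal_peak 1 * expR t)
    (- normal_peak 1 * expR (- (x ^+ 2) / 2)).
  have -> : (fun t : R => - normal_peak 1 * expR t) = (- normal_peak 1 : R) \*: (expR : R -> R^o) by [].
  exact: is_deriveZ.
have -> : x * phi x = - normal_peak 1 * expR (- (x ^+ 2) / 2) * - x.
  by rewrite normal_pdf01E; ring.
exact: (@is_derive1_comp R (fun t => - normal_peak 1 * expR t) (fun t => - t ^+ 2 / 2) x _ _ h2 h1).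
Qed.

(** [- phi] is a primitive of [x * phi x] and vanishes at infinity. *)
Lemma integral_id_normal_pdf (a : R) : 0 <= a ->
  (\int[leb]_(x in `[a, +oo[) (x * phi x)%:E = (phi a)%:E)%E.
Proof.
move=> a0.
rewrite (@ge0_continuous_FTC2y _ _ (fun x => - phi x) _ 0).
- by rewrite EFinN oppeK add0e.
- by move=> x ax; rewrite mulr_ge0 ?normal_pdf_ge0// (le_trans a0).
- apply: continuous_subspaceT => x; apply: cvgM; first exact: cvg_id.
  exact: continuous_normal_pdf.
- rewrite -[X in _ --> X]oppr0; apply: cvgN; exact: cvg_normal_pdf01.
- by move=> x _; have [] := is_derive_normal_pdf01 x.
- by apply: cvg_at_right_filter; apply: cvgN; exact: continuous_normal_pdf.
- by move=> x _; rewrite derive1E; have [_ ->] := is_derive_normal_pdf01 x.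
Qed.

Definition Qtail x : R := fine (g `]x, +oo[).

Lemma QtailE x : (Qtail x)%:E = g `]x, +oo[.
Proof. by rewrite /Qtail fineK// fin_num_measure. Qed.

Lemma Qtail_ge0 x : 0 <= Qtail x.
Proof. exact: fine_ge0. Qed.

Lemma Qtail_le1 x : Qtail x <= 1.
Proof. by rewrite -lee_fin QtailE probability_le1. Qed.

Lemma Qtail_ge x e : 0 <= x -> 0 <= e -> e * phi (x + e) <= Qtail x.
Proof.
move=> x0 e0; rewrite -lee_fin QtailE; apply: le_trans (normal_prob_itv_ge x0 e0) _.
by rewrite le_measure ?inE// => z /=; rewrite !in_itv/= andbT => /andP[].
Qed.

(** For [x < y] the density [phi y] is at most [y * phi y / x], whose integral is explicit. *)
Lemma mills_upper x : 0 < x -> Qtail x <= phi x / x.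
Proof.
move=> x0; rewrite ler_pdivlMr// -lee_fin EFinM QtailE.
rewrite -(integral_id_normal_pdf (ltW x0)) /normal_prob muleC.
have mphi (D : set R) : measurable_fun D (fun y => (phi y)%:E).
  by apply/measurable_EFinP; apply: measurable_funTS; exact: measurable_normal_pdf.
have mxphi (D : set R) : measurable_fun D (fun y : R => (y * phi y)%:E).
  apply/measurable_EFinP; apply: measurable_funTS; apply: measurable_funM => //.
  exact: measurable_normal_pdf.
rewrite -ge0_integralZl//=; last 3 first.
- exact: mphi.
- by move=> y _; rewrite lee_fin normal_pdf_ge0.
- by rewrite lee_fin ltW.
apply: (@le_trans _ _ (\int[leb]_(y in `]x, +oo[) (y * phi y)%:E)%E).
  apply: ge0_le_integral => //=.
  - by move=> y _; rewrite -EFinM lee_fin mulr_ge0 ?normal_pdf_ge0// ltW.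
  - exact: (measurable_funeM _ (mphi _)).
  - exact: mxphi.
  - by move=> y; rewrite in_itv/= andbT => xy; rewrite -EFinM lee_fin ler_wpM2r ?normal_pdf_ge0// ltW.
apply: ge0_subset_integral => //=.
- exact: mxphi.
- move=> y; rewrite in_itv/= andbT => xy.
  by rewrite lee_fin mulr_ge0 ?normal_pdf_ge0// (le_trans (ltW x0)).
- by move=> y /=; rewrite !in_itv/= !andbT; exact: ltW.
Qed.

(** Only the interval of length [1 / x] above [x] is kept: there the exponent grows by at most
    [1 + 1 / (2 x^2)], hence by at most [3 / 2]. *)
Lemma mills_lower x : 1 <= x -> expR (- (3 / 2)) * phi x / x <= Qtail x.
Proof.
move=> x1; have x0 : 0 < x by lra.
apply: le_trans (Qtail_ge (ltW x0) (ltW (_ : 0 < x^-1))); last by rewrite invr_gt0.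
rewrite mulrC ler_pM2l ?invr_gt0// !normal_pdf01E mulrCA -expRD ler_pM2l ?normal_peak_gt0//.
rewrite ler_expR.
have h : x * x^-1 = 1 by rewrite divff// gt_eqF.
have : x^-1 <= 1 by rewrite invf_le1.
have : 0 < x^-1 by rewrite invr_gt0.
nra.
Qed.
End tails.

Section moments.
Context (R : realType).
Local Notation leb := (@lebesgue_measure R).
Local Notation g := (@normal_prob R 0 1).
Local Notation phi := (@normal_pdf R 0 1).
Local Open Scope ereal_scope.

Let mphi : measurable_fun [set: R] phi. Proof. exact: measurable_normal_pdf. Qed.

(* Write [x ^+ 2] as the integral of [x] over [u] in [0, x], and exchange the integrals. *)
Lemma integral_sqr_normal_pdf0y :
  \int[leb]_(x in `[0%R, +oo[) (x ^+ 2 * phi x)%:E = \int[leb]_(x in `[0%R, +oo[) (phi x)%:E.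
Proof.
pose D := [set z : R * R | (0 <= z.2)%R /\ (z.2 <= z.1)%R].
have mD : measurable D.
  have mle (f h : R * R -> R) : measurable_fun setT f -> measurable_fun setT h ->
      measurable [set z | (f z <= h z)%R].
    move=> mf mh; have := measurable_fun_ler mf mh => /(_ measurableT [set true]).
    by rewrite setTI; apply.
  apply: measurableI; apply: mle => //; solve [exact: measurable_fst|exact: measurable_snd].
(* The absolute value makes [F] nonnegative on the whole plane, as Tonelli requires; on [D] it
   changes nothing. *)
pose F (z : R * R) := (\1_D z * `|z.1 * phi z.1|)%:E.
have mF : measurable_fun [set: R * R] F.
  apply/measurable_EFinP; apply: measurable_funM; first exact: measurable_indic.
  apply: measurableT_comp => //; apply: measurable_funM; first exact: measurable_fst.
  by apply: measurableT_comp => //; exact: measurable_fst.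
have F0 z : 0 <= F z by rewrite lee_fin mulr_ge0.
have FE : \int[leb]_x \int[leb]_y F (x, y) =
    \int[leb]_(x in `[0%R, +oo[) (x ^+ 2 * phi x)%:E.
  rewrite [RHS]integral_mkcond; apply: eq_integral => x _; rewrite patchE.
  case: ifPn => [|]; rewrite ?notin_setE ?inE /= in_itv/= andbT => x0.
    transitivity (\int[leb]_y ((`|x * phi x|)%:E * (\1_`[0%R, x]%classic y)%:E)).
      apply: eq_integral => y _; rewrite /F /= -EFinM mulrC; congr (_ * _)%:E.
      rewrite !indicE; congr (nat_of_bool _)%:R; apply/idP/idP; rewrite !inE /D /= in_itv/=.
        by case=> -> ->.
      by case/andP=> ? ?; split.
    rewrite ge0_integralZl//=; last first.
      by apply/measurable_EFinP; exact: measurable_indic.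
    rewrite integral_indic// setIT /= lebesgue_measure_itv/= lte_fin.
    rewrite ger0_norm ?mulr_ge0 ?normal_pdf_ge0//.
    move: x0; rewrite le_eqVlt => /predU1P[<-|x0].
      by rewrite ltxx mule0 expr0n mul0r.
    by rewrite x0 -EFinB -EFinM; congr EFin; ring.
  apply: integral0_eq => y _; rewrite /F indicE memNset ?mul0r// => -[/= y0 yx].
  by apply: x0; exact: le_trans yx.
apply: (etrans (esym FE)); apply: (etrans (@fubini_tonelli _ _ _ _ _ leb leb F mF F0)).
rewrite [RHS]integral_mkcond; apply: eq_integral => u _; rewrite patchE.
case: ifPn => [|]; rewrite ?notin_setE ?inE /= in_itv/= andbT => u0.
  rewrite -(integral_id_normal_pdf u0) [RHS]integral_mkcond; apply: eq_integral => x _.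
  rewrite patchE /F indicE; case: ifPn => [|]; rewrite ?notin_setE ?inE /= in_itv/= andbT => ux.
    rewrite mem_set// mul1r ger0_norm// mulr_ge0 ?normal_pdf_ge0//.
    exact: le_trans ux.
  by rewrite memNset ?mul0r// => -[].
by apply: integral0_eq => x _; rewrite /F indicE memNset ?mul0r// => -[].
Qed.

Lemma ge0_integral_even (h : R -> R) : measurable_fun setT h ->
  (forall x, (0 <= h x)%R) -> (forall x, h (- x)%R = h x) ->
  \int[leb]_x (h x)%:E =
  \int[leb]_(x in `[0%R, +oo[) (h x)%:E + \int[leb]_(x in `[0%R, +oo[) (h x)%:E.
Proof.
move=> mh h0 hN.
have mhE (D : set R) : measurable_fun D (fun x : R => (h x)%:E).
  by apply/measurable_EFinP; exact: measurable_funTS.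
have h0' x : 0 <= (h x)%:E by rewrite lee_fin.
have E : \int[leb]_(x in `]-oo, 0%R[) (h x)%:E = \int[leb]_(x in `[0%R, +oo[) (h x)%:E.
  rewrite (@ge0_integration_by_substitution0 R (fun x => (h x)%:E))//.
  rewrite -integral_itv_bndo_bndc//.
  - by apply: eq_integral => x _; rewrite hN.
  - apply/measurable_EFinP; apply: measurable_funTS.
    by rewrite (_ : (fun x : R => h (- x)%R) = h)//; apply/funext => x; rewrite hN.
rewrite -{2}E.
have -> : [set: g_sigma_algebraType (R.-ocitv.-measurable)] = `[0%R, +oo[%classic `|` `]-oo, 0%R[%classic.
  apply/seteqP; split => x //= _; rewrite !in_itv/= andbT.
  by case: (leP 0%R x); [left|right].
rewrite ge0_integral_setU//=.
- exact: mhE.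
- rewrite disj_set2E; apply/eqP; rewrite -subset0 => x /= [].
  by rewrite !in_itv/= andbT leNgt => /negP.
Qed.

Lemma integral_sqr_normal : \int[g]_x (x ^+ 2)%:E = 1.
Proof.
rewrite ge0_integral_normal//; last first.
- by move=> x; rewrite lee_fin sqr_ge0.
- by apply/measurable_EFinP; exact: measurable_funX.
under eq_integral do rewrite -EFinM.
rewrite (@ge0_integral_even (fun x => x ^+ 2 * phi x)%R)//; last 3 first.
- by apply: measurable_funM => //; exact: measurable_funX.
- by move=> x; rewrite mulr_ge0 ?sqr_ge0 ?normal_pdf_ge0.
- by move=> x; rewrite !normal_pdf01E sqrrN.
rewrite integral_sqr_normal_pdf0y -(integral_normal_pdf (0:R) 1).
rewrite [RHS](@ge0_integral_even (fun x => phi x)%R)//.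
- by move=> x; rewrite normal_pdf_ge0.
- by move=> x; rewrite !normal_pdf01E sqrrN.
Qed.
End moments.

Section std_normal_law.
Context (R : realType) d (T : measurableType d) (P : probability T R).
Local Notation g := (@normal_prob R 0 1).
Local Open Scope ereal_scope.

Definition std_normal_law (Y : T -> R) : Prop :=
  measurable_fun setT Y /\ forall A : set R, measurable A -> P (Y @^-1` A) = g A.

Lemma ge0_integral_std_normal_law (Y : T -> R) (f : R -> \bar R) :
  std_normal_law Y -> measurable_fun [set: R] f -> (forall x, 0 <= f x) ->
  \int[P]_t f (Y t) = \int[g]_x f x.
Proof.
move=> [mY hY] mf f0.
pose Y1 : T -> g_sigma_algebraType (R.-ocitv.-measurable) := Y.
have mY1 : measurable_fun setT Y1 by exact: mY.
pose Y2 := mfun_Sub (mem_set mY1).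
transitivity (\int[pushforward P Y2]_x f x).
  by rewrite (ge0_integral_pushforward mY1).
by apply: eq_measure_integral => A mA _; exact: (hY _ mA).
Qed.

Lemma integrable_dominated (f h : T -> R) : measurable_fun setT f ->
  measurable_fun setT h -> (forall t, `|f t| <= h t)%R ->
  \int[P]_t (h t)%:E < +oo -> P.-integrable setT (fun t => (f t)%:E).
Proof.
move=> mf mh fh hoo; apply/integrableP; split; first exact/measurable_EFinP.
apply: le_lt_trans hoo; apply: ge0_le_integral => //=.
- by apply/measurable_EFinP; exact: measurableT_comp.
- exact/measurable_EFinP.
- by move=> t _; rewrite lee_fin.
Qed.

Lemma integral_sqr_std_normal_law (Y : T -> R) : std_normal_law Y ->
  \int[P]_t ((Y t) ^+ 2)%:E = 1.
Proof.
move=> hY; rewrite -(integral_sqr_normal R).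
apply: (ge0_integral_std_normal_law (f := fun x => (x ^+ 2)%:E)) => //.
- by apply/measurable_EFinP; exact: measurable_funX.
- by move=> x; rewrite lee_fin sqr_ge0.
Qed.

Lemma integrable_sqr_std_normal_law (Y : T -> R) : std_normal_law Y ->
  P.-integrable setT (fun t => (Y t ^+ 2)%:E).
Proof.
move=> hY; have [mY _] := hY.
have mY2 : measurable_fun setT (fun t => (Y t) ^+ 2)%R by exact: measurable_funX.
apply: (integrable_dominated mY2 mY2).
- by move=> t; rewrite ger0_norm// sqr_ge0.
- by rewrite integral_sqr_std_normal_law// ltry.
Qed.

Lemma integrable_std_normal_law (Y : T -> R) : std_normal_law Y ->
  P.-integrable setT (fun t => (Y t)%:E).
Proof.
move=> hY; have [mY _] := hY.
(* The dominating function comes from [|y| <= 1 + y^2]. *)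
have mY2 : measurable_fun setT (fun t => 1 + (Y t) ^+ 2)%R.
  by apply: measurable_funD => //; exact: measurable_funX.
apply: (integrable_dominated mY mY2).
- move=> t; rewrite -(real_normK (num_real (Y t))); set y := `|_|%R; nra.
- under eq_integral do rewrite EFinD.
  rewrite integralD//=; last 2 first.
  + exact: finite_measure_integrable_cst.
  + exact: integrable_sqr_std_normal_law.
  by rewrite integral_cst//= probability_setT mule1 integral_sqr_std_normal_law// ltry.
Qed.

(** [Y] and [- Y] have the same law, so the mean, which is finite, equals its opposite. *)
Lemma integral_std_normal_law0 (Y : T -> R) : std_normal_law Y -> \int[P]_t (Y t)%:E = 0.
Proof.
move=> hY; have [mY lY] := hY.
have hN : std_normal_law (fun t => - Y t)%R.
  split; first exact: measurableT_comp.
  move=> A mA.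
  have e2 : ((-1 : R) ^+ 2 = 1)%R by ring.
  rewrite -(normal_prob_scale_sign e2 mA) -lY.
    by congr (P _); apply/seteqP; split => t /=; rewrite mulN1r.
  rewrite -[X in measurable X]setTI.
  have : measurable_fun [set: R] (fun x : R => -1 * x)%R by exact: measurable_funM.
  exact.
have key (Z : T -> R) : std_normal_law Z -> \int[P]_t (Z t)%:E = \int[g]_x x%:E.
  move=> hZ; have [mZ lZ] := hZ.
  pose Y1 : T -> g_sigma_algebraType (R.-ocitv.-measurable) := Z.
  have mY1 : measurable_fun setT Y1 by exact: mZ.
  pose Y2 := mfun_Sub (mem_set mY1).
  transitivity (\int[pushforward P Y2]_x x%:E).
    rewrite (integral_pushforward mY1)//=.
    - exact: (integrable_std_normal_law hZ).
  by apply: eq_measure_integral => A mA _; exact: (lZ _ mA).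
have fY := integrable_fin_num measurableT (integrable_std_normal_law hY).
have : \int[P]_t (Y t)%:E = - \int[P]_t (Y t)%:E.
  rewrite {1}(key _ hY) -(key _ hN) -integralN; last exact: integrable_add_def (integrable_std_normal_law hY).
  by apply: eq_integral => t _; rewrite EFinN.
rewrite -(fineK fY) -EFinN => -[] h; congr EFin; lra.
Qed.
End std_normal_law.

Section iid3_covariance.
Context (R : realType) d (T : measurableType d) (P : probability T R).
Local Notation g := (@normal_prob R 0 1).
Local Open Scope ereal_scope.

Lemma iid3_law0 (N : T -> R * R * R) : iid3 P N -> std_normal_law P (fun t => (N t).1.1).
Proof.
move=> [mN hN]; split.
  exact: (measurableT_comp (measurableT_comp (@measurable_fst _ _ _ _) (@measurable_fst _ _ _ _)) mN).
move=> A mA; have gT := @normal_prob_setT R.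
transitivity (g A * g setT * g setT); last by rewrite gT !mule1.
rewrite -hN//; congr (P _).
by apply/seteqP; split => t /= => [h|[]].
Qed.

Lemma iid3_law1 (N : T -> R * R * R) : iid3 P N -> std_normal_law P (fun t => (N t).1.2).
Proof. by move=> /iid3_perm01 /iid3_law0. Qed.

Lemma iid3_integral_mul (N : T -> R * R * R) (u v w : R) : iid3 P N ->
  \int[P]_t ((u * (N t).1.1) * (v * (N t).1.1 + w * (N t).1.2))%:E = (u * v)%:E.
Proof.
move=> iN.
(* After a rotation by pi/4 the product of the coordinates becomes half a difference of squares. *)
pose c : R := Num.sqrt (2^-1).
have c0 : (0 <= c)%R by exact: sqrtr_ge0.
have c2 : (c ^+ 2 = 2^-1)%R by rewrite sqr_sqrtr.
have cs : (c ^+ 2 + c ^+ 2 = 1)%R by rewrite c2; lra.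
have iN' := iid3_rot01 c0 cs iN.
have l0 := iid3_law0 iN.
have l0' := iid3_law0 iN'. have l1' := iid3_law1 iN'.
have i0 := integrable_sqr_std_normal_law l0.
have i0' := integrable_sqr_std_normal_law l0'.
have i1' := integrable_sqr_std_normal_law l1'.
transitivity (\int[P]_t ((u * v)%:E * ((N t).1.1 ^+ 2)%:E +
  ((u * w / 2)%:E * ((rot01 c c (N t)).1.1 ^+ 2)%:E -
   (u * w / 2)%:E * ((rot01 c c (N t)).1.2 ^+ 2)%:E))).
  apply: eq_integral => t _; rewrite -!EFinM -!EFinB -!EFinD; congr EFin; rewrite /rot01 /=.
  set x := (N t).1.1; set y := (N t).1.2.
  have -> : ((c * x + c * y) ^+ 2 = c ^+ 2 * (x + y) ^+ 2)%R by ring.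
  have -> : ((- c * x + c * y) ^+ 2 = c ^+ 2 * (y - x) ^+ 2)%R by ring.
  by rewrite c2; field.
have j0 := integrableZl measurableT (u * v) i0.
have j0' := integrableZl measurableT (u * w / 2) i0'.
have j1' := integrableZl measurableT (u * w / 2) i1'.
apply: (etrans (integralD measurableT j0 (integrableB measurableT j0' j1'))).
apply: (etrans (congr1 (fun z => _ + z) (integralB measurableT j0' j1'))).
rewrite /= !integralZl//.
rewrite (integral_sqr_std_normal_law l0) (integral_sqr_std_normal_law l0').
by rewrite (integral_sqr_std_normal_law l1') !mule1 -EFinB subrr adde0.
Qed.

Lemma iid3_integral_affine (N : T -> R * R * R) (u c : R) : iid3 P N ->
  \int[P]_t (u * (N t).1.1 + c)%:E = c%:E.
Proof.
move=> iN; have l0 := iid3_law0 iN.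
transitivity (\int[P]_t (u%:E * ((N t).1.1)%:E + c%:E)) => //.
rewrite integralD//=; last 2 first.
- by apply: integrableZl => //; exact: integrable_std_normal_law.
- exact: finite_measure_integrable_cst.
rewrite integralZl//; last exact: integrable_std_normal_law.
by rewrite (integral_std_normal_law0 l0) mule0 add0e integral_cst//= probability_setT mule1.
Qed.
End iid3_covariance.

(** * Expectations determined by tail probabilities *)

Section transfer.
Context (R : realType) d (T : measurableType d) (P : probability T R)
  d' (T' : measurableType d') (P' : probability T' R).
Local Open Scope ereal_scope.

(** Layer-cake formula: the expectation is the integral of the tail. *)
Lemma ge0_integral_eq_tails (U : T -> R) (V : T' -> R) :
  measurable_fun setT U -> measurable_fun setT V ->
  (forall t, (0 <= U t)%R) -> (forall t, (0 <= V t)%R) ->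
  (forall r, (0 <= r)%R -> P [set t | (r < U t)%R] = P' [set t | (r < V t)%R]) ->
  \int[P]_t (U t)%:E = \int[P']_t (V t)%:E.
Proof.
move=> mU mV U0 V0 h.
pose U1 : {RV P >-> R} := mfun_Sub (mem_set mU).
pose V1 : {RV P' >-> R} := mfun_Sub (mem_set mV).
have eU := ge0_expectation_ccdf (X := U1) U0.
have eV := ge0_expectation_ccdf (X := V1) V0.
rewrite unlock in eU; rewrite unlock in eV.
rewrite [LHS]eU [RHS]eV; apply: eq_integral => r; rewrite inE /= in_itv/= andbT => r0.
have := h _ r0; rewrite /ccdf /distribution /pushforward.
have E D (W : D -> R) : W @^-1` `]r, +oo[ = [set t | (r < W t)%R].
  by apply/seteqP; split => t /=; rewrite in_itv/= andbT.
by rewrite !E.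
Qed.

(** Only open half-lines occur. For a continuous function of the vector the events are therefore
    open sets of vectors, on which [gaussian_vector] equates the two probabilities; this carries
    means and covariances from [X] to its representation. *)
Lemma integral_eq_tails (U : T -> R) (V : T' -> R) :
  measurable_fun setT U -> measurable_fun setT V ->
  (forall r, P [set t | (r < U t)%R] = P' [set t | (r < V t)%R]) ->
  (forall r, P [set t | (U t < r)%R] = P' [set t | (V t < r)%R]) ->
  \int[P]_t (U t)%:E = \int[P']_t (V t)%:E.
Proof.
move=> mU mV h1 h2; rewrite integralE [RHS]integralE; congr (_ - _).
  transitivity (\int[P]_t (Num.max (U t) 0)%:E).
    by apply: eq_integral => t _; rewrite funeposE -EFin_max.
  transitivity (\int[P']_t (Num.max (V t) 0)%:E); last first.
    by apply: eq_integral => t _; rewrite funeposE -EFin_max.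
  apply: ge0_integral_eq_tails.
  - exact: measurable_maxr.
  - exact: measurable_maxr.
  - by move=> t; rewrite le_max lexx orbT.
  - by move=> t; rewrite le_max lexx orbT.
  - move=> r r0; have E D (W : D -> R) : [set t | (r < Num.max (W t) 0)%R] = [set t | (r < W t)%R].
      by apply/seteqP; split => t /=; rewrite lt_max (ltNge r 0%R) r0 orbF.
    by rewrite !E.
transitivity (\int[P]_t (Num.max (- U t) 0)%:E).
  by apply: eq_integral => t _; rewrite funenegE -EFin_max.
transitivity (\int[P']_t (Num.max (- V t) 0)%:E); last first.
  by apply: eq_integral => t _; rewrite funenegE -EFin_max.
apply: ge0_integral_eq_tails.
- by apply: measurable_maxr => //; exact: measurableT_comp.
- by apply: measurable_maxr => //; exact: measurableT_comp.
- by move=> t; rewrite le_max lexx orbT.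
- by move=> t; rewrite le_max lexx orbT.
- move=> r r0; have E D (W : D -> R) : [set t | (r < Num.max (- W t) 0)%R] = [set t | (W t < - r)%R].
    by apply/seteqP; split => t /=; rewrite lt_max (ltNge r 0%R) r0 orbF ltrNr.
  by rewrite !E.
Qed.
End transfer.

(** * Gaussian vectors as linear images of iid variables *)

Section borel_rV.
Context (R : realType).
Local Notation g := (@normal_prob R 0 1).

Lemma ord3_ind (Q : 'I_3 -> Prop) : Q 0 -> Q 1 -> Q 2%:R -> forall i, Q i.
Proof.
move=> q0 q1 q2 [[|[|[|]]]//= i3].
- by rewrite (_ : Ordinal i3 = 0)//; exact: val_inj.
- by rewrite (_ : Ordinal i3 = 1)//; exact: val_inj.
- by rewrite (_ : Ordinal i3 = 2%:R)//; exact: val_inj.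
Qed.

Lemma big_ord3 (V : Type) (idx : V) (op : Monoid.law idx) (F : 'I_3 -> V) :
  \big[op/idx]_i F i = op (F 0) (op (F 1) (F 2%:R)).
Proof.
rewrite !big_ord_recl big_ord0 Monoid.mulm1.
by congr (op (F _) (op (F _) (F _))); exact: val_inj.
Qed.

Lemma open_measurable_rV n (U : set 'rV[R]_n) : open U -> <<s open >> U.
Proof. by move=> oU; exact: sub_gen_smallest. Qed.

Lemma continuous_coord n (i : 'I_n) : continuous (fun x : 'rV[R]_n => x 0 i).
Proof. by move=> x; exact: coord_continuous. Qed.

Lemma open_gt_rV n (f : 'rV[R]_n -> R) (r : R) : continuous f -> open [set x | r < f x].
Proof.
move=> cf; have -> : [set x | r < f x] = f @^-1` [set y | r < y] by [].
by apply: open_comp => [x _|]; [exact: cf|exact: open_gt].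
Qed.

Lemma open_lt_rV n (f : 'rV[R]_n -> R) (r : R) : continuous f -> open [set x | f x < r].
Proof.
move=> cf; have -> : [set x | f x < r] = f @^-1` [set y | y < r] by [].
by apply: open_comp => [x _|]; [exact: cf|exact: open_lt].
Qed.

Lemma orthants_measurable_rV n (h : R) (y : {ffun 'I_n.+1 -> bool}) :
  <<s open >> [set x : 'rV[R]_n.+1 | forall i, (h < x 0 i) = y i].
Proof.
have m1 i : <<s open >> [set x : 'rV[R]_n.+1 | (h < x 0 i) = y i].
  have o := open_measurable_rV (@open_gt_rV n.+1 _ h (@continuous_coord n.+1 i)).
  case: (y i).
    by rewrite (_ : [set x | _] = [set x : 'rV[R]_n.+1 | h < x 0 i])//; apply/seteqP; split => x.
  have := @measurableC _ (g_sigma_algebraType (@open 'rV[R]_n.+1)) _ o.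
  rewrite (_ : ~` _ = [set x : 'rV[R]_n.+1 | (h < x 0 i) = false])//.
  by apply/seteqP; split => x /= => [/negP/negbTE|->].
have -> : [set x : 'rV[R]_n.+1 | forall i, (h < x 0 i) = y i] =
    \bigcap_(i in [set: 'I_n.+1]) [set x : 'rV[R]_n.+1 | (h < x 0 i) = y i].
  by apply/seteqP; split => x /= H i; [move=> _; exact: H|exact: (H i I)].
apply: (@fin_bigcap_measurable _ (g_sigma_algebraType (@open 'rV[R]_n.+1))).
  exact: finite_finset.
by move=> i _; exact: m1.
Qed.

Context d (T : measurableType d) (P : probability T R).

Lemma iid_std_normal_iid3 (Z : 'I_3 -> {RV P >-> R}) : iid_std_normal Z ->
  iid3 P (fun t => (Z 0 t, Z 1 t, Z 2%:R t)).
Proof.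
move=> [lawZ indZ]; split.
  by apply/measurable_fun_pairP; split => //; apply/measurable_fun_pairP; split.
move=> A B C mA mB mC.
pose D (i : 'I_3) := if i == 0 then A else if i == 1 then B else C.
have mD i : measurable (D i) by rewrite /D; case: ifP => // _; case: ifP.
have := indZ D mD; rewrite big_ord3 /D /= !lawZ// muleA.
rewrite (_ : [set t | _] = [set t | [/\ A (Z 0 t), B (Z 1 t) & C (Z 2%:R t)]])//.
apply/seteqP; split => t /= => [H|[hA hB hC]]; last exact: ord3_ind.
by split; [exact: (H 0)|exact: (H 1)|exact: (H 2%:R)].
Qed.

End borel_rV.

Section dot3_integrals.
Context (R : realType) d (T : measurableType d) (P : probability T R).

Lemma measurable_dot3 d' (T' : measurableType d') (N : T' -> R * R * R) (m : R * R * R) :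
  measurable_fun setT N -> measurable_fun setT (fun t => dot3 m (N t)).
Proof.
move=> mN.
have h1 : measurable_fun setT (fun t => (N t).1).
  by apply: measurableT_comp => //; exact: measurable_fst.
have h2 : measurable_fun setT (fun t => (N t).2).
  by apply: measurableT_comp => //; exact: measurable_snd.
apply: measurable_funD; last exact: measurable_funM.
apply: measurable_funD; apply: measurable_funM => //; apply: measurableT_comp => //;
  solve [exact: measurable_fst|exact: measurable_snd].
Qed.

Lemma iid3_integral_dot3 (N : T -> R * R * R) (m : R * R * R) (c : R) : iid3 P N ->
  (\int[P]_t (dot3 m (N t) + c)%:E = c%:E)%E.
Proof.
move=> iN; have [f [[f1 f2] [h1 h2 _] _]] := gaussian_isometry_triangular m m m.
rewrite -[RHS](iid3_integral_affine (f m).1.1 c (f2 _ _ _ _ iN)).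
by apply: eq_integral => t _; rewrite -f1 /dot3 h1 h2 !mul0r !addr0.
Qed.

(** A triangular isometry puts [m] on the first axis and [n] in the first coordinate plane, the case
    settled by [iid3_integral_mul]. *)
Lemma iid3_integral_dot3_mul (N : T -> R * R * R) (m n : R * R * R) : iid3 P N ->
  (\int[P]_t (dot3 m (N t) * dot3 n (N t))%:E = (dot3 m n)%:E)%E.
Proof.
move=> iN; have [f [[f1 f2] [h1 h2 h3] _]] := gaussian_isometry_triangular m n n.
rewrite -(f1 m n) {3}/dot3 h1 h2 !mul0r !addr0.
rewrite -(iid3_integral_mul _ _ (f n).1.2 (f2 _ _ _ _ iN)).
apply: eq_integral => t _; rewrite -(f1 m) -(f1 n) /dot3 h1 h2 h3 /=.
by congr EFin; ring.
Qed.

End dot3_integrals.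

Section representation.
Context (R : realType) d (T : measurableType d) (P : probability T R).

(** The vectors [m i] are the columns of [M], and mean zero forces [mu = 0]. The last clause encodes
    full support: under a nontrivial relation [c], the open half-space of the [x] with positive
    [\sum_i c 0 i * x 0 i] would contain the support point [c] and yet have probability 0. *)
Lemma gaussian_vector3_representation (X : 'I_3 -> {RV P >-> R}) (A : 'M[R]_3) :
  gaussian_vector X -> standard X -> fully_supported X ->
  (forall i j, covariance P (X i) (X j) = (A i j)%:E) ->
  exists (d' : measure_display) (T' : measurableType d') (P' : probability T' R)
    (N : T' -> R * R * R) (m : 'I_3 -> R * R * R),
  [/\ iid3 P' N, forall i j, dot3 (m i) (m j) = A i j,
    forall (h : R) (y : {ffun 'I_3 -> bool}),
      P [set t | forall i, threshold X h i t = y i] =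
      P' [set t | forall i, (h < dot3 (m i) (N t)) = y i]
  & forall c : 'rV[R]_3, (forall t, \sum_i c 0 i * dot3 (m i) (N t) = 0) -> c = 0].
Proof.
move=> [d' [T' [P' [Z [M [mu [iidZ lawX]]]]]]] stX supX covX.
pose N t := (Z 0 t, Z 1 t, Z 2%:R t).
pose m i := (M 0 i, M 1 i, M 2%:R i).
have iN : iid3 P' N by exact: iid_std_normal_iid3.
have WE i t : (rvec Z t *m M + mu) 0 i = dot3 (m i) (N t) + mu 0 i.
  by rewrite !mxE big_ord3 /dot3 /= !mxE addrA ![_ * M _ _]mulrC.
have mW i : measurable_fun setT (fun t => dot3 (m i) (N t) + mu 0 i).
  by apply: measurable_funD => //; apply: measurable_dot3; case: iN.
have lawf (f : 'rV[R]_3 -> R) (U : T -> R) (V : T' -> R) : continuous f ->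
    (forall t, f (rvec X t) = U t) -> (forall t, f (rvec Z t *m M + mu) = V t) ->
    measurable_fun setT U -> measurable_fun setT V ->
    (\int[P]_t (U t)%:E = \int[P']_t (V t)%:E)%E.
  move=> cf fU fV mU mV; apply: integral_eq_tails => // r.
  - have := lawX [set x | r < f x] (open_measurable_rV (open_gt_rV cf)).
    have -> : [set t | [set x | r < f x] (rvec X t)] = [set t | r < U t].
      by apply/seteqP; split => t /=; rewrite fU.
    by move=> ->; congr (P' _); apply/seteqP; split => t /=; rewrite fV.
  - have := lawX [set x | f x < r] (open_measurable_rV (open_lt_rV cf)).
    have -> : [set t | [set x | f x < r] (rvec X t)] = [set t | U t < r].
      by apply/seteqP; split => t /=; rewrite fU.
    by move=> ->; congr (P' _); apply/seteqP; split => t /=; rewrite fV.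
have XE i t : rvec X t 0 i = X i t by rewrite mxE.
have mX i : measurable_fun setT (X i : T -> R) by exact: measurable_funPT.
have EX i : (\int[P]_t (X i t)%:E = 0)%E.
  by have [+ _] := stX i; rewrite unlock.
have mu0 i : mu 0 i = 0.
  have := lawf _ _ _ (@continuous_coord R 3 i) (XE i) (WE i) (mX i) (mW i).
  by rewrite EX (iid3_integral_dot3 (m i) (mu 0 i) iN) => -[].
have WE0 i t : (rvec Z t *m M + mu) 0 i = dot3 (m i) (N t) by rewrite WE mu0 addr0.
have mW0 i : measurable_fun setT (fun t => dot3 (m i) (N t)).
  by apply: measurable_dot3; case: iN.
exists d', T', P', N, m; split => //.
- move=> i j; have := covX i j.
  rewrite unlock unlock !EX /= => E.
  have cf : continuous (fun x : 'rV[R]_3 => x 0 i * x 0 j).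
    by move=> x; exact: (continuousM (@continuous_coord R 3 i x) (@continuous_coord R 3 j x)).
  have := lawf _ (fun t => X i t * X j t) (fun t => dot3 (m i) (N t) * dot3 (m j) (N t)) cf.
  move=> /(_ _ _ _ _)/esym; rewrite (iid3_integral_dot3_mul (m i) (m j) iN).
  have -> : (\int[P]_t (X i t * X j t)%:E = (A i j)%:E)%E.
    by rewrite -E; apply: eq_integral => t _; rewrite mulrfctE /= !subr0.
  move=> H; suff [] : (dot3 (m i) (m j))%:E = (A i j)%:E by [].
  apply: H.
  + by move=> t; rewrite !XE.
  + by move=> t; rewrite !WE0.
  + exact: measurable_funM.
  + exact: measurable_funM.
- move=> h y; have := lawX _ (orthants_measurable_rV h y).
  rewrite (_ : [set t | _] = [set t | forall i, threshold X h i t = y i]); last first.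
    by apply/seteqP; split => t /= H i; have := H i; rewrite /threshold XE.
  move=> ->; congr (P' _).
  by apply/seteqP; split => t /= H i; have := H i; rewrite WE0.
- move=> c hc; apply/eqP; apply: contraT => c0.
  pose f (x : 'rV[R]_3) := \sum_i c 0 i * x 0 i.
  have cf : continuous f.
    move=> x; rewrite /f; under eq_fun do rewrite big_ord3 /=.
    have hci i : {for x, continuous (fun x : 'rV[R]_3 => c 0 i * x 0 i)}.
      exact: (continuousM (@cst_continuous _ _ (c 0 i) x) (@continuous_coord R 3 i x)).
    exact: (continuousD (hci 0) (continuousD (hci 1) (hci 2%:R))).
  have : law_support X c by rewrite supX.
  have oU : open [set x | 0 < f x] by exact: open_gt_rV.
  have fc : 0 < f c.
    have [i ci] : exists i, c 0 i != 0.
      apply/existsP; apply: contraR c0 => /existsPn H.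
      by apply/eqP/rowP => i; rewrite mxE; apply/eqP; have := H i; rewrite negbK.
    rewrite /f (bigD1 i)//= ltr_pwDl//.
      by rewrite -expr2 exprn_even_gt0.
    by apply: sumr_ge0 => j _; rewrite -expr2 sqr_ge0.
  move=> /(_ _ oU fc); rewrite (lawX [set x | 0 < f x] (open_measurable_rV oU)).
  rewrite (_ : [set t | _] = set0) ?measure0 ?ltxx//.
  rewrite -subset0 => t /=; rewrite /f.
  by under eq_bigr do rewrite WE0; rewrite hc ltxx.
Qed.
End representation.

(** * Color representations on three sites *)

Section coloring3.
Context (R : realType) (S : finType) (i j k : S).
Hypotheses (ij : i != j) (ik : i != k) (jk : j != k).
Hypothesis ijk : forall x, [|| x == i, x == j | x == k].
Implicit Types (p : R) (y : {ffun S -> bool}) (pi : {set {set S}}).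

(** The factor of a single block in [coloring_prob]: [a] and [b] tell whether the coloring is all 1,
    respectively all 0, on it. *)
Definition block_prob p (a b : bool) : R := p * a%:R + (1 - p) * b%:R.

Lemma forall_in_pair (Q : pred S) : [forall x in [set i; j]%SET, Q x] = Q i && Q j.
Proof.
apply/forall_inP/andP => [h|[hi hj] x].
  by split; apply: h; rewrite !inE eqxx ?orbT.
by rewrite !inE => /orP[]/eqP ->.
Qed.

Lemma forall_in_single (x0 : S) (Q : pred S) : [forall x in [set x0]%SET, Q x] = Q x0.
Proof. by apply/forall_inP/idP => [h|h x]; [apply: h; rewrite inE|rewrite inE => /eqP ->]. Qed.

Lemma forall_in_triple (Q : pred S) : [forall x in [set: S]%SET, Q x] = [&& Q i, Q j & Q k].
Proof.
apply/forall_inP/and3P => [h|[hi hj hk] x _]; first by split; apply: h.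
by case/or3P: (ijk x) => /eqP ->.
Qed.

Definition part_one : {set {set S}} := [set [set: S]]%SET.
Definition part_pair : {set {set S}} := [set [set i; j]; [set k]]%SET.
Definition part_all : {set {set S}} := [set [set i]; [set j]; [set k]]%SET.

Lemma coloring_prob_one p y : coloring_prob p part_one y =
  block_prob p [&& y i, y j & y k] [&& ~~ y i, ~~ y j & ~~ y k].
Proof. by rewrite /coloring_prob big_set1 !forall_in_triple. Qed.

Lemma coloring_prob_pair p y : coloring_prob p part_pair y =
  block_prob p (y i && y j) (~~ y i && ~~ y j) * block_prob p (y k) (~~ y k).
Proof.
rewrite /coloring_prob /part_pair big_setU1 ?big_set1 /=.
  by rewrite !forall_in_pair !forall_in_single.
rewrite inE; apply/eqP => /finset.setP /(_ i).
by rewrite !inE eqxx (negbTE ik).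
Qed.

Lemma coloring_prob_all p y : coloring_prob p part_all y =
  block_prob p (y i) (~~ y i) * block_prob p (y j) (~~ y j) * block_prob p (y k) (~~ y k).
Proof.
rewrite /coloring_prob /part_all -finset.setUA big_setU1 ?big_setU1 ?big_set1 /=.
- by rewrite !forall_in_single mulrA.
- rewrite inE; apply/eqP => /finset.setP /(_ j).
  by rewrite !inE eqxx (negbTE jk).
- rewrite !inE; apply/norP; split; apply/eqP => /finset.setP /(_ i);
    by rewrite !inE eqxx ?(negbTE ij) ?(negbTE ik).
Qed.

Lemma partition_part_one : finset.partition part_one [set: S]%SET.
Proof.
apply/and3P; split.
- apply/eqP/finset.setP => x; rewrite inE; apply/finset.bigcupP.
  by exists [set: S]%SET; rewrite ?inE.
- by apply/finset.trivIsetP => A B; rewrite !inE => /eqP -> /eqP ->; rewrite eqxx.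
- by rewrite inE; apply/eqP => /finset.setP /(_ i); rewrite !inE.
Qed.

Lemma partition_part_pair : finset.partition part_pair [set: S]%SET.
Proof.
have d1 : fintype.disjoint (mem [set i; j]%SET) (mem [set k]%SET).
  by rewrite disjoint_sym disjoints1 !inE negb_or ![k == _]eq_sym ik jk.
apply/and3P; split.
- apply/eqP/finset.setP => x; rewrite inE; apply/finset.bigcupP.
  case/or3P: (ijk x) => /eqP ->; [exists [set i; j]%SET|exists [set i; j]%SET|exists [set k]%SET];
    by rewrite !inE eqxx ?orbT.
- apply/finset.trivIsetP => A B; rewrite !inE => /orP[]/eqP -> /orP[]/eqP ->; rewrite ?eqxx//.
  by rewrite disjoint_sym.
- rewrite !inE; apply/norP; split; apply/eqP => /finset.setP.
    by move=> /(_ i); rewrite !inE eqxx.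
  by move=> /(_ k); rewrite !inE eqxx.
Qed.

Lemma partition_part_all : finset.partition part_all [set: S]%SET.
Proof.
have dd (x z : S) : x != z -> fintype.disjoint (mem [set x]%SET) (mem [set z]%SET).
  by move=> xz; rewrite disjoints1 inE.
apply/and3P; split.
- apply/eqP/finset.setP => x; rewrite inE; apply/finset.bigcupP; exists [set x]%SET; rewrite ?inE//.
  by case/or3P: (ijk x) => /eqP ->; rewrite eqxx ?orbT.
- apply/finset.trivIsetP => A B; rewrite !inE -!orbA => /or3P[]/eqP -> /or3P[]/eqP ->; rewrite ?eqxx// => _;
    by apply: dd; rewrite // eq_sym.
- rewrite !inE -!orbA; apply/norP; split; [|apply/norP; split]; apply/eqP => /finset.setP.
  + by move=> /(_ i); rewrite !inE eqxx.
  + by move=> /(_ j); rewrite !inE eqxx.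
  + by move=> /(_ k); rewrite !inE eqxx.
Qed.
End coloring3.

Section partitions3.
Context (S : finType) (i j k : S).
Hypotheses (ij : i != j) (ik : i != k) (jk : j != k).
Hypothesis ijk : forall x, [|| x == i, x == j | x == k].

Lemma set3_eq (A B : {set S}) : (i \in A) = (i \in B) -> (j \in A) = (j \in B) ->
  (k \in A) = (k \in B) -> A = B.
Proof.
move=> hi hj hk; apply/finset.setP => x.
by case/or3P: (ijk x) => /eqP ->.
Qed.

(** A partition is the set of the blocks of its three points, so it is determined by which of the
    points share a block. *)
Lemma partition3_cases (pi : {set {set S}}) : finset.partition pi [set: S]%SET ->
  pi = part_one S \/ pi = part_pair i j k \/ pi = part_pair i k j \/
  pi = part_pair j k i \/ pi = part_all i j k.
Proof.
case/and3P => /eqP covP trivP notP0.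
have mem x : x \in finset.pblock pi x by rewrite finset.mem_pblock covP inE.
have same x z : z \in finset.pblock pi x -> finset.pblock pi z = finset.pblock pi x.
  exact: finset.same_pblock.
have sym x z : (z \in finset.pblock pi x) = (x \in finset.pblock pi z).
  by apply/idP/idP => h; rewrite (same _ _ h) mem.
have piE : pi = [set finset.pblock pi i; finset.pblock pi j; finset.pblock pi k]%SET.
  apply/finset.setP => B; rewrite !inE -orbA; apply/idP/or3P => [Bpi|].
    have /finset.set0Pn[x xB] : B != finset.set0 by apply: contraNneq notP0 => <-.
    have <- := finset.def_pblock trivP Bpi xB.
    by case/or3P: (ijk x) => /eqP ->; [apply: Or31|apply: Or32|apply: Or33].
  by case=> /eqP ->; apply: finset.pblock_mem; rewrite covP inE.
have ji : j != i by rewrite eq_sym. have ki : k != i by rewrite eq_sym.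
have kj : k != j by rewrite eq_sym.
have [a|a] := boolP (j \in finset.pblock pi i).
  have Ej := same _ _ a.
  have [b|b] := boolP (k \in finset.pblock pi i).
    left; rewrite piE Ej (same _ _ b) !finset.setUid; congr [set _]%SET.
    by apply: set3_eq; rewrite ?mem ?a ?b inE.
  right; left; rewrite piE Ej finset.setUid /part_pair.
  have -> : finset.pblock pi i = [set i; j]%SET.
    by apply: set3_eq; rewrite !inE ?mem ?a ?(negbTE b) ?eqxx ?orbT// (negbTE ki) (negbTE kj).
  have -> : finset.pblock pi k = [set k]%SET.
    by apply: set3_eq; rewrite !inE ?mem ?eqxx// -sym ?Ej ?(negbTE b) ?(negbTE ik) ?(negbTE jk).
  by [].
have [b|b] := boolP (k \in finset.pblock pi i).
  right; right; left; rewrite piE (same _ _ b) /part_pair.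
  have -> : finset.pblock pi i = [set i; k]%SET.
    by apply: set3_eq; rewrite !inE ?mem ?b ?(negbTE a) ?eqxx ?orbT// (negbTE ji) (negbTE jk).
  have -> : finset.pblock pi j = [set j]%SET.
    apply: set3_eq; rewrite !inE ?mem ?eqxx//.
    - by rewrite -sym (negbTE a) (negbTE ij).
    - by rewrite -sym (same _ _ b) (negbTE a) (negbTE kj).
  by rewrite finset.setUAC finset.setUid.
have Ei : finset.pblock pi i = [set i]%SET.
  by apply: set3_eq; rewrite !inE ?mem ?eqxx// ?(negbTE a) ?(negbTE b) ?(negbTE ji) ?(negbTE ki).
have [c|c] := boolP (k \in finset.pblock pi j).
  right; right; right; left; rewrite piE Ei (same _ _ c) /part_pair.
  have -> : finset.pblock pi j = [set j; k]%SET.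
    by apply: set3_eq; rewrite !inE ?mem ?c ?eqxx ?orbT// -sym (negbTE a) (negbTE ij) (negbTE ik).
  by rewrite -finset.setUA finset.setUid finset.setUC.
right; right; right; right; rewrite piE Ei /part_all.
have -> : finset.pblock pi j = [set j]%SET.
  apply: set3_eq; rewrite !inE ?mem ?eqxx//.
  - by rewrite -sym (negbTE a) (negbTE ij).
  - by rewrite (negbTE c) (negbTE kj).
have -> : finset.pblock pi k = [set k]%SET.
  apply: set3_eq; rewrite !inE ?mem ?eqxx//.
  - by rewrite -sym (negbTE b) (negbTE ik).
  - by rewrite -sym (negbTE c) (negbTE jk).
by [].
Qed.
End partitions3.

Section color_representation3.
Context (R : realType) (S : finType) (i j k : S).
Hypotheses (ij : i != j) (ik : i != k) (jk : j != k).
Hypothesis ijk : forall x, [|| x == i, x == j | x == k].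
Context d (T : measurableType d) (P : probability T R) (Y : S -> T -> bool).
Hypothesis mY : forall x, measurable [set t | Y x t].

Definition pr (E : set T) : R := fine (P E).
Definition atom (a b c : bool) : R := pr [set t | [/\ Y i t = a, Y j t = b & Y k t = c]].
(** [Q1] weighs the single block, [Q2], [Q3], [Q4] the partitions isolating [k], [j], [i] in this
    order, and [Q5] the three singletons. *)
Definition mixture (p Q1 Q2 Q3 Q4 Q5 : R) (a b c : bool) : R :=
  Q1 * block_prob p [&& a, b & c] [&& ~~ a, ~~ b & ~~ c] +
  Q2 * (block_prob p (a && b) (~~ a && ~~ b) * block_prob p c (~~ c)) +
  Q3 * (block_prob p (a && c) (~~ a && ~~ c) * block_prob p b (~~ b)) +
  Q4 * (block_prob p (b && c) (~~ b && ~~ c) * block_prob p a (~~ a)) +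
  Q5 * (block_prob p a (~~ a) * block_prob p b (~~ b) * block_prob p c (~~ c)).

Lemma measurable_value x a : measurable [set t | Y x t = a].
Proof.
case: a; first exact: mY.
rewrite (_ : [set t | _] = ~` [set t | Y x t]); first exact: measurableC.
by apply/seteqP; split => t /= => [->|/negP/negbTE].
Qed.

Lemma measurable_atom a b c : measurable [set t | [/\ Y i t = a, Y j t = b & Y k t = c]].
Proof.
rewrite (_ : [set t | _] = [set t | Y i t = a] `&` [set t | Y j t = b] `&` [set t | Y k t = c]).
  by apply: measurableI; first apply: measurableI; exact: measurable_value.
by apply/seteqP; split => t /= => [[]|[[]]].
Qed.

Let kj : k != j. Proof. by rewrite eq_sym. Qed.
Let ji : j != i. Proof. by rewrite eq_sym. Qed.
Let ki : k != i. Proof. by rewrite eq_sym. Qed.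
Let ikj x : [|| x == i, x == k | x == j]. Proof. by have := ijk x; rewrite orbA orbAC -orbA. Qed.
Let jki x : [|| x == j, x == k | x == i].
Proof. by have := ijk x; rewrite orbC -orbA. Qed.

Lemma atomE (y : {ffun S -> bool}) :
  P [set t | forall x, Y x t = y x] = (atom (y i) (y j) (y k))%:E.
Proof.
rewrite /atom /pr fineK ?fin_num_measure//; last exact: measurable_atom.
congr (P _); apply/seteqP; split => t /= => [h|[hi hj hk] x]; first by split.
by case/or3P: (ijk x) => /eqP ->.
Qed.

(** Replaces the law on sets of sets by five real weights, so that the rest is algebra on eight
    atoms. *)
Lemma has_color_representation3P :
  has_color_representation P Y <->
  exists p Q1 Q2 Q3 Q4 Q5 : R, [/\ 0 <= p <= 1,
    [/\ 0 <= Q1, 0 <= Q2, 0 <= Q3 & 0 <= Q4 /\ 0 <= Q5], Q1 + Q2 + Q3 + Q4 + Q5 = 1 &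
    forall a b c, atom a b c = mixture p Q1 Q2 Q3 Q4 Q5 a b c].
Proof.
pose P1 := part_one S; pose P2 := part_pair i j k; pose P3 := part_pair i k j.
pose P4 := part_pair j k i; pose P5 := part_all i j k.
have mixE p (Q1 Q2 Q3 Q4 Q5 : R) (y : {ffun S -> bool}) :
    mixture p Q1 Q2 Q3 Q4 Q5 (y i) (y j) (y k) =
    Q1 * coloring_prob p P1 y + Q2 * coloring_prob p P2 y + Q3 * coloring_prob p P3 y +
    Q4 * coloring_prob p P4 y + Q5 * coloring_prob p P5 y.
  rewrite /P1 (coloring_prob_one ijk) /P5 coloring_prob_all//.
  by rewrite /P2 /P3 /P4 !coloring_prob_pair.
split=> [[p [q [p01 [q0 qN q1] hq]]]|[p [Q1 [Q2 [Q3 [Q4 [Q5 [p01 [h1 h2 h3 [h4 h5]] hs hat]]]]]]]].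
  (* Breaking ties in this order makes the classes disjoint without proving the partitions distinct. *)
  pose t1 pi := pi == P1.
  pose t2 pi := (pi == P2) && ~~ t1 pi.
  pose t3 pi := [&& pi == P3, ~~ t1 pi & ~~ t2 pi].
  pose t4 pi := [&& pi == P4, ~~ t1 pi, ~~ t2 pi & ~~ t3 pi].
  pose t5 pi := [&& pi == P5, ~~ t1 pi, ~~ t2 pi, ~~ t3 pi & ~~ t4 pi].
  pose Q t := \sum_pi q pi * (t pi : bool)%:R.
  have split5 (F : {set {set S}} -> R) : \sum_pi q pi * F pi =
      Q t1 * F P1 + Q t2 * F P2 + Q t3 * F P3 + Q t4 * F P4 + Q t5 * F P5.
    rewrite /Q !mulr_suml -!big_split /=; apply: eq_bigr => pi _.
    have [pp|/qN ->] := boolP (finset.partition pi [set: S]%SET); last by rewrite !mul0r !addr0.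
    rewrite -!mulrA -!mulrDr; congr (_ * _).
    have : [|| t1 pi, t2 pi, t3 pi, t4 pi | t5 pi].
      have := partition3_cases ij ik jk ijk pp.
      rewrite /t5 /t4 /t3 /t2 /t1 => -[|[|[|[|]]]] ->; rewrite eqxx /=;
        by repeat case: (_ == _) => //=.
    rewrite /t5 /t4 /t3 /t2 /t1.
    have [->|_] := eqVneq pi P1; first by rewrite /= !andbF !mul0r !addr0 mul1r.
    have [->|_] := eqVneq pi P2; first by rewrite /= !andbF !mul0r !addr0 add0r mul1r.
    have [->|_] := eqVneq pi P3; first by rewrite /= !andbF !mul0r !addr0 !add0r mul1r.
    have [->|_] := eqVneq pi P4; first by rewrite /= !andbF !mul0r !addr0 !add0r mul1r.
    have [->|_] := eqVneq pi P5; first by rewrite /= !mul0r !add0r mul1r.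
    by [].
  have Q0 t : 0 <= Q t by apply: sumr_ge0 => pi _; rewrite mulr_ge0.
  exists p, (Q t1), (Q t2), (Q t3), (Q t4), (Q t5); split => //.
    have := split5 (fun=> 1); rewrite !mulr1 => <-.
    by rewrite -[RHS]q1; apply: eq_bigr => pi _; rewrite mulr1.
  move=> a b c; pose y := [ffun x => if x == i then a else if x == j then b else c].
  have ya : y i = a by rewrite ffunE eqxx.
  have yb : y j = b by rewrite ffunE (negbTE ji) eqxx.
  have yc : y k = c by rewrite ffunE (negbTE ki) (negbTE kj).
  have := hq y; rewrite atomE ya yb yc => -[->].
  by rewrite -ya -yb -yc mixE (split5 (fun pi => coloring_prob p pi y)).
(* Adding up point masses gives the right sums without separating the five partitions. *)
pose q pi := Q1 * (pi == P1)%:R + Q2 * (pi == P2)%:R + Q3 * (pi == P3)%:R +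
  Q4 * (pi == P4)%:R + Q5 * (pi == P5)%:R.
have sum1 (Pt : {set {set S}}) (Qt : R) (F : {set {set S}} -> R) :
    \sum_pi Qt * (pi == Pt)%:R * F pi = Qt * F Pt.
  rewrite (bigD1 Pt)//= eqxx mulr1 big1 ?addr0// => pi /negbTE ->.
  by rewrite mulr0 mul0r.
have sumq (F : {set {set S}} -> R) : \sum_pi q pi * F pi =
    Q1 * F P1 + Q2 * F P2 + Q3 * F P3 + Q4 * F P4 + Q5 * F P5.
  rewrite -!sum1 -!big_split /=; apply: eq_bigr => pi _.
  by rewrite /q !mulrDl.
exists p, q; split => //.
- split.
  + by move=> pi; rewrite /q !addr_ge0 ?mulr_ge0.
  + move=> pi; rewrite /q.
    have [->|_] := eqVneq pi P1; first by rewrite (partition_part_one i).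
    have [->|_] := eqVneq pi P2; first by rewrite partition_part_pair.
    have [->|_] := eqVneq pi P3; first by rewrite partition_part_pair.
    have [->|_] := eqVneq pi P4; first by rewrite partition_part_pair.
    have [->|_] := eqVneq pi P5; first by rewrite partition_part_all.
    by rewrite !mulr0 !addr0.
  + transitivity (\sum_pi q pi * 1); first by apply: eq_bigr => pi _; rewrite mulr1.
    by rewrite sumq !mulr1.
- by move=> y; rewrite atomE hat sumq mixE.
Qed.
End color_representation3.

(** * Color representations in terms of pair and triple probabilities *)

Section coloring3_criterion.
Context (R : realType) (S : finType) (i j k : S).
Hypotheses (ij : i != j) (ik : i != k) (jk : j != k).
Hypothesis ijk : forall x, [|| x == i, x == j | x == k].
Context d (T : measurableType d) (P : probability T R) (Y : S -> T -> bool).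
Hypothesis mY : forall x, measurable [set t | Y x t].
Local Notation atom := (atom i j k P Y).

Lemma pr_split (E F : set T) : measurable E -> measurable F ->
  pr P E = pr P (E `&` F) + pr P (E `&` ~` F).
Proof.
move=> mE mF; have mEF := measurableI _ _ mE mF.
have mEF' := measurableI _ _ mE (measurableC mF).
rewrite /pr -fineD ?fin_num_measure// -measureU//.
  by rewrite -setIUr setUv setIT.
by rewrite setIACA setICr setI0.
Qed.

(** Makes every inclusion-exclusion relation below a linear identity between the eight atoms. *)
Lemma pr_atoms (f : bool -> bool -> bool -> bool) :
  pr P [set t | f (Y i t) (Y j t) (Y k t)] =
  \sum_(a : bool) \sum_(b : bool) \sum_(c : bool) (if f a b c then atom a b c else 0).
Proof.
have mv x a : measurable [set t | Y x t = a] by exact: measurable_value.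
have spl x (E : set T) : measurable E ->
    pr P E = \sum_(a : bool) pr P (E `&` [set t | Y x t = a]).
  move=> mE; rewrite (pr_split mE (mv x true)) big_bool; congr (_ + pr P (_ `&` _)).
  by apply/seteqP; split => t /=; case: (Y x t).
have mf : measurable [set t | f (Y i t) (Y j t) (Y k t)].
  rewrite (_ : [set t | _] = \bigcup_(x in [set x : bool * bool * bool | f x.1.1 x.1.2 x.2])
     [set t | [/\ Y i t = x.1.1, Y j t = x.1.2 & Y k t = x.2]]).
    apply: fin_bigcup_measurable; first exact: finite_finset.
    by move=> x _; exact: measurable_atom.
  apply/seteqP; split => t /=.
    by move=> H; exists (Y i t, Y j t, Y k t).
  by move=> [[[a b] c] /= H [-> -> ->]].
rewrite (spl i)//; under eq_bigr => a _.
  rewrite (spl j); last exact: measurableI.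
  under eq_bigr => b _.
    rewrite (spl k); last by apply: measurableI => //; exact: measurableI.
    over.
  over.
apply: eq_bigr => a _; apply: eq_bigr => b _; apply: eq_bigr => c _.
case: ifPn => fabc.
  congr (pr P _); apply/seteqP; split => t /=; first by move=> [[[_ ?] ?] ?].
  by move=> [-> -> ->].
rewrite (_ : _ `&` _ = set0) /pr ?measure0//.
rewrite -subset0 => t /= [[[H ha] hb] hc]; move: H; rewrite ha hb hc.
by rewrite (negbTE fabc).
Qed.

Let p := pr P [set t | Y i t].
Let pij := pr P [set t | Y i t && Y j t].
Let pik := pr P [set t | Y i t && Y k t].
Let pjk := pr P [set t | Y j t && Y k t].
Let pijk := pr P [set t | [&& Y i t, Y j t & Y k t]].

Hypothesis pj : pr P [set t | Y j t] = p.
Hypothesis pk : pr P [set t | Y k t] = p.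

Let pE : p = atom true true true + atom true true false + (atom true false true + atom true false false).
Proof. by rewrite /p (pr_atoms (fun a b c => a))  !big_bool /= !addr0. Qed.
Let pjE : p = atom true true true + atom true true false + (atom false true true + atom false true false).
Proof. by rewrite -pj (pr_atoms (fun a b c => b))  !big_bool /= !addr0. Qed.
Let pkE : p = atom true true true + atom true false true + (atom false true true + atom false false true).
Proof. by rewrite -pk (pr_atoms (fun a b c => c))  !big_bool /= !addr0. Qed.
Let pijE : pij = atom true true true + atom true true false.
Proof. by rewrite /pij (pr_atoms (fun a b c => a && b))  !big_bool /= !addr0. Qed.
Let pikE : pik = atom true true true + atom true false true.
Proof. by rewrite /pik (pr_atoms (fun a b c => a && c))  !big_bool /= !addr0. Qed.
Let pjkE : pjk = atom true true true + atom false true true.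
Proof. by rewrite /pjk (pr_atoms (fun a b c => b && c))  !big_bool /= !addr0 ?add0r. Qed.
Let pijkE : pijk = atom true true true.
Proof. by rewrite /pijk (pr_atoms (fun a b c => [&& a, b & c]))  !big_bool /= !addr0. Qed.
Let p1E : 1 = atom true true true + atom true true false + (atom true false true + atom true false false) +
  (atom false true true + atom false true false + (atom false false true + atom false false false)).
Proof.
have -> : 1 = pr P [set t | true].
  by rewrite /pr (_ : [set t | _] = setT) ?probability_setT//; apply/seteqP; split.
by rewrite (pr_atoms (fun a b c => true))  !big_bool.
Qed.

(** The coefficient 2 is [3 - 1], from expanding the centered product when the three marginals equal
    [p]. *)
Definition kappa := pijk - p * (pij + pik + pjk) + 2 * p ^+ 3.

(* [Q1] and [Q2] are the weights of the one-block partition and of {i, j}, {k}. *)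
Lemma color_representation3_necessary : has_color_representation P Y ->
  exists Q1 Q2 : R, [/\ 0 <= Q1, 0 <= Q2,
    kappa = p * (1 - p) * (1 - 2 * p) * Q1 & pij - p ^+ 2 = p * (1 - p) * (Q1 + Q2)].
Proof.
move=> /(has_color_representation3P ij ik jk ijk _ mY).
move=> [p0 [Q1 [Q2 [Q3 [Q4 [Q5 [_ [h1 h2 _ _] hs hat]]]]]]].
have Q5E : Q5 = 1 - Q1 - Q2 - Q3 - Q4 by lra.
have pp0 : p = p0.
  by rewrite pE !hat /mixture /block_prob /= Q5E; ring.
exists Q1, Q2; split => //.
  (* Centered products factor over the blocks and a singleton contributes 0. So only the single
     block contributes to [kappa], with the third central moment [p (1 - p) (1 - 2 p)] of a
     Bernoulli variable, and only the partitions joining [i] and [j] contribute to their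
     covariance. *)
  by rewrite /kappa pijkE pijE pikE pjkE !hat pp0 /mixture /block_prob /= Q5E; ring.
by rewrite pijE !hat pp0 /mixture /block_prob /= Q5E; ring.
Qed.

(** The weights are found by solving the necessary equations, whose divisors are positive since
    [0 < p < 1 / 2]. The inequalities on [kappa] are the nonnegativity of [Q1] to [Q4]. Their sum is
    the sum of the covariances divided by [p (1 - p)], minus [2 * Q1], so the last hypothesis leaves
    a nonnegative rest for [Q5]. *)
Lemma color_representation3_sufficient : 0 < p -> p < 1 / 2 -> 0 <= kappa ->
  kappa <= (pij - p ^+ 2) * (1 - 2 * p) -> kappa <= (pik - p ^+ 2) * (1 - 2 * p) ->
  kappa <= (pjk - p ^+ 2) * (1 - 2 * p) -> pij + pik + pjk - 3 * p ^+ 2 <= p * (1 - p) ->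
  has_color_representation P Y.
Proof.
move=> p0 p2 k0 kij kik kjk ksum.
apply/(has_color_representation3P ij ik jk ijk _ mY).
pose r := p * (1 - p). pose s := 1 - 2 * p.
have r0 : 0 < r by rewrite /r mulr_gt0//; lra.
have s0 : 0 < s by rewrite /s; lra.
have rs0 : 0 < r * s by exact: mulr_gt0.
pose Q1 := kappa / (r * s).
pose Q2 := (pij - p ^+ 2) / r - Q1.
pose Q3 := (pik - p ^+ 2) / r - Q1.
pose Q4 := (pjk - p ^+ 2) / r - Q1.
have Qge c : kappa <= c * s -> 0 <= c / r - Q1.
  move=> H; rewrite subr_ge0 /Q1 invfM mulrA mulrAC ler_pM2r ?invr_gt0//.
  by rewrite ler_pdivrMr.
have Q1ge : 0 <= Q1 by rewrite /Q1 divr_ge0// ltW.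
exists p, Q1, Q2, Q3, Q4, (1 - Q1 - Q2 - Q3 - Q4); split.
- lra.
- split => //; try exact: Qge; split; first exact: Qge.
  have : (pij + pik + pjk - 3 * p ^+ 2) / r <= 1 by rewrite ler_pdivrMr// mul1r.
  have -> : (pij + pik + pjk - 3 * p ^+ 2) / r =
    (pij - p ^+ 2) / r + (pik - p ^+ 2) / r + (pjk - p ^+ 2) / r by rewrite -!mulrDl; congr (_ / _); ring.
  by rewrite /Q2 /Q3 /Q4; lra.
- by ring.
have p1 : 1 - p != 0 by lra.
have pn0 : p != 0 by lra.
have s1 : 1 - 2 * p != 0 by lra.
have Q1E : Q1 = kappa / (p * (1 - p) * (1 - 2 * p)) by [].
have a111 := pijkE.
have e1 := pE; have e2 := pjE; have e3 := pkE; have e4 := pijE.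
have e5 := pikE; have e6 := pjkE; have e8 := p1E.
have a110 : atom true true false = pij - pijk by lra.
have a101 : atom true false true = pik - pijk by lra.
have a011 : atom false true true = pjk - pijk by lra.
have a100 : atom true false false = p - pij - pik + pijk by lra.
have a010 : atom false true false = p - pij - pjk + pijk by lra.
have a001 : atom false false true = p - pik - pjk + pijk by lra.
have a000 : atom false false false = 1 - 3 * p + pij + pik + pjk - pijk by lra.
move=> a b c; case: a; case: b; case: c;
  rewrite -?a111 ?a110 ?a101 ?a011 ?a100 ?a010 ?a001 ?a000 /mixture /block_prob /=
    /Q2 /Q3 /Q4 Q1E /r /kappa; field; by rewrite pn0 p1 s1.
Qed.
End coloring3_criterion.

(** * Asymptotics of orthant probabilities *)

Section tail_asymptotics.
Context (R : realType).
Local Notation phi := (@normal_pdf R 0 1).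
Local Notation Q := (@Qtail R).

Lemma near_pinfty_ge (a : R) : \forall h \near +oo, a <= h.
Proof. by apply: nbhs_pinfty_ge; rewrite num_real. Qed.

Lemma quadratic_dominates (a b c : R) : 0 < a -> \forall h \near +oo, b * h + c < a * h ^+ 2.
Proof.
move=> a0; near=> h.
have h1 : 1 <= h by near: h; exact: near_pinfty_ge.
have h2 : (`|b| + `|c| + 1) / a <= h by near: h; exact: near_pinfty_ge.
rewrite ler_pdivrMr// in h2.
have hb := ler_norm b; have hc := ler_norm c; have c0 := normr_ge0 c.
apply: (@le_lt_trans _ _ ((`|b| + `|c|) * h)); first by nra.
by rewrite expr2 mulrA ltr_pM2r ?(lt_le_trans ltr01)//; lra.
Unshelve. all: by end_near. Qed.

Lemma expR_quadratic_dominates (A a b c K : R) : a < A ->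
  \forall h \near +oo, K * expR (- (A * h ^+ 2)) < expR (- (a * h ^+ 2 + b * h + c)).
Proof.
move=> aA; have [K0|K0] := leP K 0.
  near=> h; apply: le_lt_trans (expR_gt0 _).
  by rewrite mulr_le0_ge0// expR_ge0.
have d0 : 0 < A - a by lra.
near=> h; rewrite -[X in X * _](lnK (_ : K \is Num.pos))// -expRD ltr_expR.
have : b * h + (ln K + c) < (A - a) * h ^+ 2 by near: h; exact: quadratic_dominates.
lra.
Unshelve. all: by end_near. Qed.

Lemma Qtail_le_exp x : 1 <= x -> Q x <= expR (- (x ^+ 2 / 2)).
Proof.
move=> x1; have x0 : 0 < x by lra.
apply: (le_trans (mills_upper x0)); rewrite ler_pdivrMr// normal_pdf01E mulNr.
have := normal_peak1_le1 R; have := normal_peak_ge0 (1 : R).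
have := expR_ge0 (- (x ^+ 2 / 2)); set k := normal_peak _; set e := expR _; nra.
Qed.

Lemma normal_pdf01_exp x : phi x = expR (- (x ^+ 2 / 2 - ln (normal_peak (1 : R)))).
Proof.
rewrite normal_pdf01E mulNr opprB expRD lnK//.
by rewrite posrE normal_peak_gt0.
Qed.

(** Only a unit interval is kept. The shift adds a linear term to the exponent, harmless wherever
    the quadratic terms differ. *)
Lemma Qtail_ge_pdf x : 0 <= x -> phi (x + 1) <= Q x.
Proof. by move=> x0; rewrite -[leLHS]mul1r; exact: Qtail_ge. Qed.

Lemma Qtail_gt0 x : 0 <= x -> 0 < Q x.
Proof. by move=> x0; apply: lt_le_trans (Qtail_ge_pdf x0); exact: normal_pdf01_gt0. Qed.

(** The exponents are [(c1^2 + c2^2) h^2 / 2] and [C^2 h^2 / 2]; constants and shifts are of lower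
    order. *)
Lemma Qtail_product_dominates (c1 c2 C K : R) : 0 <= c1 -> 0 <= c2 -> 0 < C ->
  c1 ^+ 2 + c2 ^+ 2 < C ^+ 2 ->
  \forall h \near +oo, K * Q (C * h) < Q (c1 * h) * Q (c2 * h).
Proof.
move=> c10 c20 C0 cC; have [K0|K0] := leP K 0.
  near=> h; have h0 : 0 <= h by near: h; exact: near_pinfty_ge.
  apply: (@le_lt_trans _ _ 0); first by rewrite mulr_le0_ge0// Qtail_ge0.
  by rewrite mulr_gt0// Qtail_gt0// mulr_ge0.
pose lk := ln (normal_peak (1 : R)).
have d : (c1 ^+ 2 + c2 ^+ 2) / 2 < C ^+ 2 / 2 by lra.
near=> h.
have h0 : 0 <= h by near: h; exact: near_pinfty_ge.
have hC : C^-1 <= h by near: h; exact: near_pinfty_ge.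
have Ch : 1 <= C * h by rewrite mulrC -ler_pdivrMr// mul1r.
apply: (@le_lt_trans _ _ (K * expR (- (C ^+ 2 / 2 * h ^+ 2)))).
  rewrite ler_pM2l// (le_trans (Qtail_le_exp Ch))// ler_expR.
  by rewrite lerN2 exprMn; lra.
apply: (@lt_le_trans _ _ (phi (c1 * h + 1) * phi (c2 * h + 1))); last first.
  by apply: ler_pM; rewrite ?normal_pdf_ge0// Qtail_ge_pdf// mulr_ge0.
rewrite !normal_pdf01_exp -/lk -expRD -opprD.
have -> : (c1 * h + 1) ^+ 2 / 2 - lk + ((c2 * h + 1) ^+ 2 / 2 - lk) =
  (c1 ^+ 2 + c2 ^+ 2) / 2 * h ^+ 2 + (c1 + c2) * h + (1 - lk *+ 2) by rewrite mulr2n; field.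
by near: h; exact: expR_quadratic_dominates.
Unshelve. all: by end_near. Qed.

Lemma Qtail_small (e : R) : 0 < e -> \forall h \near +oo, Q h < e.
Proof.
move=> e0; near=> h.
have h1 : 1 <= h by near: h; exact: near_pinfty_ge.
apply: le_lt_trans (Qtail_le_exp h1) _.
have : 1 * expR (- (1 / 2 * h ^+ 2)) < expR (- (0 * h ^+ 2 + 0 * h + (- ln e))).
  by near: h; apply: expR_quadratic_dominates; lra.
rewrite !mul0r !add0r opprK lnK ?posrE// !mul1r.
by rewrite mulrC.
Unshelve. all: by end_near. Qed.

Lemma Qtail_ratio_small (C e : R) : 1 < C -> 0 < e ->
  \forall h \near +oo, Q (C * h) < e * Q h.
Proof.
move=> C1 e0; near=> h.
have h0 : 0 <= h by near: h; exact: near_pinfty_ge.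
rewrite -ltr_pdivrMl//.
(* The second level is 0: [Q 0] is a constant factor, at most 1. *)
apply: (@lt_le_trans _ _ (Q (1 * h) * Q (0 * h))).
  near: h; apply: Qtail_product_dominates; rewrite ?expr0n ?addr0//; first lra.
  by rewrite ltrXn2r//; lra.
by rewrite mul1r ler_piMr ?Qtail_ge0 ?Qtail_le1.
Unshelve. all: by end_near. Qed.

(** The right-hand side is the lower bound supplied by [box_lower_band]; its exponent is below the
    exponent [h^2] of [Q h ^+ 2], and the shifts [1] and [D] cost only linear terms. *)
Lemma Qtail_sqr_small (c1 c2 D : R) : 0 <= c1 -> 0 <= c2 -> 0 <= D ->
  1 + c1 ^+ 2 + c2 ^+ 2 < 2 ->
  \forall h \near +oo, 2 * Q h ^+ 2 <= phi (h + 1) * phi (c1 * h + 1) * Q (c2 * h + D).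
Proof.
move=> c10 c20 D0 cc.
pose lk := ln (normal_peak (1 : R)).
have d : (1 + c1 ^+ 2 + c2 ^+ 2) / 2 < 1 by lra.
near=> h.
have h1 : 1 <= h by near: h; exact: near_pinfty_ge.
have h0 : 0 <= h by lra.
apply: (@le_trans _ _ (2 * expR (- (1 * h ^+ 2)))).
  rewrite ler_pM2l// -[X in _ <= expR (- X)](_ : h ^+ 2 / 2 + h ^+ 2 / 2 = _); last by lra.
  rewrite opprD expRD expr2; apply: ler_pM; rewrite ?Qtail_ge0//; exact: Qtail_le_exp.
apply: (@le_trans _ _ (phi (h + 1) * phi (c1 * h + 1) * phi (c2 * h + D + 1))); last first.
  rewrite ler_wpM2l ?mulr_ge0 ?normal_pdf_ge0//; apply: Qtail_ge_pdf.
  by rewrite addr_ge0// mulr_ge0.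
rewrite !normal_pdf01_exp -/lk -!expRD -!opprD.
have -> : (h + 1) ^+ 2 / 2 - lk + ((c1 * h + 1) ^+ 2 / 2 - lk) + ((c2 * h + D + 1) ^+ 2 / 2 - lk) =
  (1 + c1 ^+ 2 + c2 ^+ 2) / 2 * h ^+ 2 + (1 + c1 + c2 * (D + 1)) * h
   + (1 + (D + 1) ^+ 2 / 2 - lk *+ 3) by rewrite !mulrS; field.
by apply: ltW; near: h; exact: expR_quadratic_dominates.
Unshelve. all: by end_near. Qed.

(* At the critical exponent [C^2 + c^2 = 2] both sides decay like [exp (- h^2) / h^2], so the constants matter. *)
Lemma Qtail_critical (C c : R) : 0 < C -> 0 < c -> 2 <= C ^+ 2 + c ^+ 2 ->
  exists2 K : R, 0 < K & forall D : R, 0 <= D -> \forall h \near +oo,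
    Q (C * h + D) * Q (c * h) <= K * expR (- (C * D * h)) * Q h ^+ 2.
Proof.
(* [expR 3] is the square of the loss in [mills_lower], and [C * c] collects the denominators of
   [mills_upper]. The factor [expR (- (C * D * h))] is the cross term of [(C * h + D)^2 / 2]. *)
move=> C0 c0 Cc; exists (expR 3 / (C * c)); first by rewrite divr_gt0 ?expR_gt0// mulr_gt0.
move=> D D0; near=> h.
have h1 : 1 <= h by near: h; exact: near_pinfty_ge.
have h0 : 0 < h by lra.
have Ch0 : 0 < C * h by rewrite mulr_gt0.
have ch0 : 0 < c * h by rewrite mulr_gt0.
have k0 := normal_peak_gt0 (oner_neq0 R).
have hn : h != 0 by rewrite gt_eqF.
have Cn : C != 0 by rewrite gt_eqF.
have cn : c != 0 by rewrite gt_eqF.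
pose X := normal_peak 1 * expR (- (h ^+ 2 / 2)) / h.
have X0 : 0 < X by rewrite /X divr_gt0// mulr_gt0// expR_gt0.
have lower : X <= expR (3 / 2) * Q h.
  have := mills_lower h1; rewrite normal_pdf01E mulNr -mulrA -/X expRN mulrC.
  by rewrite ler_pdivrMr ?expR_gt0// mulrC.
have lower2 : X ^+ 2 <= expR 3 * Q h ^+ 2.
  have -> : expR 3 = expR (3 / 2) ^+ 2 :> R by rewrite -expRM_natr; congr expR; lra.
  rewrite -exprMn; apply: lerXn2r => //; rewrite nnegrE; first exact: ltW.
  by rewrite mulr_ge0 ?expR_ge0 ?Qtail_ge0.
have upper1 : Q (C * h + D) <= normal_peak 1 * expR (- ((C * h + D) ^+ 2 / 2)) / (C * h).
  apply: (le_trans (mills_upper (_ : 0 < C * h + D))); first by rewrite ltr_wpDr.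
  rewrite normal_pdf01E mulNr ler_pM2l ?mulr_gt0 ?expR_gt0//.
  by rewrite lef_pV2 ?posrE ?ltr_wpDr// lerDl.
have upper2 : Q (c * h) <= normal_peak 1 * expR (- ((c * h) ^+ 2 / 2)) / (c * h).
  by apply: (le_trans (mills_upper ch0)); rewrite normal_pdf01E mulNr.
apply: (@le_trans _ _ (X ^+ 2 * expR (- (C * D * h)) / (C * c))); last first.
  rewrite [leRHS](_ : _ = expR 3 * Q h ^+ 2 * (expR (- (C * D * h)) / (C * c))); last by ring.
  by rewrite -mulrA ler_wpM2r// divr_ge0 ?expR_ge0// ltW// mulr_gt0.
apply: (le_trans (ler_pM (Qtail_ge0 _) (Qtail_ge0 _) upper1 upper2)).
set k := normal_peak 1 in X X0 lower lower2 upper1 upper2 k0 *.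
have -> : k * expR (- ((C * h + D) ^+ 2 / 2)) / (C * h) * (k * expR (- ((c * h) ^+ 2 / 2)) / (c * h)) =
  k ^+ 2 / h ^+ 2 / (C * c) * (expR (- ((C * h + D) ^+ 2 / 2)) * expR (- ((c * h) ^+ 2 / 2))).
  by field; rewrite hn Cn cn.
have -> : X ^+ 2 * expR (- (C * D * h)) / (C * c) =
  k ^+ 2 / h ^+ 2 / (C * c) * (expR (- (h ^+ 2 / 2)) * expR (- (h ^+ 2 / 2)) * expR (- (C * D * h))).
  by rewrite /X; field; rewrite hn Cn cn.
have kh0 : 0 < k ^+ 2 / h ^+ 2 / (C * c).
  apply: divr_gt0; last exact: mulr_gt0.
  by apply: divr_gt0; exact: exprn_gt0.
rewrite ler_pM2l//.
rewrite -!expRD ler_expR.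
have : 0 <= (C ^+ 2 + c ^+ 2 - 2) * h ^+ 2 by rewrite mulr_ge0 ?sqr_ge0// subr_ge0.
have := sqr_ge0 D; nra.
Unshelve. all: by end_near. Qed.
End tail_asymptotics.

(** * Probabilities of boxes in independent coordinates *)

Section boxes.
Context (R : realType) d (T : measurableType d) (P : probability T R).
Local Notation phi := (@normal_pdf R 0 1).
Local Notation g := (@normal_prob R 0 1).
Local Notation Q := (@Qtail R).
Context (N : T -> R * R * R) (iN : iid3 P N).
Implicit Types (E : set T) (a b c e : R).

Let fg (A : set R) : measurable A -> (fine (g A))%:E = g A.
Proof. by move=> mA; rewrite fineK// fin_num_measure. Qed.

Lemma iid3_box (A B C : set R) : measurable A -> measurable B -> measurable C ->
  measurable [set t | [/\ A (N t).1.1, B (N t).1.2 & C (N t).2]] /\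
  pr P [set t | [/\ A (N t).1.1, B (N t).1.2 & C (N t).2]] =
  fine (g A) * fine (g B) * fine (g C).
Proof.
move=> mA mB mC; have [mN hN] := iN; split.
  rewrite (_ : [set t | _] = N @^-1` (A `*` B `*` C)).
    by rewrite -[X in measurable X]setTI; apply: mN => //; apply: measurableX => //; exact: measurableX.
  by apply/seteqP; split => t /= => [[]|[[]]].
by rewrite /pr hN// !fineM ?fin_numM ?fin_num_measure.
Qed.

Lemma pr_le E F : measurable E -> measurable F -> E `<=` F -> pr P E <= pr P F.
Proof.
by move=> mE mF EF; rewrite /pr fine_le ?fin_num_measure ?le_measure ?inE.
Qed.

Lemma pr_setU_le E F : measurable E -> measurable F -> pr P (E `|` F) <= pr P E + pr P F.
Proof.
move=> mE mF; rewrite /pr -fineD ?fin_num_measure// fine_le ?fin_numD ?fin_num_measure//.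
- exact: measurableU.
- exact: measureU2.
Qed.

Lemma box_lower3 a b c E : measurable E ->
  (forall t, a < (N t).1.1 -> b < (N t).1.2 -> c < (N t).2 -> E t) ->
  Q a * Q b * Q c <= pr P E.
Proof.
move=> mE H.
have [mB <-] := iid3_box (measurable_itv `]a, +oo[) (measurable_itv `]b, +oo[) (measurable_itv `]c, +oo[).
by apply: pr_le => // t /= []; rewrite !in_itv/= !andbT; exact: H.
Qed.

(** Bounding the first two coordinates from both sides keeps the regression on them within a
    constant of its value at the corner. *)
Lemma box_lower_band a b c E : measurable E -> 0 <= a -> 0 <= b ->
  (forall t, a < (N t).1.1 < a + 1 -> b < (N t).1.2 < b + 1 -> c < (N t).2 -> E t) ->
  phi (a + 1) * phi (b + 1) * Q c <= pr P E.
Proof.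
move=> mE a0 b0 H.
have [mB prB] := iid3_box (measurable_itv `]a, (a + 1)[) (measurable_itv `]b, (b + 1)[)
  (measurable_itv `]c, +oo[).
have band x : 0 <= x -> phi (x + 1) <= fine (g `]x, (x + 1)[%classic).
  move=> x0; rewrite -lee_fin fg//.
  by have := normal_prob_itv_ge x0 ler01; rewrite mul1r.
apply: (@le_trans _ _ (pr P [set t | [/\ `]a, (a + 1)[%classic (N t).1.1,
    `]b, (b + 1)[%classic (N t).1.2 & `]c, +oo[%classic (N t).2]])).
  rewrite prB; apply: ler_pM; rewrite ?mulr_ge0 ?normal_pdf_ge0 ?Qtail_ge0//.
  by apply: ler_pM; rewrite ?normal_pdf_ge0 ?band.
by apply: pr_le => // t /= []; rewrite !in_itv/= !andbT; exact: H.
Qed.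

Lemma fine_normal_prob_setT : fine (g setT) = 1. Proof. by rewrite normal_prob_setT. Qed.

Lemma box_upper1 a E : measurable E -> (forall t, E t -> a < (N t).1.1) -> pr P E <= Q a.
Proof.
move=> mE H.
have [mB prB] := iid3_box (measurable_itv `]a, +oo[) (@measurableT _ R) (@measurableT _ R).
rewrite !fine_normal_prob_setT !mulr1 in prB; rewrite -[leRHS]prB.
by apply: pr_le => // t Et /=; rewrite in_itv/= andbT; split => //; exact: H.
Qed.

(** Two boxes cover the event: a higher level for the first coordinate, or a band for the second, of
    mass at most [2 * e] because the density is at most 1. *)
Lemma box_upper_union a b c e E : measurable E -> 0 <= e ->
  (forall t, E t -> c < (N t).2 /\ (b < (N t).1.1 \/ a < (N t).1.1 /\ - e < (N t).1.2 < e)) ->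
  pr P E <= (Q b + Q a * (2 * e)) * Q c.
Proof.
move=> mE e0 H.
have [mB prB] := iid3_box (measurable_itv `]b, +oo[) (@measurableT _ R) (measurable_itv `]c, +oo[).
have [mA prA] := iid3_box (measurable_itv `]a, +oo[) (measurable_itv `](- e), e[) (measurable_itv `]c, +oo[).
rewrite fine_normal_prob_setT mulr1 in prB.
apply: (@le_trans _ _ (pr P _)); last first.
  apply: (@le_trans _ _ (pr P [set t | [/\ `]b, +oo[%classic (N t).1.1, setT (N t).1.2 &
     `]c, +oo[%classic (N t).2]] + pr P [set t | [/\ `]a, +oo[%classic (N t).1.1,
     `](- e), e[%classic (N t).1.2 & `]c, +oo[%classic (N t).2]])).
    exact: pr_setU_le.
  rewrite prB prA mulrDl lerD2l; apply: ler_wpM2r; first exact: Qtail_ge0.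
  apply: ler_wpM2l; first exact: Qtail_ge0.
  by rewrite -lee_fin fg// normal_prob_band_le.
apply: pr_le => //; first exact: measurableU.
move=> t Et; have [h2 [h0|[h0 h1]]] := H t Et.
- by left => /=; rewrite !in_itv/= !andbT.
- by right => /=; rewrite !in_itv/= !andbT.
Qed.

Lemma box_eq1 a : pr P [set t | a < (N t).1.1] = Q a.
Proof.
have [_ prB] := iid3_box (measurable_itv `]a, +oo[) (@measurableT _ R) (@measurableT _ R).
rewrite !fine_normal_prob_setT !mulr1 in prB; rewrite -[RHS]prB; congr (pr P _).
by apply/seteqP; split => t /= => [h|[]]; rewrite in_itv/= andbT.
Qed.

Lemma box_eq2 a b : pr P [set t | (a < (N t).1.1) && (b < (N t).1.2)] = Q a * Q b.
Proof.
have [_ prB] := iid3_box (measurable_itv `]a, +oo[) (measurable_itv `]b, +oo[) (@measurableT _ R).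
rewrite fine_normal_prob_setT mulr1 in prB; rewrite -[RHS]prB; congr (pr P _).
apply/seteqP; split => t /=; rewrite !in_itv/= !andbT; first by move=> /andP[].
by move=> [-> ->].
Qed.
End boxes.

(** * Gaussian triples in adapted coordinates *)

Section gauss3.
Context (R : realType) d (T : measurableType d) (P : probability T R).
Local Notation phi := (@normal_pdf R 0 1).
Local Notation Q := (@Qtail R).
Implicit Types (a b c h : R) (U V W : T -> R).

(** The vectors stay unspecified up to their Gram matrix, so the triple can be permuted and each
    estimate can choose its own coordinates. *)
Definition gauss3 a b c U V W : Prop :=
  exists (N : T -> R * R * R) (u v w : R * R * R), [/\ iid3 P N,
    [/\ dot3 u u = 1, dot3 v v = 1 & dot3 w w = 1],
    [/\ dot3 u v = a, dot3 u w = b & dot3 v w = c]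
    & forall t, [/\ U t = dot3 u (N t), V t = dot3 v (N t) & W t = dot3 w (N t)]].

Lemma dot3C (x y : R * R * R) : dot3 x y = dot3 y x.
Proof. by rewrite /dot3; ring. Qed.

Lemma gauss3_swap12 a b c U V W : gauss3 a b c U V W -> gauss3 a c b V U W.
Proof.
move=> [N [u [v [w [iN [? ? ?] [? ? ?] H]]]]]; exists N, v, u, w; split => //.
- by rewrite dot3C.
- by move=> t; have [] := H t.
Qed.

Lemma gauss3_swap23 a b c U V W : gauss3 a b c U V W -> gauss3 b a c U W V.
Proof.
move=> [N [u [v [w [iN [? ? ?] [? ? ?] H]]]]]; exists N, u, w, v; split => //.
- by split => //; rewrite dot3C.
- by move=> t; have [] := H t.
Qed.

Lemma measurable_ltr (U : T -> R) h : measurable_fun setT U -> measurable [set t | h < U t].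
Proof.
move=> mU; have := mU measurableT `]h, +oo[%classic (measurable_itv _).
rewrite setTI; congr (measurable _); apply/seteqP; split => t /=; rewrite in_itv/= andbT//.
Qed.

Lemma gauss3_measurable a b c U V W : gauss3 a b c U V W ->
  [/\ measurable_fun setT U, measurable_fun setT V & measurable_fun setT W].
Proof.
move=> [N [u [v [w [[mN _] _ _ H]]]]].
have E X x : (forall t, X t = dot3 x (N t)) -> measurable_fun setT X.
  by move=> /funext ->; exact: measurable_dot3.
by split; [apply: (E _ u)|apply: (E _ v)|apply: (E _ w)] => t; have [] := H t.
Qed.

Lemma gauss3_measurable_and a b c U V W h : gauss3 a b c U V W ->
  measurable [set t | (h < U t) && (h < V t)].
Proof.
move=> G; have [mU mV _] := gauss3_measurable G.
rewrite (_ : [set t | _] = [set t | h < U t] `&` [set t | h < V t]).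
  by apply: measurableI; exact: measurable_ltr.
by apply/seteqP; split => t /= => [/andP[]|[-> ->]].
Qed.

Lemma gauss3_measurable_and3 a b c U V W h : gauss3 a b c U V W ->
  measurable [set t | [&& h < U t, h < V t & h < W t]].
Proof.
move=> G; have [mU mV mW] := gauss3_measurable G.
rewrite (_ : [set t | _] = [set t | (h < U t) && (h < V t)] `&` [set t | h < W t]).
  by apply: measurableI; [exact: (gauss3_measurable_and h G)|exact: measurable_ltr].
by apply/seteqP; split => t /= => [/and3P[-> -> ->]|[/andP[-> ->]]].
Qed.

Lemma gauss3_measurable_and_not a b c U V W h : gauss3 a b c U V W ->
  measurable [set t | [&& h < U t, h < V t & ~~ (h < W t)]].
Proof.
move=> G; have [mU mV mW] := gauss3_measurable G.
rewrite (_ : [set t | _] = [set t | (h < U t) && (h < V t)] `&` ~` [set t | h < W t]).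
  by apply: measurableI; [exact: (gauss3_measurable_and h G)|exact/measurableC/measurable_ltr].
by apply/seteqP; split => t /= => [/and3P[-> -> /negP]|[/andP[-> ->] /negP]].
Qed.

Lemma gauss3_pr_split a b c U V W h : gauss3 a b c U V W ->
  pr P [set t | (h < U t) && (h < V t)] =
  pr P [set t | [&& h < U t, h < V t & h < W t]] +
  pr P [set t | [&& h < U t, h < V t & ~~ (h < W t)]].
Proof.
move=> G; have [_ _ mW] := gauss3_measurable G.
rewrite (pr_split P (gauss3_measurable_and h G) (measurable_ltr h mW)).
congr (pr P _ + pr P _); apply/seteqP; split => t /=.
- by move=> [/andP[-> ->]].
- by move=> /and3P[-> -> ->].
- by move=> [/andP[-> ->] /negP].
- by move=> /and3P[-> -> /negP].
Qed.

(** Determinant of the correlation matrix with off-diagonal entries [a] (first and second), [b]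
    (first and third), [c] (second and third). *)
Definition det3 a b c : R := 1 + 2 * a * b * c - a ^+ 2 - b ^+ 2 - c ^+ 2.

(** [al] and [be] are the regression coefficients of [W] on [U] and [V], and [s^2] is the residual
    variance. [W] is left in terms of [U] and [V] because the events bound these directly. *)
Lemma gauss3_cholesky a b c U V W : a ^+ 2 < 1 -> gauss3 a b c U V W ->
  exists (N : T -> R * R * R) (r s al be : R), [/\ iid3 P N,
    [/\ 0 < r, 0 <= s, r ^+ 2 = 1 - a ^+ 2 & s ^+ 2 * (1 - a ^+ 2) = det3 a b c],
    al * (1 - a ^+ 2) = b - a * c /\ be * (1 - a ^+ 2) = c - a * b
    & forall t, [/\ U t = (N t).1.1, V t = a * (N t).1.1 + r * (N t).1.2
      & W t = al * U t + be * V t + s * (N t).2]].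
Proof.
move=> a1 [N [u [v [w [iN [uu vv ww] [uv uw vw] H]]]]].
have [f [[f1 f2] [u1 u2 v2] [u0 v1 w2]]] := gaussian_isometry_triangular u v w.
have fu : (f u).1.1 = 1.
  have : (f u).1.1 ^+ 2 = 1 by rewrite -uu -f1 /dot3 u1 u2; ring.
  by move=> /eqP; rewrite sqrf_eq1 => /orP[/eqP//|/eqP E]; move: u0; rewrite E; lra.
have fv : (f v).1.1 = a by rewrite -uv -f1 /dot3 u1 u2 fu; ring.
have fw : (f w).1.1 = b by rewrite -uw -f1 /dot3 u1 u2 fu; ring.
pose r := (f v).1.2. pose be' := (f w).1.2. pose s := (f w).2.
have r2 : r ^+ 2 = 1 - a ^+ 2.
  by rewrite -vv -f1 /dot3 v2 fv /r; ring.
have r0 : 0 < r by rewrite lt_neqAle eq_sym v1 andbT; apply/eqP => E; move: r2; rewrite E expr0n /=; lra.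
have rb : r * be' = c - a * b by rewrite -vw -f1 /dot3 v2 fv fw /r /be'; ring.
have s2 : s ^+ 2 = 1 - b ^+ 2 - be' ^+ 2 by rewrite -ww -f1 /dot3 fw /s /be'; ring.
have rn : r != 0 by rewrite gt_eqF.
exists (f \o N), r, s, (b - a * be' / r), (be' / r); split.
- exact: f2.
- split => //; rewrite s2 -r2.
  transitivity (r ^+ 2 * (1 - b ^+ 2) - (r * be') ^+ 2); first by ring.
  by rewrite rb r2 /det3; ring.
- rewrite -r2; split.
    transitivity (b * r ^+ 2 - a * (r * be')); first by field.
    by rewrite r2 rb; ring.
  by transitivity (r * be'); [field|].
- move=> t; have [-> -> ->] := H t.
  rewrite -(f1 u) -(f1 v) -(f1 w) /dot3 u1 u2 v2 fu fv fw -/r -/be' -/s /=.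
  by split; [ring|ring|field].
Qed.

(** [U + V] and [U - V] are uncorrelated since the variances agree, so a triangular frame puts them
    on the first two axes. Their variances are [2 + 2 a] and [2 - 2 a]. *)
Lemma gauss3_sum_diff a b c U V W : a ^+ 2 < 1 -> gauss3 a b c U V W ->
  exists (N : T -> R * R * R) (u v s al be : R), [/\ iid3 P N,
    [/\ 0 < u, 0 < v, u ^+ 2 = 2 + 2 * a & v ^+ 2 = 2 - 2 * a],
    [/\ 0 <= s, s ^+ 2 * (1 - a ^+ 2) = det3 a b c,
      al * (1 - a ^+ 2) = b - a * c & be * (1 - a ^+ 2) = c - a * b]
    & forall t, [/\ U t + V t = u * (N t).1.1, U t - V t = v * (N t).1.2
      & W t = al * U t + be * V t + s * (N t).2]].
Proof.
move=> a1 [N [x [y [w [iN [xx yy ww] [xy xw yw] H]]]]].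
pose p : R * R * R := (x.1.1 + y.1.1, x.1.2 + y.1.2, x.2 + y.2).
pose q : R * R * R := (x.1.1 - y.1.1, x.1.2 - y.1.2, x.2 - y.2).
have pD z : dot3 p z = dot3 x z + dot3 y z by rewrite /dot3 /=; ring.
have qD z : dot3 q z = dot3 x z - dot3 y z by rewrite /dot3 /=; ring.
have [f [[f1 f2] [p1 p2 q2] [u0 v0 s0]]] := gaussian_isometry_triangular p q w.
set u := (f p).1.1 in u0. set v := (f q).1.2 in v0. set s := (f w).2 in s0.
have aa : 0 < 1 + a /\ 0 < 1 - a by split; nra.
have u2 : u ^+ 2 = 2 + 2 * a.
  transitivity (dot3 p p); first by rewrite -f1 /dot3 p1 p2 /u; ring.
  by rewrite pD !(dot3C _ p) !pD (dot3C y x) xx yy xy; ring.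
have up : 0 < u by rewrite lt_neqAle eq_sym u0 andbT; apply/eqP => E; move: u2; rewrite E expr0n /=; lra.
have un : u != 0 by rewrite gt_eqF.
have q1 : (f q).1.1 = 0.
  apply: (mulfI un); rewrite mulr0; transitivity (dot3 p q).
    by rewrite -f1 /dot3 p1 p2 /u; ring.
  by rewrite pD !(dot3C _ q) !qD (dot3C y x) xx yy xy; ring.
have v2 : v ^+ 2 = 2 - 2 * a.
  transitivity (dot3 q q); first by rewrite -f1 /dot3 q1 q2 /v; ring.
  by rewrite qD !(dot3C _ q) !qD (dot3C y x) xx yy xy; ring.
have vp : 0 < v by rewrite lt_neqAle eq_sym v0 andbT; apply/eqP => E; move: v2; rewrite E expr0n /=; lra.
have vn : v != 0 by rewrite gt_eqF.
set w0 := (f w).1.1. set w1 := (f w).1.2.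
have uw : u * w0 = b + c.
  by rewrite -xw -yw -pD -f1 /dot3 p1 p2 /u /w0; ring.
have vw : v * w1 = b - c.
  by rewrite -xw -yw -qD -f1 /dot3 q1 q2 /v /w1; ring.
have s2 : s ^+ 2 = 1 - w0 ^+ 2 - w1 ^+ 2 by rewrite -ww -f1 /dot3 /w0 /w1 /s; ring.
have uv4 : u ^+ 2 * v ^+ 2 = 4 * (1 - a ^+ 2) by rewrite u2 v2; ring.
have A2 : 1 - a ^+ 2 = u ^+ 2 * v ^+ 2 / 4 by rewrite uv4; field.
exists (f \o N), u, v, s, (w0 / u + w1 / v), (w0 / u - w1 / v); split => //.
- exact: f2.
- split => //.
  + rewrite s2 A2.
    transitivity ((u ^+ 2 * v ^+ 2 - v ^+ 2 * (u * w0) ^+ 2 - u ^+ 2 * (v * w1) ^+ 2) / 4); first by field.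
    by rewrite uw vw u2 v2 /det3; field.
  + rewrite A2; transitivity ((v ^+ 2 * (u * w0) + u ^+ 2 * (v * w1)) / 4); first by field; rewrite un vn.
    by rewrite uw vw u2 v2; field.
  + rewrite A2; transitivity ((v ^+ 2 * (u * w0) - u ^+ 2 * (v * w1)) / 4); first by field; rewrite un vn.
    by rewrite uw vw u2 v2; field.
- move=> t; have [-> -> ->] := H t; rewrite -pD -qD.
  have e1 : dot3 p (N t) = u * (f (N t)).1.1 by rewrite -f1 /dot3 p1 p2 /u; ring.
  have e2 : dot3 q (N t) = v * (f (N t)).1.2 by rewrite -f1 /dot3 q1 q2 /v; ring.
  have ex : dot3 x (N t) = (u * (f (N t)).1.1 + v * (f (N t)).1.2) / 2.
    by rewrite -e1 -e2 pD qD; field.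
  have ey : dot3 y (N t) = (u * (f (N t)).1.1 - v * (f (N t)).1.2) / 2.
    by rewrite -e1 -e2 pD qD; field.
  split => //; rewrite ex ey -(f1 w) /dot3 -/w0 -/w1 -/s /=.
  by field; rewrite un vn.
Qed.
End gauss3.

Lemma eq_of_sqr (R : realType) (x y : R) : 0 <= x -> 0 <= y -> x ^+ 2 = y ^+ 2 -> x = y.
Proof. by move=> x0 y0 /eqP; rewrite eqrXn2// => /eqP. Qed.

Lemma le_of_sqr (R : realType) (x y : R) : 0 <= y -> x ^+ 2 <= y ^+ 2 -> x <= y.
Proof.
move=> y0 h; rewrite leNgt; apply/negP => yx.
have : 0 < (x - y) * (x + y) by apply: mulr_gt0; lra.
by rewrite -subr_sqr; lra.
Qed.

Section gauss3_bounds.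
Context (R : realType) d (T : measurableType d) (P : probability T R).
Local Notation phi := (@normal_pdf R 0 1).
Local Notation Q := (@Qtail R).
Context (a b c : R) (U V W : T -> R).
Hypothesis a1 : a ^+ 2 < 1.
Hypothesis G : gauss3 P a b c U V W.
Implicit Types h : R.

Hypothesis D0 : 0 < det3 a b c.

Let aL : a < 1. Proof. by move: a1 => k; rewrite ltNge; apply/negP => h; nra. Qed.
Let aG : 0 < 1 + a.
Proof.
move: a1 => k; rewrite ltNge; apply/negP => h.
have : 0 <= (1 - a) * (- 1 - a) by apply: mulr_ge0; lra.
lra.
Qed.
Let A0 : 0 < 1 - a ^+ 2. Proof. by rewrite subr_gt0. Qed.

Lemma gauss3_pr1 h : pr P [set t | h < U t] = Q h.
Proof.
have [N [r [s [al [be [iN _ _ H]]]]]] := gauss3_cholesky a1 G.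
rewrite -(box_eq1 iN); congr (pr P _); apply/seteqP; split => t /=; by have [-> _ _] := H t.
Qed.

(** The event forces [U + V > 2 h], that is, the normalized sum exceeds [(2 / u) h = C h]. *)
Lemma gauss3_pr2_le h (C : R) : 0 < C -> C ^+ 2 * (1 + a) = 2 ->
  pr P [set t | (h < U t) && (h < V t)] <= Q (C * h).
Proof.
move=> C0 C2; have [N [u [v [s [al [be [iN [u0 v0 u2 _] _ H]]]]]]] := gauss3_sum_diff a1 G.
have uC : u * C = 2.
  apply: eq_of_sqr; rewrite ?mulr_ge0// ?ltW//.
  by rewrite exprMn u2; lra.
apply: (box_upper1 iN); first exact: (gauss3_measurable_and h G).
move=> t /= /andP[hU hV]; have [e _ _] := H t.
rewrite -(ltr_pM2l u0) -e mulrA uC; lra.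
Qed.

Lemma gauss3_pr2_indep h : a = 0 -> pr P [set t | (h < U t) && (h < V t)] = Q h ^+ 2.
Proof.
move=> a0; have [N [r [s [al [be [iN [r0 _ r2 _] _ H]]]]]] := gauss3_cholesky a1 G.
have r1 : r = 1.
  by apply: eq_of_sqr; rewrite ?ltW// r2 a0; ring.
rewrite expr2 -(box_eq2 iN); congr (pr P _); apply/seteqP; split => t /=;
  by have [-> -> _] := H t; rewrite a0 r1 mul0r add0r mul1r.
Qed.

(** The box starts at levels [h], [c1 h], [c2 h]. With [U = h], the level [c1 h] brings [V] to [h],
    as [r c1 = 1 - a]; with [U = V = h], the level [c2 h] brings [W] to at least [h]. Since [a],
    [al] and [be] are nonnegative, checking the corner suffices. *)
Lemma gauss3_pr3_ge h (c1 c2 : R) : 0 <= h -> 0 <= a -> 0 <= c1 -> 0 <= c2 ->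
  c1 ^+ 2 * (1 + a) = 1 - a -> 0 <= b - a * c -> 0 <= c - a * b ->
  1 + a <= b + c \/ (1 + a - b - c) ^+ 2 * (1 - a) <= c2 ^+ 2 * (1 + a) * det3 a b c ->
  Q h * Q (c1 * h) * Q (c2 * h) <= pr P [set t | [&& h < U t, h < V t & h < W t]].
Proof.
move=> h0 a0 c10 c20 c12 al0 be0 c22.
have [N [r [s [al [be [iN [r0 s0 r2 s2] [ale bee] H]]]]]] := gauss3_cholesky a1 G.
have sp : 0 < s.
  by rewrite lt_neqAle eq_sym s0 andbT; apply/eqP => E; move: s2 D0; rewrite E expr0n mul0r => <-; rewrite ltxx.
have alp : 0 <= al by rewrite -(pmulr_lge0 _ A0) ale.
have bep : 0 <= be by rewrite -(pmulr_lge0 _ A0) bee.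
have rc1 : r * c1 = 1 - a.
  apply: eq_of_sqr; rewrite ?mulr_ge0// ?subr_ge0 ?ltW//.
  apply: (mulIf (lt0r_neq0 aG)); rewrite exprMn -mulrA c12 r2; ring.
have abE : (al + be) * (1 + a) = b + c.
  have an : 1 - a != 0 by rewrite subr_eq0 gt_eqF.
  apply: (mulIf an); transitivity (al * (1 - a ^+ 2) + be * (1 - a ^+ 2)); first by ring.
  by rewrite ale bee; ring.
(* In the first case [al + be = (b + c) / (1 + a) >= 1], so the left side is nonpositive. In the
   second, squaring and clearing denominators gives the hypothesis. *)
have sc2 : 1 - (al + be) <= s * c2.
  case: c22 => [h1|h1].
    by apply: (@le_trans _ _ 0); [nra|rewrite mulr_ge0].
  apply: le_of_sqr; first by rewrite mulr_ge0.
  have B0 : 0 < (1 - a ^+ 2) * (1 + a) by rewrite mulr_gt0.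
  rewrite -(ler_pM2r B0) -(ler_pM2r aG).
  have -> : (s * c2) ^+ 2 * ((1 - a ^+ 2) * (1 + a)) * (1 + a) =
    (1 + a) * (c2 ^+ 2 * (1 + a) * (s ^+ 2 * (1 - a ^+ 2))) by ring.
  rewrite s2.
  have -> : (1 - (al + be)) ^+ 2 * ((1 - a ^+ 2) * (1 + a)) * (1 + a) =
    (1 + a) * (((1 + a) - (al + be) * (1 + a)) ^+ 2 * (1 - a)) by ring.
  rewrite abE ler_pM2l//; apply: le_trans h1.
  by rewrite le_eqVlt; apply/orP; left; apply/eqP; ring.
apply: (box_lower3 iN); first exact: (gauss3_measurable_and3 h G).
move=> t h1 h2 h3 /=; have [eU eV eW] := H t.
have hU : h < U t by rewrite eU.
have hV : h < V t.
  rewrite eV; have : r * (c1 * h) < r * (N t).1.2 by rewrite ltr_pM2l.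
  by rewrite mulrA rc1; nra.
apply/and3P; split => //; rewrite eW.
have k1 : al * h <= al * U t by rewrite ler_wpM2l// ltW.
have k2 : be * h <= be * V t by rewrite ler_wpM2l// ltW.
have k3 : s * (c2 * h) < s * (N t).2 by rewrite ltr_pM2l.
have k4 : (1 - (al + be)) * h <= s * c2 * h by rewrite ler_wpM2r.
lra.
Qed.

(** The corner is again at [U = V = h], now with [W] pushed down to [h]. No sign of [al] or [be] is
    available, so the first two coordinates are kept in unit bands and the deviation of the
    regression is absorbed by a constant shift of the third level. *)
Lemma gauss3_pr2_not_ge (c1 c2 : R) : 0 <= a -> 0 <= c1 -> 0 <= c2 ->
  c1 ^+ 2 * (1 + a) = 1 - a ->
  b + c <= 1 + a \/ (1 + a - b - c) ^+ 2 * (1 - a) <= c2 ^+ 2 * (1 + a) * det3 a b c ->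
  1 + c1 ^+ 2 + c2 ^+ 2 < 2 ->
  \forall h \near +oo, 2 * Q h ^+ 2 <= pr P [set t | [&& h < U t, h < V t & ~~ (h < W t)]].
Proof.
move=> a0 c10 c20 c12 c22 ccc.
have [N0 [r [s [al [be [iN0 [r0 s0 r2 s2] [ale bee] H]]]]]] := gauss3_cholesky a1 G.
(* Reversing the third coordinate turns [W <= h] into a lower bound on it. *)
pose N := sgn3 1 1 (-1) \o N0.
have iN : iid3 P N by apply: iid3_sgn => //; ring.
have NE t : [/\ (N0 t).1.1 = (N t).1.1, (N0 t).1.2 = (N t).1.2 & (N0 t).2 = - (N t).2].
  by rewrite /N /=; split; ring.
have sp : 0 < s.
  by rewrite lt_neqAle eq_sym s0 andbT; apply/eqP => E; move: s2 D0; rewrite E expr0n mul0r => <-; rewrite ltxx.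
have sn : s != 0 by rewrite gt_eqF.
have rc1 : r * c1 = 1 - a.
  apply: eq_of_sqr; rewrite ?mulr_ge0// ?subr_ge0 ?ltW//.
  apply: (mulIf (lt0r_neq0 aG)); rewrite exprMn -mulrA c12 r2; ring.
have r1 : r <= 1 by apply: le_of_sqr => //; rewrite r2 expr1n; nra.
have abE : (al + be) * (1 + a) = b + c.
  have an : 1 - a != 0 by rewrite subr_eq0 gt_eqF.
  apply: (mulIf an); transitivity (al * (1 - a ^+ 2) + be * (1 - a ^+ 2)); first by ring.
  by rewrite ale bee; ring.
have sc2 : (al + be) - 1 <= s * c2.
  case: c22 => [h1|h1].
    by apply: (@le_trans _ _ 0); [nra|rewrite mulr_ge0].
  apply: le_of_sqr; first by rewrite mulr_ge0.
  have B0 : 0 < (1 - a ^+ 2) * (1 + a) by rewrite mulr_gt0.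
  rewrite -(ler_pM2r B0) -(ler_pM2r aG).
  have -> : (s * c2) ^+ 2 * ((1 - a ^+ 2) * (1 + a)) * (1 + a) =
    (1 + a) * (c2 ^+ 2 * (1 + a) * (s ^+ 2 * (1 - a ^+ 2))) by ring.
  rewrite s2.
  have -> : (al + be - 1) ^+ 2 * ((1 - a ^+ 2) * (1 + a)) * (1 + a) =
    (1 + a) * (((1 + a) - (al + be) * (1 + a)) ^+ 2 * (1 - a)) by ring.
  rewrite abE ler_pM2l//; apply: le_trans h1.
  by rewrite le_eqVlt; apply/orP; left; apply/eqP; ring.
(* In the box [U - h] is below 1 and [V - h] below 2, so the regression exceeds [(al + be) h] by at
   most [s * D]. *)
pose D := (`|al| + 2 * `|be|) / s.
have Dge : 0 <= D by rewrite /D divr_ge0// addr_ge0// mulr_ge0.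
near=> h.
have h0 : 0 <= h by near: h; exact: near_pinfty_ge.
apply: (@le_trans _ _ (phi (h + 1) * phi (c1 * h + 1) * Q (c2 * h + D))).
  by near: h; exact: Qtail_sqr_small.
apply: (box_lower_band iN) => //.
- exact: (gauss3_measurable_and_not h G).
- by rewrite mulr_ge0.
move=> t /andP[h1 h1'] /andP[h2 h2'] h3 /=; have [eU eV eW] := H t.
have [n0 n1 n2] := NE t.
have U1 : h < U t by rewrite eU n0.
have U2 : U t < h + 1 by rewrite eU n0.
have VE : V t = h + (a * (U t - h) + r * ((N t).1.2 - c1 * h)).
  rewrite eV eU n0 n1; transitivity (h + (a * (N t).1.1 + r * (N t).1.2 - (a + r * c1) * h)); last by ring.
  by rewrite rc1; ring.
have w1 : 0 < r * ((N t).1.2 - c1 * h) by rewrite mulr_gt0// subr_gt0.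
have w2 : r * ((N t).1.2 - c1 * h) < 1.
  apply: (@le_lt_trans _ _ ((N t).1.2 - c1 * h)); last by lra.
  by rewrite ler_piMl// subr_ge0 ltW.
have w3 : 0 <= a * (U t - h) by rewrite mulr_ge0// subr_ge0 ltW.
have w4 : a * (U t - h) <= 1.
  apply: (@le_trans _ _ (U t - h)); last by lra.
  by rewrite ler_piMl ?subr_ge0 ?ltW.
apply/and3P; split => //; first by rewrite VE; lra.
rewrite -leNgt eW n2.
have k1 : al * (U t - h) <= `|al|.
  apply: (le_trans (ler_norm _)); rewrite normrM ler_piMr// ger0_norm; lra.
have k2 : be * (V t - h) <= 2 * `|be|.
  apply: (le_trans (ler_norm _)); rewrite normrM mulrC ler_wpM2r// ger0_norm; lra.
have k3 : s * (c2 * h + D) < s * (N t).2 by rewrite ltr_pM2l.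
have k5 : s * D = `|al| + 2 * `|be| by rewrite /D mulrC divfK.
have k4 : (al + be - 1) * h <= s * c2 * h by rewrite ler_wpM2r.
lra.
Unshelve. all: by end_near. Qed.

(* The condition [2 <= C^2 + c2^2] includes the critical case, where [P (h < U, h < V)] must be
   bounded by [o (Q (C h))]: on this event [U + V] close to [2 h] forces [U - V] close to 0. *)
Lemma gauss3_pr2_not_le (C c2 e : R) : 0 < C -> 0 < c2 -> C ^+ 2 * (1 + a) = 2 ->
  0 <= b - a * c -> 0 <= c - a * b -> 1 + a < b + c ->
  c2 ^+ 2 * (1 + a) * det3 a b c = (1 + a - b - c) ^+ 2 * (1 - a) ->
  2 <= C ^+ 2 + c2 ^+ 2 -> 0 < e ->
  \forall h \near +oo, pr P [set t | [&& h < U t, h < V t & ~~ (h < W t)]] <= e * Q h ^+ 2.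
Proof.
move=> C0 c20 C2 al0 be0 abc c22 Cc e0.
have [N0 [u [v [s [al [be [iN0 [u0 v0 u2 v2] [s0 s2 ale bee] H]]]]]]] := gauss3_sum_diff a1 G.
pose N := sgn3 1 1 (-1) \o N0.
have iN : iid3 P N by apply: iid3_sgn => //; ring.
have NE t : [/\ (N0 t).1.1 = (N t).1.1, (N0 t).1.2 = (N t).1.2 & (N0 t).2 = - (N t).2].
  by rewrite /N /=; split; ring.
have sp : 0 < s.
  by rewrite lt_neqAle eq_sym s0 andbT; apply/eqP => E; move: s2 D0; rewrite E expr0n mul0r => <-; rewrite ltxx.
have alp : 0 <= al by rewrite -(pmulr_lge0 _ A0) ale.
have bep : 0 <= be by rewrite -(pmulr_lge0 _ A0) bee.
have uC : u * C = 2.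
  apply: eq_of_sqr; rewrite ?mulr_ge0// ?ltW//.
  by rewrite exprMn u2; lra.
have abE : (al + be) * (1 + a) = b + c.
  have an : 1 - a != 0 by rewrite subr_eq0 gt_eqF.
  apply: (mulIf an); transitivity (al * (1 - a ^+ 2) + be * (1 - a ^+ 2)); first by ring.
  by rewrite ale bee; ring.
have ab1 : 1 < al + be by rewrite -(ltr_pM2r aG) abE mul1r.
have sc2 : al + be - 1 = s * c2.
  apply: eq_of_sqr; rewrite ?subr_ge0 ?ltW// ?mulr_gt0//.
  have B0 : (1 - a ^+ 2) * (1 + a) * (1 + a) != 0 by rewrite gt_eqF// !mulr_gt0.
  apply: (mulIf B0).
  transitivity ((1 + a) * (((1 + a) - (al + be) * (1 + a)) ^+ 2 * (1 - a))); first by ring.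
  transitivity ((1 + a) * (c2 ^+ 2 * (1 + a) * (s ^+ 2 * (1 - a ^+ 2)))); last by ring.
  by rewrite s2 abE c22; congr (_ * _); ring.
have [K K0 crit] := Qtail_critical C0 c20 Cc.
(* [u * D = e1 * v]: if [U + V <= 2 h + u D] while both exceed [h], then [|U - V| < e1 v], which is
   a band of half-width [e1]. Its mass bound [2 * e1], times [K], is [e / 2]; the other half of [e]
   pays for the larger sum. *)
pose e1 := e / (4 * K). pose D := e1 * v / u.
have e10 : 0 < e1 by rewrite divr_gt0// mulr_gt0.
have D1 : 0 < D by rewrite /D divr_gt0// mulr_gt0.
have CD : 0 < C * D by rewrite mulr_gt0.
near=> h.
have h1 : 1 <= h by near: h; exact: near_pinfty_ge.
apply: (@le_trans _ _ ((Q (C * h + D) + Q (C * h) * (2 * e1)) * Q (c2 * h))).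
  apply: (box_upper_union iN); [exact: (gauss3_measurable_and_not h G)|exact: ltW|].
  move=> t Et; have /and3P[hU hV] : [&& h < U t, h < V t & ~~ (h < W t)] := Et.
  rewrite -leNgt => hW; have [eS eD eW] := H t.
  have [n0 n1 n2] := NE t; rewrite n0 in eS; rewrite n1 in eD; rewrite n2 in eW.
  have S1 : C * h < (N t).1.1 by rewrite -(ltr_pM2l u0) -eS mulrA uC; lra.
  split.
    rewrite -(ltr_pM2l sp) mulrA -sc2.
    have k1 : al * h <= al * U t by rewrite ler_wpM2l// ltW.
    have k2 : be * h <= be * V t by rewrite ler_wpM2l// ltW.
    (* As [al + be > 1], one of the coefficients is positive, which makes the bound on the third
       coordinate strict. *)
    have [al1|al1] := ltP 0 al.
      have : al * h < al * U t by rewrite ltr_pM2l.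
      lra.
    have be1 : 0 < be by lra.
    have : be * h < be * V t by rewrite ltr_pM2l.
    lra.
  have [big|small] := ltP (C * h + D) (N t).1.1; [by left|right; split => //].
  have k : u * (N t).1.1 <= 2 * h + e1 * v.
    apply: (le_trans (_ : _ <= u * (C * h + D))); first by rewrite ler_pM2l.
    rewrite mulrDr mulrA uC lerD2l /D mulrC divfK ?gt_eqF//.
  have q1 : v * (N t).1.2 < v * e1 by lra.
  have q2 : v * (- e1) < v * (N t).1.2 by lra.
  by rewrite !ltr_pM2l// in q1 q2; rewrite q1 q2.
have b1 : Q (C * h + D) * Q (c2 * h) <= K * expR (- (C * D * h)) * Q h ^+ 2.
  by near: h; apply: crit; exact: ltW.
have b2 : Q (C * h) * Q (c2 * h) <= K * Q h ^+ 2.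
  have : Q (C * h + 0) * Q (c2 * h) <= K * expR (- (C * 0 * h)) * Q h ^+ 2.
    by near: h; exact: crit.
  by rewrite addr0 mulr0 mul0r oppr0 expR0 mulr1.
have b3 : K * expR (- (C * D * h)) <= e / 2.
  rewrite mulrC -ler_pdivlMr// -[leRHS](lnK (_ : e / 2 / K \is Num.pos)) ?posrE ?divr_gt0//.
  rewrite ler_expR lerNl -ler_pdivrMl; last by [].
  by near: h; exact: near_pinfty_ge.
have b4 : 2 * e1 * K = e / 2 by rewrite /e1; field; rewrite gt_eqF.
have Q2 := sqr_ge0 (Q h).
rewrite mulrDl; apply: (@le_trans _ _ (e / 2 * Q h ^+ 2 + e / 2 * Q h ^+ 2)); last by lra.
apply: lerD.
  by apply: (le_trans b1); rewrite ler_wpM2r.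
rewrite mulrAC mulrC -b4 -[leRHS]mulrA ler_wpM2l// mulr_ge0// ltW//.
Unshelve. all: by end_near. Qed.
End gauss3_bounds.

(** * Exponents as functions of the covariances *)

Section quadratic_form.
Context (R : realType).
Implicit Types a b c x : R.

(* [1^T A^{-1} 1 = cofactor_sum a b c / det3 a b c] *)
Definition cofactor_sum a b c : R :=
  (1 - a) * (1 + a - b - c) + (1 - b) * (1 + b - a - c) + (1 - c) * (1 + c - a - b).

(** Divided by [(1 + a) * det3 a b c], this splits [1^T A^{-1} 1] into [2 / (1 + a)], the squared
    level of the pair, and the squared level of the third coordinate. *)
Lemma cofactor_sumE a b c :
  (1 + a) * cofactor_sum a b c = 2 * det3 a b c + (1 + a - b - c) ^+ 2 * (1 - a).
Proof. by rewrite /cofactor_sum /det3; ring. Qed.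

Lemma cofactor_sum_swap23 a b c : cofactor_sum b a c = cofactor_sum a b c.
Proof. by rewrite /cofactor_sum; ring. Qed.

Lemma det3_swap12 a b c : det3 a c b = det3 a b c.
Proof. by rewrite /det3; ring. Qed.

Lemma det3_swap23 a b c : det3 b a c = det3 a b c.
Proof. by rewrite /det3; ring. Qed.

(* With [l = A^{-1} 1 > 0], the row of [A l = 1] at the vertex opposite to the pair of covariance [x]
   bounds that entry of [l] by 1. *)
Lemma cofactor_sum_lt a b c x : 0 <= a -> a <= b -> a <= c -> 0 < b -> b < 1 -> 0 < c -> c < 1 ->
  0 < det3 a b c -> b + c < 1 + a -> x \in [:: a; b; c] ->
  (cofactor_sum a b c - det3 a b c) * (1 + x) < 2 * det3 a b c.
Proof.
move=> a0 ab ac b0 b1 c0 c1 D0 bc.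
(* By [cofactor_sumE] the claim is [(1 + p - q - r)^2 (1 - p) < (1 + p) det3]. It follows from the
   entry bound and [1 + p - q - r <= 1 + p]. *)
have key p q r : 0 <= p -> 0 <= q -> 0 <= r -> p < 1 -> 0 < 1 + p - q - r ->
    det3 p q r = det3 a b c -> cofactor_sum p q r = cofactor_sum a b c ->
    (1 - p) * (1 + p - q - r) < det3 p q r ->
    (cofactor_sum a b c - det3 a b c) * (1 + p) < 2 * det3 a b c.
  move=> p0 q0 r0 p1 pqr eD <- L.
  have := cofactor_sumE p q r; rewrite eD in L *.
  have : (1 + p - q - r) * ((1 - p) * (1 + p - q - r)) < (1 + p - q - r) * det3 a b c.
    by rewrite ltr_pM2l.
  have : (1 + p - q - r) * det3 a b c <= (1 + p) * det3 a b c.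
    by rewrite ler_pM2r//; lra.
  lra.
have Li : 0 < (1 - c) * (1 + c - a - b) by rewrite mulr_gt0//; lra.
have Lj : 0 < (1 - b) * (1 + b - a - c) by rewrite mulr_gt0//; lra.
have Lk : 0 < (1 - a) * (1 + a - b - c) by rewrite mulr_gt0//; lra.
rewrite !inE => /or3P[]/eqP ->.
- apply: (key a b c _ _ _ _ _ erefl erefl); try lra.
  have -> : det3 a b c = (1 - a) * (1 + a - b - c) + (b * ((1 - c) * (1 + c - a - b)) +
    c * ((1 - b) * (1 + b - a - c))) by rewrite /det3; ring.
  by rewrite ltrDl addr_gt0// mulr_gt0.
- apply: (key b a c _ _ _ _ _ (det3_swap23 a b c) (cofactor_sum_swap23 a b c)); try lra.
  rewrite det3_swap23; have -> : det3 a b c = (1 - b) * (1 + b - a - c) + (a * ((1 - c) * (1 + c - a - b)) +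
    c * ((1 - a) * (1 + a - b - c))) by rewrite /det3; ring.
  rewrite ltrDl; apply: ltr_wpDl; last exact: mulr_gt0.
  by apply: mulr_ge0 => //; exact: ltW.
- have eD : det3 c a b = det3 a b c by rewrite /det3; ring.
  have eS : cofactor_sum c a b = cofactor_sum a b c by rewrite /cofactor_sum; ring.
  apply: (key c a b _ _ _ _ _ eD eS); try lra.
  have -> : det3 c a b = (1 - c) * (1 + c - a - b) + (a * ((1 - b) * (1 + b - a - c)) +
    b * ((1 - a) * (1 + a - b - c))) by rewrite /det3; ring.
  rewrite ltrDl; apply: ltr_wpDl; last exact: mulr_gt0.
  by apply: mulr_ge0 => //; exact: ltW.
Qed.

(** The equations are combined with the rows of the adjugate; each row sum factors as displayed. *)
Lemma cramer3 a b c (x y z : R) : x + y * a + z * b = 1 -> x * a + y + z * c = 1 ->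
  x * b + y * c + z = 1 -> [/\ det3 a b c * x = (1 - c) * (1 + c - a - b),
    det3 a b c * y = (1 - b) * (1 + b - a - c) & det3 a b c * z = (1 - a) * (1 + a - b - c)].
Proof.
move=> ex ey ez; split.
- transitivity ((1 - c ^+ 2) * (x + y * a + z * b) + (b * c - a) * (x * a + y + z * c) +
    (a * c - b) * (x * b + y * c + z)); first by rewrite /det3; ring.
  by rewrite ex ey ez; ring.
- transitivity ((b * c - a) * (x + y * a + z * b) + (1 - b ^+ 2) * (x * a + y + z * c) +
    (a * b - c) * (x * b + y * c + z)); first by rewrite /det3; ring.
  by rewrite ex ey ez; ring.
- transitivity ((a * c - b) * (x + y * a + z * b) + (a * b - c) * (x * a + y + z * c) +
    (1 - a ^+ 2) * (x * b + y * c + z)); first by rewrite /det3; ring.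
  by rewrite ex ey ez; ring.
Qed.

(** The second factor is [(q - p) + (1 - r)]. With [p] the smallest covariance this covers the
    entries at [i] and [j]. *)
Lemma cofactor_row_gt0 (p q r : R) : p <= q -> r < 1 -> q < 1 -> 0 < (1 - q) * (1 + q - p - r).
Proof. by move=> *; rewrite mulr_gt0//; lra. Qed.

Lemma sqrt_solution (x y : R) : 0 <= x -> 0 < y -> exists2 z : R, 0 <= z & z ^+ 2 * y = x.
Proof.
move=> x0 y0; exists (Num.sqrt (x / y)); first exact: sqrtr_ge0.
by rewrite sqr_sqrtr ?divfK ?gt_eqF// divr_ge0// ltW.
Qed.
End quadratic_form.

(** * Pair and triple probabilities for large [h] *)

Section color_asymptotics.
Context (R : realType) d (T : measurableType d) (P : probability T R).
Local Notation Q := (@Qtail R).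
Context (a b c : R) (U V W : T -> R).
Hypothesis G : gauss3 P a b c U V W.
Hypotheses (a0 : 0 <= a) (ab : a <= b) (ac : a <= c) (b0 : 0 < b) (b1 : b < 1)
  (c0 : 0 < c) (c1 : c < 1) (D0 : 0 < det3 a b c).
Implicit Types h : R.

Local Notation puv h := (pr P [set t | (h < U t) && (h < V t)]).
Local Notation puw h := (pr P [set t | (h < U t) && (h < W t)]).
Local Notation pvw h := (pr P [set t | (h < V t) && (h < W t)]).
Local Notation puvw h := (pr P [set t | [&& h < U t, h < V t & h < W t]]).

Let a1 : a < 1. Proof. exact: le_lt_trans ab b1. Qed.
Let sq (x : R) : 0 <= x -> x < 1 -> x ^+ 2 < 1. Proof. by move=> x0 x1; rewrite expr_lt1. Qed.
Let Gb : gauss3 P b a c U W V. Proof. exact: gauss3_swap23. Qed.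
Let Gc : gauss3 P c a b V W U.
Proof. exact/gauss3_swap23/gauss3_swap12. Qed.

Lemma gauss3_marginals h : [/\ pr P [set t | h < U t] = Q h, pr P [set t | h < V t] = Q h
  & pr P [set t | h < W t] = Q h].
Proof.
split.
- by apply: (gauss3_pr1 _ G); apply: sq.
- by apply: (gauss3_pr1 _ Gc); apply: sq => //; exact: ltW.
- by apply: (gauss3_pr1 _ (gauss3_swap12 Gb)); apply: sq => //; exact: ltW.
Qed.

Lemma pr_pair_le (x y z : R) (F1 F2 F3 : T -> R) : 0 <= x -> x < 1 -> gauss3 P x y z F1 F2 F3 ->
  exists C : R, [/\ 1 < C, C ^+ 2 * (1 + x) = 2 &
    forall h, pr P [set t | (h < F1 t) && (h < F2 t)] <= Q (C * h)].
Proof.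
move=> x0 x1 Gx.
have [C C0 C2] := @sqrt_solution R 2 (1 + x) ltac:(lra) ltac:(lra).
have C1 : 1 < C.
  rewrite ltNge; apply/negP => h.
  have : C ^+ 2 * (1 + x) <= 1 * (1 + x).
    by rewrite ler_pM2r; [exact: exprn_ile1|lra].
  lra.
exists C; split => // h; apply: (gauss3_pr2_le (sq x0 x1) Gx) => //; lra.
Qed.

Lemma pr_pairs_small (e : R) : 0 < e -> \forall h \near +oo,
  [/\ puv h <= e * Q h, puw h <= e * Q h & pvw h <= e * Q h].
Proof.
move=> e0.
have [Ca [Ca1 _ Ha]] := pr_pair_le a0 a1 G.
have [Cb [Cb1 _ Hb]] := pr_pair_le (ltW b0) b1 Gb.
have [Cc [Cc1 _ Hc]] := pr_pair_le (ltW c0) c1 Gc.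
near=> h; split.
- apply: (le_trans (Ha h)); apply: ltW; near: h; exact: Qtail_ratio_small.
- apply: (le_trans (Hb h)); apply: ltW; near: h; exact: Qtail_ratio_small.
- apply: (le_trans (Hc h)); apply: ltW; near: h; exact: Qtail_ratio_small.
Unshelve. all: by end_near. Qed.

(** Minimality of [a] gives [a c <= a <= b] and [a b <= a <= c]. *)
Lemma regression_coef_ge0 : 0 <= b - a * c /\ 0 <= c - a * b.
Proof.
move: a0 ab ac b0 b1 c0 c1 a1 => *; split; nra.
Qed.

(** Once the common factor [Q h] is removed, a product of tails at [k1 h] and [k2 h] faces tails at
    [C h] with [C^2 = 2 / (1 + x)]. If [1 + a <= b + c], then [k2 = 0] works because [k1^2 <= 1];
    otherwise [cofactor_sum_lt] compares the exponents. *)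
Lemma pr_triple_dominates : \forall h \near +oo, Q h * (puv h + puw h + pvw h) < puvw h.
Proof.
have [alp bep] := regression_coef_ge0.
have [k1 k10 k12] := @sqrt_solution R (1 - a) (1 + a) ltac:(move: a1; lra) ltac:(move: a0; lra).
have [k2 [k20 k2c k2s]] : exists k2 : R, [/\ 0 <= k2,
    1 + a <= b + c \/ (1 + a - b - c) ^+ 2 * (1 - a) <= k2 ^+ 2 * (1 + a) * det3 a b c
    & forall x, x \in [:: a; b; c] -> (k1 ^+ 2 + k2 ^+ 2) * (1 + x) < 2].
  have [h1|h1] := leP (1 + a) (b + c).
    exists 0; split => //; first by left.
    move=> x xs; have [x0 x1] : 0 <= x /\ x < 1.
      by move: xs; rewrite !inE => /or3P[]/eqP ->; split => //; exact: ltW.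
    rewrite expr0n addr0.
    have : k1 ^+ 2 <= 1.
      have : k1 ^+ 2 * (1 + a) <= 1 * (1 + a) by rewrite k12; move: a0; lra.
      by rewrite ler_pM2r//; move: a0; lra.
    move=> k; apply: (@le_lt_trans _ _ (1 * (1 + x))); last by lra.
    by rewrite ler_wpM2r//; lra.
  have yp : 0 < (1 + a) * det3 a b c by rewrite mulr_gt0//; move: a0; lra.
  have xp : 0 <= (1 + a - b - c) ^+ 2 * (1 - a).
    by rewrite mulr_ge0 ?sqr_ge0// subr_ge0 ltW// a1.
  have [k2 k20 k22] := sqrt_solution xp yp.
  exists k2; split => //; first by right; rewrite -mulrA k22.
  move=> x xs.
  have := cofactor_sum_lt a0 ab ac b0 b1 c0 c1 D0 h1 xs.
  have a1p : 0 < 1 + a by move: a0; lra.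
  (* In terms of the matrix, [k1^2 + k2^2 = 1^T A^{-1} 1 - 1]. *)
  have E : (k1 ^+ 2 + k2 ^+ 2) * det3 a b c = cofactor_sum a b c - det3 a b c.
    apply: (mulIf (lt0r_neq0 a1p)).
    transitivity (k1 ^+ 2 * (1 + a) * det3 a b c + k2 ^+ 2 * ((1 + a) * det3 a b c)); first by ring.
    rewrite k12 k22; transitivity ((1 + a) * cofactor_sum a b c - (1 + a) * det3 a b c); last by ring.
    by rewrite cofactor_sumE; ring.
  rewrite -E => h2; rewrite -(ltr_pM2r D0); apply: le_lt_trans h2.
  by rewrite le_eqVlt mulrAC eqxx.
have [Ca [Ca1 Ca2 Ha]] := pr_pair_le a0 a1 G.
have [Cb [Cb1 Cb2 Hb]] := pr_pair_le (ltW b0) b1 Gb.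
have [Cc [Cc1 Cc2 Hc]] := pr_pair_le (ltW c0) c1 Gc.
have Cgt C x : 0 <= x -> x \in [:: a; b; c] -> C ^+ 2 * (1 + x) = 2 -> k1 ^+ 2 + k2 ^+ 2 < C ^+ 2.
  move=> x0 xs C2; have x1 : 0 < 1 + x by lra.
  by rewrite -(ltr_pM2r x1) C2; exact: k2s.
near=> h.
have h0 : 0 <= h by near: h; exact: near_pinfty_ge.
have lower := gauss3_pr3_ge (sq a0 a1) G D0 h0 a0 k10 k20 k12 alp bep k2c.
(* The factor 3 lets the three pairs be summed. *)
have ua : 3 * Q (Ca * h) < Q (k1 * h) * Q (k2 * h).
  near: h; apply: Qtail_product_dominates => //; first exact: lt_trans Ca1.
  by apply: Cgt Ca2; rewrite ?inE ?eqxx.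
have ub : 3 * Q (Cb * h) < Q (k1 * h) * Q (k2 * h).
  near: h; apply: Qtail_product_dominates => //; first exact: lt_trans Cb1.
  by apply: Cgt Cb2; rewrite ?inE ?eqxx ?orbT// ltW.
have uc : 3 * Q (Cc * h) < Q (k1 * h) * Q (k2 * h).
  near: h; apply: Qtail_product_dominates => //; first exact: lt_trans Cc1.
  by apply: Cgt Cc2; rewrite ?inE ?eqxx ?orbT// ltW.
apply: lt_le_trans lower; rewrite -mulrA ltr_pM2l ?Qtail_gt0//.
have := Ha h; have := Hb h; have := Hc h; lra.
Unshelve. all: by end_near. Qed.

(** Minimality of [a] gives [a + c <= 1 + b] and [a + b <= 1 + c], so for the pairs of covariance
    [b] and [c] the third level can be 0. Only the pair of covariance [a] depends on the alternative
    in the hypothesis. *)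
Lemma pr_pair_not_ge : 0 < a -> b + c <= 1 + a \/ cofactor_sum a b c < 2 * det3 a b c ->
  \forall h \near +oo,
  [/\ 2 * Q h ^+ 2 <= puv h - puvw h, 2 * Q h ^+ 2 <= puw h - puvw h
    & 2 * Q h ^+ 2 <= pvw h - puvw h].
Proof.
move=> ap cond.
have sub x y z (F1 F2 F3 : T -> R) h : gauss3 P x y z F1 F2 F3 ->
    pr P [set t | (h < F1 t) && (h < F2 t)] - pr P [set t | [&& h < F1 t, h < F2 t & h < F3 t]] =
    pr P [set t | [&& h < F1 t, h < F2 t & ~~ (h < F3 t)]].
  by move=> Gx; rewrite (gauss3_pr_split h Gx) addrC addKr.
have simple x y z (F1 F2 F3 : T -> R) : 0 < x -> x < 1 -> 0 < det3 x y z -> y + z <= 1 + x ->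
    gauss3 P x y z F1 F2 F3 -> \forall h \near +oo,
    2 * Q h ^+ 2 <= pr P [set t | [&& h < F1 t, h < F2 t & ~~ (h < F3 t)]].
  move=> x0 x1 Dx yz Gx.
  have [k1 k10 k12] := @sqrt_solution R (1 - x) (1 + x) ltac:(lra) ltac:(lra).
  apply: (gauss3_pr2_not_ge (sq (ltW x0) x1) Gx Dx (ltW x0) k10 (lexx 0) k12); first by left.
  rewrite expr0n addr0; have : k1 ^+ 2 < 1; last by lra.
  have x1p : 0 < 1 + x by lra.
  by rewrite -(ltr_pM2r x1p) k12; lra.
have Huv : \forall h \near +oo,
    2 * Q h ^+ 2 <= pr P [set t | [&& h < U t, h < V t & ~~ (h < W t)]].
  have [bc|bc] := leP (b + c) (1 + a); first exact: (simple _ _ _ _ _ _ ap a1 D0 bc G).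
  case: cond => [bc'|cond]; first by move: (le_lt_trans bc' bc); rewrite ltxx.
  have a1p : 0 < 1 + a by lra.
  have [k1 k10 k12] := @sqrt_solution R (1 - a) (1 + a) ltac:(move: a1; lra) a1p.
  have yp : 0 < (1 + a) * det3 a b c by rewrite mulr_gt0.
  have xp : 0 <= (1 + a - b - c) ^+ 2 * (1 - a).
    by rewrite mulr_ge0 ?sqr_ge0// subr_ge0 ltW// a1.
  have [k2 k20 k22] := sqrt_solution xp yp.
  apply: (gauss3_pr2_not_ge (sq a0 a1) G D0 a0 k10 k20 k12); first by right; rewrite -mulrA k22.
  rewrite -(ltr_pM2r yp).
  (* The squared levels of the box sum to [1^T A^{-1} 1], so the requirement is that this be less
     than 2. *)
  have -> : (1 + k1 ^+ 2 + k2 ^+ 2) * ((1 + a) * det3 a b c) = (1 + a) * cofactor_sum a b c.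
    rewrite cofactor_sumE -k22.
    transitivity ((1 + a + k1 ^+ 2 * (1 + a)) * det3 a b c + k2 ^+ 2 * ((1 + a) * det3 a b c)); first by ring.
    by rewrite k12; ring.
  by rewrite mulrCA ltr_pM2l.
have Huw := simple _ _ _ _ _ _ b0 b1 _ _ Gb.
have Hvw := simple _ _ _ _ _ _ c0 c1 _ _ Gc.
have [Db Dc] : 0 < det3 b a c /\ 0 < det3 c a b.
  by rewrite det3_swap23; split => //; rewrite -det3_swap23 det3_swap12.
have {}Huw := Huw Db _; have {}Hvw := Hvw Dc _.
near=> h.
have e1 : [set t | [&& h < U t, h < W t & h < V t]] = [set t | [&& h < U t, h < V t & h < W t]].
  by apply/seteqP; split => t /= /and3P[-> -> ->].
have e2 : [set t | [&& h < V t, h < W t & h < U t]] = [set t | [&& h < U t, h < V t & h < W t]].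
  by apply/seteqP; split => t /= /and3P[-> -> ->].
split.
- by rewrite (sub _ _ _ _ _ _ h G); near: h.
- rewrite -e1 (sub _ _ _ _ _ _ h Gb); near: h; apply: Huw.
  by move: a0 ab ac b0 b1 c0 c1; lra.
- rewrite -e2 (sub _ _ _ _ _ _ h Gc); near: h; apply: Hvw.
  by move: a0 ab ac b0 b1 c0 c1; lra.
Unshelve. all: by end_near. Qed.

(** The levels [C] and [k2] satisfy [C^2 + k2^2 = 1^T A^{-1} 1], and [k2] is positive because
    [1 + a] differs from [b + c]. *)
Lemma pr_pair_not_small : 1 + a < b + c -> 2 * det3 a b c <= cofactor_sum a b c ->
  \forall h \near +oo, puv h - puvw h <= 1 / 4 * Q h ^+ 2.
Proof.
move=> bc cond; have [alp bep] := regression_coef_ge0.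
have a1p : 0 < 1 + a by move: a0; lra.
have [C C0 C2] := @sqrt_solution R 2 (1 + a) ltac:(lra) a1p.
have Cp : 0 < C.
  rewrite lt_neqAle C0 andbT eq_sym; apply/eqP => E; move: C2; rewrite E expr0n mul0r; lra.
have yp : 0 < (1 + a) * det3 a b c by rewrite mulr_gt0.
have xp : 0 < (1 + a - b - c) ^+ 2 * (1 - a).
  rewrite mulr_gt0 ?subr_gt0 ?a1// exprn_even_gt0//=.
  by apply/eqP => E; move: bc; lra.
have [k2 k20 k22] := sqrt_solution (ltW xp) yp.
have k2p : 0 < k2.
  rewrite lt_neqAle k20 andbT eq_sym; apply/eqP => E; move: xp; rewrite -k22 E expr0n mul0r; lra.
have Cc : 2 <= C ^+ 2 + k2 ^+ 2.
  rewrite -(ler_pM2r yp).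
  have -> : (C ^+ 2 + k2 ^+ 2) * ((1 + a) * det3 a b c) = (1 + a) * cofactor_sum a b c.
    rewrite cofactor_sumE -k22.
    transitivity (C ^+ 2 * (1 + a) * det3 a b c + k2 ^+ 2 * ((1 + a) * det3 a b c)); first by ring.
    by rewrite C2.
  by rewrite mulrCA ler_pM2l.
have k22' : k2 ^+ 2 * (1 + a) * det3 a b c = (1 + a - b - c) ^+ 2 * (1 - a) by rewrite -mulrA.
near=> h.
rewrite (gauss3_pr_split h G) addrC addKr.
near: h.
by apply: (gauss3_pr2_not_le (sq a0 a1) G D0 Cp k2p C2 alp bep bc k22' Cc).
Unshelve. all: by end_near. Qed.
End color_asymptotics.

(** * Existence and nonexistence of color representations for large [h] *)

Section eventual_color.
Context (R : realType) d (T : measurableType d) (P : probability T R).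
Local Notation Q := (@Qtail R).
Context (S : finType) (i j k : S).
Hypotheses (ij : i != j) (ik : i != k) (jk : j != k).
Hypothesis ijk : forall x, [|| x == i, x == j | x == k].
Context (a b c : R) (X : S -> T -> R).
Hypothesis G : gauss3 P a b c (X i) (X j) (X k).
Hypotheses (a0 : 0 <= a) (ab : a <= b) (ac : a <= c) (b0 : 0 < b) (b1 : b < 1)
  (c0 : 0 < c) (c1 : c < 1) (D0 : 0 < det3 a b c).

Let Y (h : R) : S -> T -> bool := fun x t => h < X x t.

Let mY h x : measurable [set t | Y h x t].
Proof.
have [mi mj mk] := gauss3_measurable G.
by case/or3P: (ijk x) => /eqP ->; exact: measurable_ltr.
Qed.

Let pr1 h : [/\ pr P [set t | Y h i t] = Q h, pr P [set t | Y h j t] = Q h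
  & pr P [set t | Y h k t] = Q h].
Proof. exact: (gauss3_marginals G a0 ab b0 b1 c0 c1). Qed.

(** With [p = Q h], the difference [(pij - p^2) (1 - 2 p) - kappa] is exactly [(pij - pijk) - p^2 -
    p pij + p pik + p pjk]. The margin [2 p^2] on [pij - pijk] covers [p^2] and [p pij <= p^2 / 4];
    the other pairs are symmetric. *)
Lemma eventually_color_representation :
  0 < a -> b + c <= 1 + a \/ cofactor_sum a b c < 2 * det3 a b c ->
  \forall h \near +oo, has_color_representation P (fun x t => h < X x t).
Proof.
move=> ap cond; near=> h.
have h0 : 0 <= h by near: h; exact: near_pinfty_ge.
have [e1 e2 e3] := pr1 h.
have Qp : 0 < Q h by exact: Qtail_gt0.
have Qs : Q h < 1 / 4 by near: h; apply: Qtail_small; lra.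
have [s1 s2 s3] : [/\ pr P [set t | Y h i t && Y h j t] <= 1 / 4 * Q h,
    pr P [set t | Y h i t && Y h k t] <= 1 / 4 * Q h
  & pr P [set t | Y h j t && Y h k t] <= 1 / 4 * Q h].
  by near: h; apply: (pr_pairs_small G a0 ab b0 b1 c0 c1); lra.
have [n1 n2 n3] : [/\ 2 * Q h ^+ 2 <= pr P [set t | Y h i t && Y h j t] -
      pr P [set t | [&& Y h i t, Y h j t & Y h k t]],
    2 * Q h ^+ 2 <= pr P [set t | Y h i t && Y h k t] -
      pr P [set t | [&& Y h i t, Y h j t & Y h k t]]
  & 2 * Q h ^+ 2 <= pr P [set t | Y h j t && Y h k t] -
      pr P [set t | [&& Y h i t, Y h j t & Y h k t]]].
  by near: h; exact: (pr_pair_not_ge G a0 ab ac b0 b1 c0 c1 D0 ap cond).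
have dom : Q h * (pr P [set t | Y h i t && Y h j t] + pr P [set t | Y h i t && Y h k t] +
    pr P [set t | Y h j t && Y h k t]) < pr P [set t | [&& Y h i t, Y h j t & Y h k t]].
  by near: h; exact: (pr_triple_dominates G a0 ab ac b0 b1 c0 c1 D0).
have pr0 (E : set T) : 0 <= pr P E by exact: fine_ge0.
have Q3 : 0 <= Q h ^+ 3 by rewrite exprn_ge0// ltW.
have bnd (x : R) : x <= 1 / 4 * Q h -> Q h * x <= 1 / 4 * Q h ^+ 2.
  by move=> xQ; rewrite expr2 mulrCA ler_pM2l.
have Q0 E : 0 <= Q h * pr P E by rewrite mulr_ge0// ltW.
have p0 : 0 < Q h ^+ 2 by rewrite exprn_gt0.
apply: (color_representation3_sufficient ij ik jk ijk (mY h)).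
- by rewrite e2 e1.
- by rewrite e3 e1.
- by rewrite e1.
- by rewrite e1; lra.
- by rewrite /kappa e1; lra.
- by rewrite /kappa e1; have := bnd _ s1; have := Q0 [set t | Y h i t && Y h k t];
    have := Q0 [set t | Y h j t && Y h k t]; lra.
- by rewrite /kappa e1; have := bnd _ s2; have := Q0 [set t | Y h i t && Y h j t];
    have := Q0 [set t | Y h j t && Y h k t]; lra.
- by rewrite /kappa e1; have := bnd _ s3; have := Q0 [set t | Y h i t && Y h j t];
    have := Q0 [set t | Y h i t && Y h k t]; lra.
- rewrite e1; have : Q h * Q h <= Q h * (1 / 4) by rewrite ler_pM2l// ltW.
  lra.
Unshelve. all: by end_near. Qed.

(** The difference [(pij - p^2) (1 - 2 p) - kappa] is a nonnegative multiple of the weight of {i,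
    j}, {k}. It is at most [- p^2] plus three terms bounded by [p^2 / 4], namely [pij - pijk],
    [p pik] and [p pjk], hence negative. *)
Lemma eventually_no_color_representation_neg :
  1 + a < b + c -> 2 * det3 a b c <= cofactor_sum a b c ->
  \forall h \near +oo, ~ has_color_representation P (fun x t => h < X x t).
Proof.
move=> bc cond; near=> h => rep.
have h0 : 0 <= h by near: h; exact: near_pinfty_ge.
have [e1 e2 e3] := pr1 h.
have Qp : 0 < Q h by exact: Qtail_gt0.
have Qs : Q h < 1 / 4 by near: h; apply: Qtail_small; lra.
have [s1 s2 s3] : [/\ pr P [set t | Y h i t && Y h j t] <= 1 / 4 * Q h,
    pr P [set t | Y h i t && Y h k t] <= 1 / 4 * Q h
  & pr P [set t | Y h j t && Y h k t] <= 1 / 4 * Q h].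
  by near: h; apply: (pr_pairs_small G a0 ab b0 b1 c0 c1); lra.
have small : pr P [set t | Y h i t && Y h j t] -
      pr P [set t | [&& Y h i t, Y h j t & Y h k t]] <= 1 / 4 * Q h ^+ 2.
  by near: h; exact: (pr_pair_not_small G a0 ab ac b0 b1 c0 c1 D0 bc cond).
have pr0 (E : set T) : 0 <= pr P E by exact: fine_ge0.
have Q0 E : 0 <= Q h * pr P E by rewrite mulr_ge0// ltW.
have p0 : 0 < Q h ^+ 2 by rewrite exprn_gt0.
have bnd (x : R) : x <= 1 / 4 * Q h -> Q h * x <= 1 / 4 * Q h ^+ 2.
  by move=> xQ; rewrite expr2 mulrCA ler_pM2l.
have [q1 [q2 [q10 q20]]] := color_representation3_necessary ij ik jk ijk (mY h) rep.
rewrite /kappa e1 => eK eP.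
have q2' : 0 <= Q h * (1 - Q h) * (1 - 2 * Q h) * q2.
  by rewrite !mulr_ge0//; lra.
have E : (pr P [set t | Y h i t && Y h j t] - Q h ^+ 2) * (1 - 2 * Q h) =
    Q h * (1 - Q h) * (1 - 2 * Q h) * q1 + Q h * (1 - Q h) * (1 - 2 * Q h) * q2.
  by rewrite eP; ring.
rewrite -eK in E.
have := bnd _ s2; have := bnd _ s3; have := Q0 [set t | Y h i t && Y h j t].
lra.
Unshelve. all: by end_near. Qed.

Lemma eventually_no_color_representation_zero : a = 0 ->
  \forall h \near +oo, ~ has_color_representation P (fun x t => h < X x t).
Proof.
move=> az; near=> h => rep.
have h0 : 0 <= h by near: h; exact: near_pinfty_ge.
have [e1 e2 e3] := pr1 h.
have Qp : 0 < Q h by exact: Qtail_gt0.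
have Qs : Q h < 1 / 4 by near: h; apply: Qtail_small; lra.
have dom : Q h * (pr P [set t | Y h i t && Y h j t] + pr P [set t | Y h i t && Y h k t] +
    pr P [set t | Y h j t && Y h k t]) < pr P [set t | [&& Y h i t, Y h j t & Y h k t]].
  by near: h; exact: (pr_triple_dominates G a0 ab ac b0 b1 c0 c1 D0).
have a1 : a ^+ 2 < 1 by rewrite az expr0n.
have e12 : pr P [set t | Y h i t && Y h j t] = Q h ^+ 2 by exact: (gauss3_pr2_indep a1 G).
have [q1 [q2 [q10 q20]]] := color_representation3_necessary ij ik jk ijk (mY h) rep.
rewrite /kappa e1 => eK; rewrite e12 subrr => eP.
have Q1 : 0 < Q h * (1 - Q h) by rewrite mulr_gt0//; lra.
have q12 : q1 + q2 = 0.
  by move/esym/eqP: eP; rewrite mulf_eq0 gt_eqF//= => /eqP.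
have q1z : q1 = 0 by lra.
have Q3 : 0 < Q h ^+ 3 by rewrite exprn_gt0.
by move: eK; rewrite q1z mulr0; lra.
Unshelve. all: by end_near. Qed.
End eventual_color.

(** * Reduction to the smallest covariance, and the theorem *)

Section order3.
Context (R : realType).

Lemma ord3_cover (i j k : 'I_3) : i != j -> i != k -> j != k ->
  forall x, [|| x == i, x == j | x == k].
Proof.
have H : [forall i : 'I_3, forall j : 'I_3, forall k : 'I_3, forall x : 'I_3,
    [==> i != j, i != k, j != k => [|| x == i, x == j | x == k]]].
  by do 4![apply/forallP => -[[|[|[|]]]//= ?]].
by move=> ij ik jk x; move/forallP: H => /(_ i)/forallP/(_ j)/forallP/(_ k)/forallP/(_ x);
  rewrite ij ik jk.
Qed.

Lemma sum_ord3 (i j k : 'I_3) (F : 'I_3 -> R) : i != j -> i != k -> j != k ->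
  \sum_x F x = F i + F j + F k.
Proof.
move=> ij ik jk; have H := ord3_cover ij ik jk.
rewrite (bigD1 i)//= (bigD1 j)/=; last by rewrite eq_sym.
rewrite (bigD1 k)/=; last by rewrite ![k == _]eq_sym ik jk.
rewrite big1 ?addr0 ?addrA// => x /andP[/andP[xi xj] xk].
by have := H x; rewrite (negbTE xi) (negbTE xj) (negbTE xk).
Qed.

Lemma exists_smallest_pair (A : 'M[R]_3) : (forall x y, A x y = A y x) ->
  exists i j k : 'I_3, [/\ i != j, i != k, j != k, A i j <= A i k & A i j <= A j k].
Proof.
move=> sA.
have [h1|h1] := leP (A 0 1) (A 0 2%:R).
  have [h2|h2] := leP (A 0 1) (A 1 2%:R); first by exists 0, 1, 2%:R.
  exists 1, 2%:R, 0; split => //; apply: ltW; first by rewrite (sA 1 0).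
  by rewrite (sA 2%:R 0); exact: lt_le_trans h2 h1.
have [h2|h2] := leP (A 0 2%:R) (A 1 2%:R).
  exists 0, 2%:R, 1; split => //; first exact: ltW.
  by rewrite (sA 2%:R).
exists 1, 2%:R, 0; split => //; apply: ltW; last by rewrite (sA 2%:R 0).
by rewrite (sA 1 0); exact: lt_trans h2 h1.
Qed.

Lemma min_entry_le n (u : 'rV[R]_n.+1) i : min_entry u <= u 0 i.
Proof. by rewrite /min_entry; exact: bigmin_le. Qed.

Lemma min_entry_attained n (u : 'rV[R]_n.+1) : exists i, min_entry u = u 0 i.
Proof.
rewrite /min_entry; elim/big_ind : _ => [|x y [i ->] [j ->]|i _]; first by exists 0.
  by rewrite /Num.min; case: ifP => _; [exists i|exists j].
by exists i.
Qed.

Lemma one_invmx_mul n (A : 'M[R]_n) : A \in unitmx -> one_invmx A *m A = const_mx 1.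
Proof. by move=> uA; rewrite /one_invmx mulmxKV. Qed.
End order3.

Theorem theorem1p6 (R : realType) (d : measure_display) (T : measurableType d)
    (P : probability T R) (X : 'I_3 -> {RV P >-> R}) (A : 'M[R]_3) :
  gaussian_vector X -> standard X -> fully_supported X ->
  (forall i j, covariance P (X i) (X j) = (A i j)%:E) ->
  (forall i j : 'I_3, (i < j)%N -> 0 <= A i j < 1) ->
  ((forall i j : 'I_3, (i < j)%N -> 0 < A i j) ->
     ((\forall h \near +oo, has_color_representation P (threshold X h)) <->
        [\/ cond_pos A, cond_zero A | cond_neg A]) /\
     [/\ ~ (cond_pos A /\ cond_zero A), ~ (cond_pos A /\ cond_neg A)
       & ~ (cond_zero A /\ cond_neg A)]) /\
  (#|[set ij : 'I_3 * 'I_3 | (ij.1 < ij.2)%N && (A ij.1 ij.2 == 0)]%SET| = 1%N ->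
     \forall h \near +oo, ~ has_color_representation P (threshold X h)).
Proof.
move=> gX sX fX covX A01.
have [d' [T' [P' [N [m [iN mA law pd]]]]]] := gaussian_vector3_representation gX sX fX covX.
have symA x y : A x y = A y x by rewrite -!mA dot3C.
have A1 x : A x x = 1.
  have [_] := sX x; rewrite /variance (covX x x) => -[].
  by [].
have A01' x y : x != y -> 0 <= A x y < 1.
  move=> xy; have [lt|gt|/val_inj e] := ltngtP (x : nat) y.
  - exact: A01.
  - by rewrite symA; exact: A01.
  - by rewrite e eqxx in xy.
have quadE (v : 'rV[R]_3) : (v *m A *m v^T) 0 0 =
    \sum_y (\sum_x v 0 x * A x y) * v 0 y.
  by rewrite mxE; apply: eq_bigr => y _; rewrite !mxE.
(* The quadratic form is the squared length of the combination of the [m x] with coefficients [v];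
   if it vanishes, [v] is a linear relation, excluded by [pd]. Invertibility of [A] and positivity
   of [det3] both follow. *)
have quad (v : 'rV[R]_3) : (v *m A *m v^T) 0 0 <= 0 -> v = 0.
  pose s : R * R * R := (\sum_x v 0 x * (m x).1.1, \sum_x v 0 x * (m x).1.2, \sum_x v 0 x * (m x).2).
  have -> : (v *m A *m v^T) 0 0 = dot3 s s.
    rewrite quadE /dot3 /= !(@sum_ord3 _ 0 1 2%:R)// -!mA /dot3.
    by ring.
  move=> ss; apply: pd => t.
  have [s1 s2 s3] : [/\ s.1.1 = 0, s.1.2 = 0 & s.2 = 0].
    move: ss; rewrite /dot3 -!expr2 => ss.
    have h1 := sqr_ge0 s.1.1; have h2 := sqr_ge0 s.1.2; have h3 := sqr_ge0 s.2.
    by split; apply/eqP; rewrite -sqrf_eq0; apply/eqP; lra.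
  transitivity (dot3 s (N t)); last by rewrite /dot3 s1 s2 s3; ring.
  by rewrite /dot3 /= !(@sum_ord3 _ 0 1 2%:R)//; ring.
have uA : A \in unitmx.
  rewrite -row_free_unit; apply: inj_row_free => v vA.
  by apply: quad; rewrite vA mul0mx mxE.
have [i [j [k [ij ik jk ab ac]]]] := exists_smallest_pair symA.
set a := A i j in ab ac. set b := A i k in ab. set c := A j k in ac.
have [/andP[a0 a1] /andP[b0 b1] /andP[c0 c1]] : [/\ 0 <= a < 1, 0 <= b < 1 & 0 <= c < 1].
  by split; exact: A01'.
have [ji ki kj] : [/\ A j i = a, A k i = b & A k j = c] by split; rewrite symA.
have a2 : 0 < 1 - a ^+ 2 by rewrite subr_gt0 expr_lt1.
have D0 : 0 < det3 a b c.
  (* [v] lists, up to a factor, the coefficients of the residual of the regression of X_k on X_i, X_j. *)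
  pose v := \row_x (if x == k then 1 - a ^+ 2 else if x == i then a * c - b else a * b - c).
  have vk : v 0 k = 1 - a ^+ 2 by rewrite mxE eqxx.
  have vi : v 0 i = a * c - b by rewrite mxE (negbTE ik) eqxx.
  have vj : v 0 j = a * b - c by rewrite mxE (negbTE jk) eq_sym (negbTE ij).
  have vq : (v *m A *m v^T) 0 0 = (1 - a ^+ 2) * det3 a b c.
    rewrite quadE !(sum_ord3 _ ij ik jk) !A1 ji ki kj -/a -/b -/c vk vi vj /det3.
    by ring.
  rewrite ltNge; apply/negP => Dn.
  have v0 : v = 0 by apply: quad; rewrite vq mulr_ge0_le0// ltW.
  by move: vk a2; rewrite v0 mxE => <-; rewrite ltxx.
pose W x t := dot3 (m x) (N t).
have G : gauss3 P' a b c (W i) (W j) (W k).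
  by exists N, (m i), (m j), (m k); split => //; split; rewrite mA.
(* Color representations depend only on the probabilities of the orthants, which agree on the two
   spaces. *)
have repE h : has_color_representation P (threshold X h) <->
    has_color_representation P' (fun x t => h < W x t).
  by split=> -[p [q [p01 hq H]]]; exists p, q; split => // y; rewrite -H law.
have cov := ord3_cover ij ik jk.
split=> [Apos|card1]; last first.
  have zpair x y : x != y -> A x y = 0 ->
      (if (x < y)%N then (x, y) else (y, x)) \in
      [set ij : 'I_3 * 'I_3 | (ij.1 < ij.2)%N && (A ij.1 ij.2 == 0)]%SET.
    move=> xy Axy; case: ltngtP => [lt|gt|/val_inj e]; rewrite inE /=.
    - by rewrite lt Axy eqxx.
    - by rewrite gt symA Axy eqxx.
    - by rewrite e eqxx in xy.
  have /cards1P[z0 zE] := introT eqP card1.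
  have uniq0 x y x' y' : x != y -> x' != y' -> A x y = 0 -> A x' y' = 0 ->
      (x == x') && (y == y') || (x == y') && (y == x').
    move=> xy xy' /(zpair _ _ xy) + /(zpair _ _ xy'); rewrite zE !inE => /eqP <-.
    case: ifP => _; case: ifP => _ /eqP[-> ->]; rewrite !eqxx ?orbT//.
  (* The vanishing covariance is at least the smallest one, [a], which is nonnegative; uniqueness of
     the zero then makes [b] and [c] positive. *)
  have az : a = 0.
    have : z0 \in [set ij : 'I_3 * 'I_3 | (ij.1 < ij.2)%N && (A ij.1 ij.2 == 0)]%SET.
      by rewrite zE inE.
    rewrite inE => /andP[lt /eqP z00].
    have : z0.1 != z0.2 by apply: contraTneq lt => ->; rewrite ltnn.
    move: z00 {lt}; move: z0.1 z0.2 => x y Axy xy.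
    have : a <= A x y.
      move: xy Axy; case/or3P: (cov x) => /eqP ->; case/or3P: (cov y) => /eqP ->;
        rewrite ?eqxx// => _ _; rewrite ?ji ?ki ?kj -/a -/b -/c //.
    by rewrite Axy => a0'; apply/eqP; rewrite eq_le a0 a0'.
  have bp : 0 < b.
    rewrite lt_neqAle b0 andbT eq_sym; apply/eqP => bz.
    have := uniq0 _ _ _ _ ij ik az bz.
    by rewrite eqxx (negbTE jk) (negbTE ik).
  have cp : 0 < c.
    rewrite lt_neqAle c0 andbT eq_sym; apply/eqP => cz.
    have := uniq0 _ _ _ _ ij jk az cz.
    by rewrite eqxx (negbTE ij) (negbTE ik).
  near=> h; rewrite repE; near: h.
  exact: (eventually_no_color_representation_zero ij ik jk cov G a0 ab ac bp b1 cp c1 D0 az).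
have pos x y : x != y -> 0 < A x y.
  move=> xy; have [lt|gt|/val_inj e] := ltngtP (x : nat) y.
  - exact: Apos.
  - by rewrite symA; exact: Apos.
  - by rewrite e eqxx in xy.
have [ap bp cp] : [/\ 0 < a, 0 < b & 0 < c] by split; exact: pos.
set l := one_invmx A.
have lA y : l 0 i * A i y + l 0 j * A j y + l 0 k * A k y = 1.
  have := one_invmx_mul uA => /matrixP/(_ 0 y).
  by rewrite [RHS]mxE mxE (sum_ord3 _ ij ik jk).
have eqi := lA i; have eqj := lA j; have eqk := lA k.
rewrite A1 ji ki mulr1 in eqi; rewrite A1 kj -/a mulr1 in eqj; rewrite A1 -/b -/c mulr1 in eqk.
have [li lj lk] := cramer3 eqi eqj eqk.
have lsum : det3 a b c * (l *m const_mx 1 : 'M[R]_1) 0 0 = cofactor_sum a b c.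
  rewrite mxE; under eq_bigr => x _ do rewrite [const_mx _ _ _]mxE mulr1.
  by rewrite (sum_ord3 _ ij ik jk) !mulrDr li lj lk /cofactor_sum; ring.
have lip : 0 < l 0 i.
  by rewrite -(pmulr_rgt0 _ D0) li (cofactor_row_gt0 ac b1 c1).
have ljp : 0 < l 0 j.
  by rewrite -(pmulr_rgt0 _ D0) lj (cofactor_row_gt0 ab c1 b1).
have [x0 minx0] := min_entry_attained l.
have lmin := min_entry_le l.
split; last first.
  split=> -[].
  - by move=> hp hz; have := hp x0; rewrite -/l -minx0 hz ltxx.
  - by move=> hp [hn _]; have := hp x0; rewrite -/l -minx0 ltNge ltW.
  - by move=> hz [hn _]; move: hn; rewrite hz ltxx.
have a1p : 0 < 1 - a by lra.
split=> [rep|].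
  (* Since the entries at [i] and [j] are positive, the sign of the entry at [k] decides which
     condition can hold. *)
  have [lk0|lk0|lk0] := ltgtP (l 0 k) 0.
  - have bc : 1 + a < b + c.
      have : (1 - a) * (1 + a - b - c) < 0 by rewrite -lk pmulr_rlt0.
      by rewrite pmulr_rlt0//; lra.
    apply: Or33; split; first exact: le_lt_trans (lmin k) lk0.
    rewrite ltNge; apply/negP => f2.
    have cond : 2 * det3 a b c <= cofactor_sum a b c by rewrite -lsum mulrC ler_pM2l.
    have norep := eventually_no_color_representation_neg ij ik jk cov G a0 ab ac bp b1 cp c1 D0 bc cond.
    (* Two properties that hold for all large [h] hold together at some [h]. *)
    have [h [hrep]] := filter_ex (filterI rep norep).
    by apply; exact/repE.
  - apply: Or31 => x; case/or3P: (cov x) => /eqP ->; exact.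
  - apply: Or32; rewrite /cond_zero -/l; apply/eqP; rewrite eq_le -{1}lk0 lmin /= minx0.
    by case/or3P: (cov x0) => /eqP ->; rewrite ?lk0// ltW.
move=> cond.
have cond' : b + c <= 1 + a \/ cofactor_sum a b c < 2 * det3 a b c.
  have geS : 0 <= l 0 k -> b + c <= 1 + a.
    by rewrite -(pmulr_rge0 _ D0) lk pmulr_rge0//; lra.
  case: cond => [hp|hz|[_ f2]].
  - by left; apply/geS/ltW/hp.
  - by left; apply: geS; rewrite -hz lmin.
  - by right; rewrite -lsum mulrC ltr_pM2r.
near=> h; rewrite repE; near: h.
exact: (eventually_color_representation ij ik jk cov G a0 ab ac bp b1 cp c1 D0 ap cond').
Unshelve. all: by end_near. Qed.
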